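(* When $\mathrm{M}$ has no loops and no coloops, we have \[ \overline{\chi}_{\mathrm{M}}(q+1)=\sum_{k=0}^r (-1)^{r-k} \deg( \gamma^k\, \delta^{n-k-1}) \, q^k, \] where the degrees are taken with respect to the top-dimensional constant Minkowski weight $1_{\mathrm{M},\mathrm{M}^\perp}$ on the conormal fan.
   Context: Let $\mathrm{M}$ be a matroid of rank $r+1$ on a finite set $E$ with $|E|=n+1$, $n\ge1$, with dual $\mathrm{M}^\perp$. $\overline{\chi}_{\mathrm{M}}(q)=\chi_{\mathrm{M}}(q)/(q-1)$ is the reduced characteristic polynomial, where $\chi_{\mathrm{M}}(q)=\sum_{F}\mu(\varnothing,F)q^{\mathrm{corank}(F)}$ over flats $F$. Let $\mathrm{N}_{E,E}=\mathbb{R}^E/\mathbb{R}\mathbf{e}_E\oplus\mathbb{R}^E/\mathbb{R}\mathbf{f}_E$. A biflat of $\mathrm{M}$ is a pair $F|G$ with $F$ a flat of $\mathrm{M}$, $G$ a flat of $\mathrm{M}^\perp$, both nonempty, not both $E$, and $F\cup G=E$; a flag of biflats is a set of biflats pairwise comparable (i.e. $F\subseteq F'$ and $G\supseteq G'$, or the reverse) such that the union of the $F\cap G$ over its members is not $E$. The conormal fan $\Sigma_{\mathrm{M},\mathrm{M}^\perp}$ is the $(n-1)$-dimensional unimodular fan in $\mathrm{N}_{E,E}$ with cones $\mathrm{cone}\{\mathbf{e}_F+\mathbf{f}_G\}$ over flags of biflats; its support is the product of the tropical linear spaces of $\mathrm{M}$ and $\mathrm{M}^\perp$. In its Chow ring,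 $\gamma$ is the class of the piecewise linear functions $\gamma_j(z,w)=\max_{i\in E}(z_j-z_i)$ and $\delta$ the class of $\delta_j(z,w)=\max_{i\in E}(z_j+w_j-z_i-w_i)$ (independent of $j$ modulo linear functions). The degree map on degree $n-1$ is the linear isomorphism given by capping with the constant weight $1_{\mathrm{M},\mathrm{M}^\perp}$, sending the monomial of any maximal flag of biflats to $1$. *)

(* Defs.v *)
From HB Require Import structures.
From mathcomp Require Import all_boot all_order all_algebra.
From mathcomp Require Import boolp reals.
From mathcomp.multinomials Require Import mpoly.

Set Implicit Arguments.
Unset Strict Implicit.
Unset Printing Implicit Defensive.

Import GRing.Theory Num.Theory.

Record matroid (E : finType) := Matroid {
  bases : {set {set E}};
  bases_neq0 : bases != set0;
  bases_exchange : forall B1 B2 x,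
    B1 \in bases -> B2 \in bases -> x \in B1 :\: B2 ->
    exists2 y, y \in B2 :\: B1 & (y |: (B1 :\ x)) \in bases }.

Section Dual.
Variables (E : finType) (M : matroid E).
Implicit Types A B : {set E}.

Lemma card_exchange B (x y : E) :
  x \in B -> y \notin B -> #|y |: (B :\ x)| = #|B|.
Proof.
move=> xB yB; rewrite cardsU1 in_setD1 (negbTE yB) andbF.
by rewrite (cardsD1 x B) xB.
Qed.

Lemma card_bases B1 B2 :
  B1 \in bases M -> B2 \in bases M -> #|B1| = #|B2|.
Proof.
have [m] := ubnP #|B1 :\: B2|; elim: m B1 => // m IHm B1 /ltnSE le_m b1 b2.
have [D0|[x xD]] := set_0Vmem (B1 :\: B2).
  have [D0'|[y yD]] := set_0Vmem (B2 :\: B1).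
    by congr #|pred_of_set _|; apply/eqP; rewrite eqEsubset -!setD_eq0 D0 D0' eqxx.
  by have [z] := bases_exchange b2 b1 yD; rewrite D0 inE.
have [y yD b1'] := bases_exchange b1 b2 xD.
move: (xD) (yD); rewrite !inE => /andP[xB2 xB1] /andP[yB1 yB2].
rewrite -(IHm _ _ b1' b2) ?card_exchange //.
apply: leq_trans le_m; apply: proper_card; apply/properP; split.
  apply/subsetP=> z; rewrite !inE => /andP[zB2 /orP[/eqP zy|/andP[_ ->]]].
    by rewrite zy yB2 in zB2.
  by rewrite zB2.
exists x; first by [].
rewrite !inE eqxx /= orbF xB2 /=; apply: contra yB1 => /eqP <-; exact: xB1.
Qed.

Definition dual_bases : {set {set E}} := [set ~: B | B in bases M].

Lemma mem_dual_bases B : (B \in dual_bases) = (~: B \in bases M).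
Proof.
apply/imsetP/idP => [[C bC ->]|bB]; first by rewrite setCK.
by exists (~: B); rewrite ?setCK.
Qed.

Lemma dual_bases_neq0 : dual_bases != set0.
Proof.
case: (set_0Vmem (bases M)) => [e|[B bB]].
  by have := bases_neq0 M; rewrite e eqxx.
by apply/set0Pn; exists (~: B); rewrite mem_dual_bases setCK.
Qed.

Lemma bases_coexchange B1 B2 x :
  B1 \in bases M -> B2 \in bases M -> x \in B2 :\: B1 ->
  exists2 y, y \in B1 :\: B2 & ((x |: B1) :\ y) \in bases M.
Proof.
move=> b1 b2; rewrite inE => /andP[xB1 xB2].
pose P B := [&& B \in bases M, x \in B & B1 :&: B2 \subset B].
have PB2 : P B2 by rewrite /P b2 xB2 subsetIr.
case: (arg_minnP (fun B => #|B :\: B1|) PB2) => B /and3P[bB xB sB] minB.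
have DB : B :\: B1 = [set x].
  apply/eqP; rewrite eqEsubset sub1set !inE xB1 xB !andbT.
  apply/subsetP => z zD; rewrite inE; apply/negPn/negP => zx.
  have [y yD bB'] := bases_exchange bB b1 zD.
  move: (zD) (yD); rewrite !inE => /andP[zB1 zB] /andP[yB yB1].
  have PB' : P (y |: (B :\ z)).
    rewrite /P bB' !inE [x == z]eq_sym zx xB orbT /=.
    apply/subsetP => t tI; rewrite !inE (subsetP sB) // andbT orbC.
    by case: eqP => // tz; move: tI; rewrite tz inE (negbTE zB1).
  have := minB _ PB'; rewrite leqNgt => /negP; apply.
  apply: proper_card; apply/properP; split.
    apply/subsetP=> t; rewrite !inE => /andP[tB1 /orP[/eqP ty|/andP[_ ->]]].
      by rewrite ty yB1 in tB1.
    by rewrite tB1.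
  exists z; first by [].
  rewrite !inE eqxx /= orbF zB1 /=; apply: contra zB1 => /eqP ->; exact: yB1.
have : #|B1 :\: B| = 1%N.
  apply/eqP; rewrite -(eqn_add2l #|B1 :&: B|) cardsID (card_bases b1 bB).
  by rewrite -(cardsID B1 B) DB cards1 setIC.
move/eqP/cards1P => [y Dy].
have /[!inE]/andP[yB yB1] : y \in B1 :\: B by rewrite Dy inE.
exists y.
  rewrite inE yB1 andbT; apply: contra yB => yB2.
  by apply: (subsetP sB); rewrite inE yB1.
suff -> : (x |: B1) :\ y = B by [].
apply/setP => t; rewrite !inE.
have := congr1 (fun A : {set E} => t \in A) DB.
have := congr1 (fun A : {set E} => t \in A) Dy.
rewrite !inE => <-.
by case: (t \in B1); case tB: (t \in B) => //= <-.
Qed.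

Lemma dual_exchange B1 B2 x :
  B1 \in dual_bases -> B2 \in dual_bases -> x \in B1 :\: B2 ->
  exists2 y, y \in B2 :\: B1 & (y |: (B1 :\ x)) \in dual_bases.
Proof.
rewrite !mem_dual_bases => b1 b2 xD.
have xD' : x \in ~: B2 :\: ~: B1 by move: xD; rewrite !inE negbK andbC.
have [y yD bB] := bases_coexchange b1 b2 xD'.
exists y; first by move: yD; rewrite !inE negbK andbC.
rewrite mem_dual_bases; suff -> : ~: (y |: (B1 :\ x)) = (x |: ~: B1) :\ y by [].
by apply/setP => t; rewrite !inE !(negb_or, negb_and, negbK).
Qed.

Definition dual_matroid : matroid E := Matroid dual_bases_neq0 dual_exchange.

Definition rank A : nat := \max_(B in bases M) #|A :&: B|.

Definition flats : {set {set E}} :=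
  [set F : {set E} | [forall (x : E | x \notin F), rank F < rank (x |: F)]].

Definition corank A : nat := rank [set: E] - rank A.

Definition is_loop (x : E) : bool := [forall (B | B \in bases M), x \notin B].

End Dual.

Definition loopless (E : finType) (M : matroid E) : bool :=
  [forall x, ~~ is_loop M x].

Definition coloopless (E : finType) (M : matroid E) : bool := loopless (dual_matroid M).

Section Mobius.
Variables (E : finType) (P : {set {set E}}).

Fixpoint mobius_rec (fuel : nat) (A B : {set E}) : int :=
  if fuel is fuel'.+1 then
    if A == B then 1%R
    else (- \sum_(C in P | (A \subset C) && (C \proper B)) mobius_rec fuel' A C)%R
  else 0%R.

(* Moebius function of P ordered by inclusion: mobiusE is its recurrence. *)
Definition mobius (A B : {set E}) : int := mobius_rec #|B|.+1 A B.

Lemma mobiusE A B : mobius A B =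
  if A == B then 1%R
  else (- \sum_(C in P | (A \subset C) && (C \proper B)) mobius A C)%R.
Proof.
have rec_fuel m k (C : {set E}) : (#|C| < m)%N -> (#|C| < k)%N ->
    mobius_rec m A C = mobius_rec k A C.
  elim: m k C => // m IHm [//|k] C /ltnSE Cm /ltnSE Ck /=.
  case: ifP => // _; congr (- _)%R; apply: eq_bigr => D /and3P[_ _ /proper_card DC].
  by apply: IHm; apply: leq_trans DC _.
rewrite {1}/mobius /=; case: ifP => // _.
congr (- _)%R; apply: eq_bigr => D /and3P[_ _ /proper_card DB].
by apply: rec_fuel.
Qed.

End Mobius.

Local Open Scope ring_scope.

Section CharacteristicPolynomial.
Variables (R : realType) (E : finType) (M : matroid E).

Definition matroid_charpoly : {poly R} :=
  \sum_(F in flats M) (mobius (flats M) set0 F)%:~R *: 'X^(corank M F).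

Definition reduced_matroid_charpoly : {poly R} := matroid_charpoly %/ ('X - 1).

End CharacteristicPolynomial.

Section Biflats.
Variables (E : finType) (M : matroid E).

(* The pair (F, G) stands for F|G. *)
Definition is_biflat (x : {set E} * {set E}) : bool :=
  [&& x.1 \in flats M, x.2 \in flats (dual_matroid M), x.1 != set0, x.2 != set0,
      ~~ ((x.1 == [set: E]) && (x.2 == [set: E])) & x.1 :|: x.2 == [set: E]].

Definition biflat : Type := {x : {set E} * {set E} | is_biflat x}.

Definition bF (b : biflat) : {set E} := (val b).1.
Definition bG (b : biflat) : {set E} := (val b).2.

Definition biflat_le (b c : biflat) : bool :=
  (bF b \subset bF c) && (bG c \subset bG b).

Definition is_flag (D : {set biflat}) : bool :=
  [forall b in D, forall c in D, biflat_le b c || biflat_le c b]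
  && (\bigcup_(b in D) (bF b :&: bG b) != [set: E]).

End Biflats.

Section ConormalFan.
Variables (R : realType) (E : finType).

Definition indicator (A : {set E}) : {ffun E -> R^o} := [ffun i => (i \in A)%:R].

(* Points of N_{E,E} are given by representatives (z, w) in R^E x R^E. *)
Definition ambient : lmodType R := ({ffun E -> R^o} * {ffun E -> R^o})%type.

(* l descends to a linear function on N_{E,E}, the quotient of R^E x R^E by
   the span of (e_E, 0) and (0, f_E). *)
Definition descends (l : ambient -> R) : Prop :=
  l (indicator [set: E], 0) = 0 /\ l (0, indicator [set: E]) = 0.

(* The bigops start at 0, which is the term i = j of the maximum. *)
Definition gamma_pl (j : E) (p : ambient) : R :=
  \big[Num.max/0]_(i : E) (p.1 j - p.1 i).

Definition delta_pl (j : E) (p : ambient) : R :=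
  \big[Num.max/0]_(i : E) (p.1 j + p.2 j - p.1 i - p.2 i).

End ConormalFan.

Section ChowRing.
Variables (R : realType) (E : finType) (M : matroid E).

Local Notation polyring := {mpoly R[#|{: biflat M}|]}.

(* The primitive generator e_F + f_G of the ray of F|G. *)
Definition ray (b : biflat M) : ambient R E :=
  (indicator R (bF b), indicator R (bG b)).

Definition ray_var (b : biflat M) : polyring := 'X_(enum_rank b).

Definition cone_monomial (D : {set biflat M}) : polyring :=
  \prod_(b in D) ray_var b.

(* A piecewise linear function on a unimodular fan is determined by its values
   on the primitive ray generators. *)
Definition pl_poly (phi : ambient R E -> R) : polyring :=
  \sum_(b : biflat M) phi (ray b) *: ray_var b.

(* The condition on set0 only matters when E is empty: otherwise set0 is a
   flag, spanning the cone {0}. *)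
Definition stanley_reisner (p : polyring) : Prop :=
  exists2 D : {set biflat M}, (D != set0) && ~~ is_flag D & p = cone_monomial D.

Definition linear_relation (p : polyring) : Prop :=
  exists2 l : {linear ambient R E -> R^o}, descends l & p = pl_poly l.

Definition chow_ideal : {pred polyring} := fun p =>
  `[< exists2 s : seq (polyring * polyring),
        (forall u, u \in s -> stanley_reisner u.2 \/ linear_relation u.2)
        & p = \sum_(u <- s) u.1 * u.2 >].

Lemma generator_mcoeff0 (p : polyring) :
  stanley_reisner p \/ linear_relation p -> p@_0%MM = 0.
Proof.
have var0 b : (ray_var b)@_0%MM = 0.
  rewrite /ray_var mcoeffX; case: eqP => // e.
  by have := congr1 (fun m : 'X_{1..#|{: biflat M}|} => m (enum_rank b)) e;
     rewrite mnm1E eqxx mnm0E.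
case=> [[D /andP[/set0Pn[b bD] _] ->]|[l _ ->]].
  by rewrite /cone_monomial (bigD1 b bD) /= rmorphM /= var0 mul0r.
by rewrite /pl_poly raddf_sum big1 // => b _; rewrite /= mcoeffZ var0 mulr0.
Qed.

Lemma chow_ideal_closed : idealr_closed chow_ideal.
Proof.
split.
- by apply/asboolP; exists [::]; rewrite // big_nil.
- apply/negP => /asboolP[s gen /(congr1 (mcoeff 0%MM))].
  rewrite mcoeff1 eqxx raddf_sum /= big_seq big1 ?oner_eq0; last first.
    by move=> u /gen/generator_mcoeff0 u0; rewrite rmorphM /= u0 mulr0.
  by move/eqP; rewrite oner_eq0.
- move=> a p q /asboolP[s sgen ->] /asboolP[t tgen ->]; apply/asboolP.
  exists ([seq (a * u.1, u.2) | u <- s] ++ t).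
    by move=> u; rewrite mem_cat => /orP[/mapP[v vs ->]|]; [exact: (sgen v) | exact: tgen].
  rewrite big_cat big_map mulr_sumr; congr (_ + _).
  by apply: eq_bigr => u _; rewrite mulrA.
Qed.

HB.instance Definition _ := isIdealr.Build polyring chow_ideal chow_ideal_closed.

Definition chow_idealr : idealr polyring := chow_ideal.
Definition chow : Type := {ideal_quot chow_idealr}.

HB.instance Definition _ := GRing.ComNzRing.on chow.
HB.instance Definition _ := NzRingQuotient.on chow.

Definition chow_class : polyring -> chow := \pi_chow%qT.

Lemma chow_class_is_zmod_morphism : zmod_morphism chow_class.
Proof. by move=> p q; rewrite /chow_class !rmorphB. Qed.

Lemma chow_class_is_monoid_morphism : monoid_morphism chow_class.
Proof. by split => [|p q]; rewrite /chow_class ?rmorph1 ?rmorphM. Qed.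

HB.instance Definition _ :=
  GRing.isZmodMorphism.Build polyring chow chow_class chow_class_is_zmod_morphism.
HB.instance Definition _ :=
  GRing.isMonoidMorphism.Build polyring chow chow_class chow_class_is_monoid_morphism.

Definition chow_scale (c : R) (a : chow) : chow := chow_class c%:MP * a.

Lemma chow_scaleA c d a : chow_scale c (chow_scale d a) = chow_scale (c * d) a.
Proof. by rewrite /chow_scale mulrA -rmorphM -mpolyCM. Qed.
Lemma chow_scale1 : left_id 1 chow_scale.
Proof. by move=> a; rewrite /chow_scale mpolyC1 rmorph1 mul1r. Qed.
Lemma chow_scaleDr : right_distributive chow_scale +%R.
Proof. by move=> c a b; rewrite /chow_scale mulrDr. Qed.
Lemma chow_scaleDl a : {morph chow_scale^~ a : c d / c + d}.
Proof. by move=> c d; rewrite /chow_scale mpolyCD rmorphD mulrDl. Qed.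

HB.instance Definition _ := GRing.Zmodule_isLmodule.Build R chow
  chow_scaleA chow_scale1 chow_scaleDr chow_scaleDl.

(* The graded piece A^k. *)
Definition chow_graded (k : nat) (a : chow) : Prop :=
  exists2 p : polyring, p \is k.-homog & a = chow_class p.

(* The linear functional on A^k corresponding to a weight w on k-dimensional
   cones under MW_k = Hom(A^k, R). The monomials of the k-dimensional cones span
   A^k, so phi is determined on A^k; it exists exactly when w is balanced. *)
Definition is_cap (k : nat) (w : {set biflat M} -> R) (phi : chow -> R) : Prop :=
  (forall (c : R) (a b : chow), chow_graded k a -> chow_graded k b ->
     phi (c *: a + b) = c * phi a + phi b) /\
  (forall D : {set biflat M}, is_flag D -> #|D| = k ->
     phi (chow_class (cone_monomial D)) = w D).

(* Junk value 0 when no such functional exists. *)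
Definition cap (k : nat) (w : {set biflat M} -> R) : chow -> R :=
  if pselect (exists phi, is_cap k w phi) is left h then projT1 (cid h)
  else fun=> 0.

(* Here #|E|.-2 = n - 1 is the dimension of the conormal fan. *)
Definition degree : chow -> R := cap #|E|.-2 (fun=> 1).

Definition gamma (j : E) : chow := chow_class (pl_poly (gamma_pl j)).

Definition delta (j : E) : chow := chow_class (pl_poly (delta_pl j)).

End ChowRing.

(* Main.v *)
(* Write x_{F|G} for the generators of the Chow ring: gamma_j is the sum of the
   x_{F|G} with j in F and F != E, and delta_j that with j in both F and G. In
   gamma_j^k delta_j^(m+1), expand one factor delta_j. For rank reasons only the
   biflats {j}|E and E|cl*(j) contribute, where cl* is the closure in the dual of
   M, and multiplication by their variables reduces the computation to the
   conormal fans of M/j and of M\j. This is the recursion satisfied by the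
   coefficients of the characteristic polynomial at q + 1, divided by q, and the
   initial values are the degrees of powers of gamma_j. The degree map exists as
   the constant weight is balanced, which lets one define it on monomials by
   descending induction on the size of their support. *)

From HB Require Import structures.
Require Import Defs.
From mathcomp Require Import all_boot all_order all_algebra zify ring.
From mathcomp Require Import boolp reals.
From mathcomp.multinomials Require Import mpoly.

Set Implicit Arguments.
Unset Strict Implicit.
Unset Printing Implicit Defensive.

Import GRing.Theory Num.Theory Order.TTheory.

(** * Rank functions, duality and minors *)

(* lia restricted to the arithmetic hypotheses, for speed. *)
Ltac nlia :=
  try done;
  repeat match goal with
  | H : ?T |- _ =>
    lazymatch T with
    | is_true (leq _ _) => fail
    | is_true (leq _ _ && leq _ _) => fail
    | is_true (~~ leq _ _) => fail
    | @eq ?a _ _ => tryif unify a nat then fail else clear H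
    | ~ @eq ?a _ _ => tryif unify a nat then fail else clear H
    | is_true (@eq_op ?a _ _) => tryif unify (Equality.sort a) nat then fail else clear H
    | is_true (~~ @eq_op ?a _ _) => tryif unify (Equality.sort a) nat then fail else clear H
    | nat => fail
    | _ => clear H
    end
  end; lia.

(** Deleting j may create coloops and contracting j may create loops, so the recursion leaves the
    class of matroids of the theorem. It is run instead on pairs of dual rank functions [r], [s] on
    subsets [X] of the fixed type [E], with coloops allowed; loops and coloops are not counted among
    the uncovered elements of a flag. If contracting j creates loops, or if deleting j leaves only
    coloops, the corresponding terms vanish on both sides of the recursion.

    The Chow rings of the minors are never built. The model of a minor keeps the ring, composes
    [deg] with multiplication by the variable of {j}|X or of X|S, where S is the closure of {j} in
    [s], and takes sums of old variables as new variables.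

    The vanishing of the other terms comes from two counts: a flag whose last member is X|G has
    fewer than |X| - s G members, and every factor gamma or delta, expanded at a well chosen
    element, covers or separates elements that the flag did not yet distinguish, which cannot go on
    until all are distinguished. *)

Section RankFunctions.
Variable E : finType.
Implicit Types (X A B F G : {set E}) (e i j : E) (r s : {set E} -> nat).

(** Local form of the rank axioms: by the third, an element spanned by a set is spanned by every
    larger set. No ground set is mentioned, so a deletion keeps its rank function and only [X]
    changes. *)
Definition rank_axioms r : Prop :=
  [/\ r set0 = 0,
      forall A e, r A <= r (e |: A) <= (r A).+1
    & forall A B e, A \subset B -> r (e |: A) = r A -> r (e |: B) = r B].

Definition closure X r A : {set E} := [set e in X | r (e |: A) == r A].

Definition is_flat X r F : bool := closure X r F == F.

Section OneRank.
Variables (X : {set E}) (r : {set E} -> nat).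
Hypothesis rP : rank_axioms r.

Lemma rank0 : r set0 = 0. Proof. by case: rP. Qed.

Lemma rankU1 e A : r A <= r (e |: A) <= (r A).+1. Proof. by case: rP. Qed.

Lemma rankU1_sub A B e : A \subset B -> r (e |: A) = r A -> r (e |: B) = r B.
Proof. by case: rP => _ _; apply. Qed.

Lemma rank_ind (P : {set E} -> Prop) A B :
    A \subset B -> P A -> 
    (forall (C : {set E}) e, A \subset C -> C \subset B -> e \in B -> e \notin C ->
       P C -> P (e |: C)) -> P B.
Proof.
move=> sAB PA IH.
have [m] := ubnP #|B :\: A|; elim: m A sAB PA IH => // m IHm A sAB PA IH /ltnSE le_m.
have [D0|[e eD]] := set_0Vmem (B :\: A).
  by suff -> : B = A by []; apply/eqP; rewrite eqEsubset sAB andbT -setD_eq0 D0.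
move: (eD); rewrite inE => /andP[eA eB].
apply: (IHm (e |: A)).
- by rewrite subUset sub1set eB.
- exact: IH.
- move=> C f sC; apply: IH; apply: subset_trans sC; exact: subsetUr.
- apply: leq_trans le_m; apply: proper_card; apply/properP; split.
    by apply/subsetP=> x; rewrite !inE negb_or -andbA => /and3P[_ -> ->].
  by exists e; rewrite ?inE ?eqxx ?eA ?eB.
Qed.

Lemma rank_mono A B : A \subset B -> r A <= r B.
Proof.
move=> sAB; apply: (rank_ind (P := fun B => r A <= r B) sAB) => // C e _ _ _ _ le; apply: leq_trans le _.
by case/andP: (rankU1 e C).
Qed.

Lemma rank_card A : r A <= #|A|.
Proof.
apply: (rank_ind (P := fun B => r B <= #|B|) (sub0set A)) => [|C e _ _ _ eC le]; first by rewrite rank0.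
by rewrite cardsU1 eC add1n; case/andP: (rankU1 e C) => _ /leq_trans->.
Qed.

Lemma rankU_closed A B : (forall e, e \in B -> r (e |: A) = r A) -> r (A :|: B) = r A.
Proof.
move=> AB; apply: (rank_ind (P := fun C => r C = r A) (subsetUl A B)) => // C e sAC _ + eC rC.
rewrite inE; case/orP => [eA|eB]; first by rewrite (subsetP sAC) in eC.
by rewrite -rC; apply: rankU1_sub sAC _; apply: AB.
Qed.

Lemma closure_sub A : closure X r A \subset X.
Proof. by apply/subsetP => e; rewrite inE => /andP[]. Qed.

Lemma sub_closure A : A \subset X -> A \subset closure X r A.
Proof.
move=> sAX; apply/subsetP => e eA; rewrite inE (subsetP sAX) //=.
by rewrite (setUidPr _) ?sub1set.
Qed.

Lemma rank_closure A : A \subset X -> r (closure X r A) = r A.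
Proof.
move=> sAX; have := @rankU_closed A (closure X r A).
rewrite (setUidPr (sub_closure sAX)); apply => e.
by rewrite inE => /andP[_ /eqP].
Qed.

Lemma closure_mono A B : A \subset B -> closure X r A \subset closure X r B.
Proof.
move=> sAB; apply/subsetP => e; rewrite !inE => /andP[-> /eqP h] /=.
by apply/eqP; apply: rankU1_sub h.
Qed.

Lemma closure_flat A : A \subset X -> is_flat X r (closure X r A).
Proof.
move=> sAX; rewrite /is_flat eqEsubset sub_closure ?closure_sub // andbT.
apply/subsetP => e; rewrite !inE => /andP[-> /eqP h] /=.
have := rank_mono (setUS [set e] (sub_closure sAX)).
by case/andP: (rankU1 e A); rewrite h rank_closure // => le1 le2 le3; apply/eqP; nlia.
Qed.

Lemma flat_sub F : is_flat X r F -> F \subset X.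
Proof. by move/eqP <-; apply: closure_sub. Qed.

Lemma closure_min A F : is_flat X r F -> A \subset F -> closure X r A \subset F.
Proof. by move/eqP => {2}<-; apply: closure_mono. Qed.

Lemma flatP F e : is_flat X r F -> e \in X -> e \notin F -> r (e |: F) = (r F).+1.
Proof.
move=> /eqP fF eX; rewrite -{1}fF inE eX /= => /eqP ne.
by case/andP: (rankU1 e F) => le1 le2; nlia.
Qed.

Lemma flat_lt F A e : is_flat X r F -> F \subset A -> e \in X -> e \in A ->
  e \notin F -> r F < r A.
Proof.
move=> fF sFA eX eA eF; rewrite -(flatP fF eX eF); apply: rank_mono.
by rewrite subUset sub1set eA.
Qed.

Lemma flat_eq F A : is_flat X r F -> F \subset A -> A \subset X -> r A <= r F -> A = F.
Proof.
move=> fF sFA sAX le; apply/eqP; rewrite eqEsubset sFA andbT.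
apply/subsetP => e eA; apply/negPn/negP => eF.
by have := flat_lt fF sFA (subsetP sAX _ eA) eA eF; rewrite ltnNge le.
Qed.

Lemma ground_flat : is_flat X r X.
Proof. by rewrite /is_flat eqEsubset closure_sub sub_closure. Qed.

Lemma loops_sub F : is_flat X r F -> closure X r set0 \subset F.
Proof. by move=> fF; apply: closure_min; rewrite // sub0set. Qed.

Lemma mem_loops e : e \in X -> (e \in closure X r set0) = (r [set e] == 0).
Proof. by move=> eX; rewrite inE eX setU0 rank0. Qed.

Lemma rank0_flat F : is_flat X r F -> r F = 0 -> F = closure X r set0.
Proof.
move=> fF rF; apply: (flat_eq _ (loops_sub fF) (flat_sub fF)).
  by rewrite closure_flat ?sub0set.
by rewrite rF.
Qed.

Lemma rank1_le e : r [set e] <= 1.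
Proof. by have := rankU1 e set0; rewrite rank0 setU0 => /andP[]. Qed.

End OneRank.

(** The formula for the rank in the dual matroid, without subtraction. It is required only inside
    [X], as the rank functions of minors remain defined on all subsets of [E]. *)
Definition dual_ranks X r s : Prop :=
  [/\ rank_axioms r, rank_axioms s
    & forall A, A \subset X -> s A + r X = #|A| + r (X :\: A)].

Section Duality.
Variables (X : {set E}) (r s : {set E} -> nat).
Hypothesis d : dual_ranks X r s.

Let rP : rank_axioms r. Proof. by case: d. Qed.
Let sP : rank_axioms s. Proof. by case: d. Qed.

Lemma dual_rank A : A \subset X -> s A + r X = #|A| + r (X :\: A).
Proof. by case: d => _ _; apply. Qed.

Lemma dual_total : r X + s X = #|X|.
Proof. by have := dual_rank (subxx X); rewrite setDv (rank0 rP) addn0 addnC. Qed.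

Lemma dual_ranks_sym : dual_ranks X s r.
Proof.
split=> // A sAX.
have := dual_rank (subsetDl X A); have := dual_total.
rewrite setDDr setDv set0U (setIidPr sAX).
have := cardsID A X; rewrite (setIidPr sAX); nlia.
Qed.

(* Orthogonality of circuits and cocircuits, in terms of their complements. *)
Lemma flat_dual_flat_setU F G e :
  is_flat X r F -> is_flat X s G -> X :\: (F :|: G) != [set e].
Proof.
move=> fF fG; apply/negP => /eqP D.
have : e \in X :\: (F :|: G) by rewrite D inE.
rewrite !inE negb_or => /andP[/andP[eF eG] eX].
have := flatP sP fG eX eG.
have sG := flat_sub fG.
have := dual_rank sG; have := @dual_rank (e |: G).
rewrite subUset sub1set eX sG => /(_ isT); rewrite cardsU1 eG => h1 h2 h3.
(* Since e raises the rank of G in [s], it does not raise the rank of A in [r]. But A lies in F, so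
   F would span e. *)
pose A := X :\: (e |: G).
have eA : e |: A = X :\: G.
  by apply/setP => x; rewrite !inE; case: eqP => [->|]; rewrite ?eG ?eX.
have rA : r (e |: A) = r A by rewrite eA /A; nlia.
have sAF : A \subset F.
  apply/subsetP => x; rewrite !inE negb_or => /andP[/andP[xe xG] xX].
  have : x \notin X :\: (F :|: G) by rewrite D inE.
  by rewrite !inE xX andbT negbK (negbTE xG) orbF.
by have := rankU1_sub rP sAF rA; rewrite (flatP rP fF eX eF); nlia.
Qed.

End Duality.

Definition contraction r j A : nat := r (j |: A) - r [set j].

Section Minors.
Variables (X : {set E}) (r s : {set E} -> nat) (j : E).
Hypotheses (d : dual_ranks X r s) (jX : j \in X).

Let rP : rank_axioms r. Proof. by case: d. Qed.
Let sP : rank_axioms s. Proof. by case: d. Qed.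

Lemma contractionE A : contraction r j A + r [set j] = r (j |: A).
Proof. by rewrite subnK // (rank_mono rP) // subsetUl. Qed.

Lemma contraction_axioms : rank_axioms (contraction r j).
Proof.
have cE := contractionE; split.
- by have := cE set0; rewrite setU0; nlia.
- move=> A e; have := cE A; have := cE (e |: A); rewrite setUCA.
  by have := rankU1 rP e (j |: A); nlia.
- move=> A B e sAB; have := cE A; have := cE (e |: A).
  have := cE B; have := cE (e |: B); rewrite ![j |: (e |: _)]setUCA => h1 h2 h3 h4 h.
  have := rankU1_sub rP (setUS [set j] sAB) (e := e); nlia.
Qed.

(** Contraction is dual to deletion, which leaves [s] unchanged. Deletion from [r] is the same
    statement with [r] and [s] exchanged. *)
Lemma dual_ranks_contraction : dual_ranks (X :\ j) (contraction r j) s.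
Proof.
split; [exact: contraction_axioms | exact: sP | move=> A sA].
have jA : j \notin A by apply/negP => /(subsetP sA); rewrite !inE eqxx.
have := dual_rank d (subset_trans sA (subsetDl _ _)).
have := contractionE (X :\ j); have := contractionE (X :\ j :\: A).
rewrite setD1K //.
have -> : j |: (X :\ j :\: A) = X :\: A.
  by apply/setP => x; rewrite !inE; case: eqP => [->|_]; rewrite ?jX ?jA ?andbT.
nlia.
Qed.

Lemma closure_deletion A : closure (X :\ j) s A = closure X s A :\ j.
Proof. by apply/setP => x; rewrite !inE andbA. Qed.

Lemma closure_contraction A :
  closure (X :\ j) (contraction r j) A = closure X r (j |: A) :\ j.
Proof.
apply/setP => x; rewrite !inE -andbA; congr (_ && (_ && _)).
have := contractionE A; have := contractionE (x |: A); rewrite setUCA.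
by move=> h1 h2; apply/eqP/eqP; nlia.
Qed.

Lemma flat_contraction F : F \subset X -> j \in F ->
  is_flat (X :\ j) (contraction r j) (F :\ j) = is_flat X r F.
Proof.
move=> sFX jF; rewrite /is_flat closure_contraction setD1K //.
apply/eqP/eqP => [h|-> //].
rewrite -[RHS](setD1K jF) -h setD1K //.
exact: (subsetP (sub_closure _ sFX)).
Qed.

Lemma flat_deletion G : is_flat X s G -> is_flat (X :\ j) s (G :\ j).
Proof.
move=> fG; rewrite /is_flat eqEsubset; apply/andP; split; last first.
  by apply: sub_closure; apply: setSD; apply: flat_sub fG.
by rewrite closure_deletion; apply/setSD/(closure_min sP fG)/subsetDl.
Qed.

Lemma closure_flat_deletion G :
  is_flat (X :\ j) s G -> closure X s G :\ j = G.
Proof. by rewrite /is_flat closure_deletion => /eqP. Qed.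

End Minors.
End RankFunctions.

(** * Flags of pairs of flats *)

Section Flags.
Variables (E : finType) (X : {set E}) (r s : {set E} -> nat).
Local Notation pair := ({set E} * {set E})%type.
Implicit Types (b c : pair) (t : seq pair) (e i : E).

Local Notation loops := (closure X r set0).
Local Notation coloops := (closure X s set0).

(** Only the bottom and the top of the order [pair_le] are excluded, instead of the pairs with an
    empty component, because minors may have coloops. The pair (X, X) is kept, but it belongs to no
    flag. *)
Definition is_flat_pair b : bool :=
  [&& is_flat X r b.1, is_flat X s b.2, b.1 :|: b.2 == X,
      b != (loops, X) & b != (X, coloops)].

Definition pair_le b c : bool := (b.1 \subset c.1) && (c.2 \subset b.2).

Definition pair_cmp b c : bool := pair_le b c || pair_le c b.

Definition covered t e : bool := has (fun b => e \in b.1 :&: b.2) t.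

Arguments covered : simpl never.

(** Without loops and coloops, this is the complement of the union of the F ∩ G. *)
Definition residue t : {set E} :=
  [set e in X | [&& e \notin loops, e \notin coloops & ~~ covered t e]].

(** Sequences with repetitions are allowed, so that they index all monomials. *)
Definition flag t : bool :=
  [&& all is_flat_pair t, allrel pair_cmp t t & residue t != set0].

Lemma pair_lexx b : pair_le b b. Proof. by rewrite /pair_le !subxx. Qed.

Lemma pair_le_trans b c d : pair_le b c -> pair_le c d -> pair_le b d.
Proof.
move=> /andP[h1 h2] /andP[h3 h4].
by rewrite /pair_le (subset_trans h1 h3) (subset_trans h4 h2).
Qed.

Lemma pair_le_anti b c : pair_le b c -> pair_le c b -> b = c.
Proof.
case: b c => [F G] [F' G'] /andP[/= h1 h2] /andP[/= h3 h4].
by congr (_, _); apply/eqP; rewrite eqEsubset ?h1 ?h2 ?h3 ?h4.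
Qed.

Lemma pair_cmpC b c : pair_cmp b c = pair_cmp c b.
Proof. by rewrite /pair_cmp orbC. Qed.

Lemma chain_max t : allrel pair_cmp t t -> t != [::] ->
  exists2 b, b \in t & {in t, forall c, pair_le c b}.
Proof.
elim: t => // b t IH; rewrite allrel_consl => /andP[/= /andP[_ bt]].
rewrite allrel_consr => /andP[_ tt] _.
have [->|t0] := eqVneq t [::].
  by exists b => [|c]; rewrite ?inE // => /eqP->; exact: pair_lexx.
have [c ct cmax] := IH tt t0.
case/orP: (allP bt c ct) => h.
  exists c => [|d]; first by rewrite inE ct orbT.
  by rewrite inE => /orP[/eqP->|/cmax].
exists b => [|d]; first by rewrite inE eqxx.
rewrite inE => /orP[/eqP->|/cmax h']; first exact: pair_lexx.
exact: pair_le_trans h' h.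
Qed.

Lemma chain_min t : allrel pair_cmp t t -> t != [::] ->
  exists2 b, b \in t & {in t, forall c, pair_le b c}.
Proof.
elim: t => // b t IH; rewrite allrel_consl => /andP[/= /andP[_ bt]].
rewrite allrel_consr => /andP[_ tt] _.
have [->|t0] := eqVneq t [::].
  by exists b => [|c]; rewrite ?inE // => /eqP->; exact: pair_lexx.
have [c ct cmin] := IH tt t0.
case/orP: (allP bt c ct) => h.
  exists b => [|d]; first by rewrite inE eqxx.
  rewrite inE => /orP[/eqP->|/cmin h']; first exact: pair_lexx.
  exact: pair_le_trans h h'.
exists c => [|d]; first by rewrite inE ct orbT.
by rewrite inE => /orP[/eqP->|/cmin].
Qed.

Lemma covered_sub t t' e : {subset t' <= t} -> covered t' e -> covered t e.
Proof. by move=> sub /hasP[b bt eb]; apply/hasP; exists b; rewrite ?sub. Qed.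

Lemma flag_sub t t' : {subset t' <= t} -> flag t -> flag t'.
Proof.
move=> sub /and3P[bt ct /set0Pn[e et]]; apply/and3P; split.
- by apply/allP => b /sub; apply: (allP bt).
- by apply/allrelP => b c /sub + /sub; apply: (allrelP ct).
- apply/set0Pn; exists e; move: et; rewrite !inE => /and4P[-> -> -> /=].
  by apply: contra; apply: covered_sub.
Qed.

Lemma flag_pair t b : flag t -> b \in t -> is_flat_pair b.
Proof. by case/and3P => /allP h _ _ /h. Qed.

Lemma flag_cmp t b c : flag t -> b \in t -> c \in t -> pair_cmp b c.
Proof. by case/and3P => _ /allrelP h _; apply: h. Qed.

Lemma flag_le t b c e : flag t -> b \in t -> c \in t ->
  e \in c.1 -> e \notin b.1 -> pair_le b c.
Proof.
move=> ft bt ct ec eb; case/orP: (flag_cmp ft bt ct) => // /andP[/subsetP h _].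
by rewrite h in eb.
Qed.

Hypothesis d : dual_ranks X r s.
Let rP : rank_axioms r. Proof. by case: d. Qed.
Let sP : rank_axioms s. Proof. by case: d. Qed.

Lemma flat_pair_setU b e : is_flat_pair b -> e \in X -> (e \in b.1) || (e \in b.2).
Proof. by case/and5P => _ _ /eqP <- _ _; rewrite inE. Qed.

Lemma pair_sub b : is_flat_pair b -> b.1 \subset X /\ b.2 \subset X.
Proof. by case/and5P => /flat_sub h1 /flat_sub h2 _ _ _. Qed.

(** An uncovered e lies in exactly one component of each member: in the second one before some place
    of the chain, in the first one after it. F is the largest first component before this jump and G
    the largest second component after it, replaced by the loops or the coloops when there is no
    such member. *)
Lemma residue_jump t e : flag t -> e \in residue t ->
  exists F G, [/\ is_flat X r F, is_flat X s G, e \notin F, e \notin G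
    & {in t, forall b, if e \in b.1 then [&& F \subset b.1, b.2 \subset G & e \notin b.2]
                       else [&& b.1 \subset F, G \subset b.2 & e \in b.2]}].
Proof.
move=> ft et; move: (et); rewrite inE => /and4P[eX eL eC /hasPn ecov].
have cfilter (P : pred pair) : allrel pair_cmp (filter P t) (filter P t).
  by apply/allrelP => b c; rewrite !mem_filter => /andP[_ bt] /andP[_ ct]; exact: flag_cmp ft bt ct.
pose lo := [seq b : pair <- t | e \notin b.1]; pose up := [seq b : pair <- t | e \in b.1].
have [F [fF eF loF upF]] : exists F, [/\ is_flat X r F, e \notin F,
    {in lo, forall b, b.1 \subset F} & {in up, forall b, F \subset b.1}].
  have [lo0|lo0] := eqVneq lo [::].
    exists loops; split; rewrite ?closure_flat ?sub0set ?lo0 // => b.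
    by rewrite mem_filter => /andP[_ /(flag_pair ft)/and5P[+ _ _ _ _]]; apply: loops_sub.
  have [p pt pmax] := chain_max (cfilter _) lo0.
  move: pt; rewrite mem_filter => /andP[ep pt].
  exists p.1; split => //; first by case/and5P: (flag_pair ft pt).
    by move=> b /pmax /andP[].
  move=> b; rewrite mem_filter => /andP[eb bt].
  by case/andP: (flag_le ft pt bt eb ep).
have [G [fG eG loG upG]] : exists G, [/\ is_flat X s G, e \notin G,
    {in lo, forall b, G \subset b.2} & {in up, forall b, b.2 \subset G}].
  have [up0|up0] := eqVneq up [::].
    exists coloops; split; rewrite ?closure_flat ?sub0set ?up0 // => b.
    by rewrite mem_filter => /andP[_ /(flag_pair ft)/and5P[_ + _ _ _]]; apply: loops_sub.
  have [p pt pmin] := chain_min (cfilter _) up0.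
  move: pt; rewrite mem_filter => /andP[ep pt].
  exists p.2; split => //; first by case/and5P: (flag_pair ft pt).
  - by have := ecov _ pt; rewrite inE ep.
  - move=> b; rewrite mem_filter => /andP[eb bt].
    by case/andP: (flag_le ft bt pt ep eb).
  - by move=> b /pmin /andP[].
exists F, G; split => // b bt; case: ifP => eb.
  have bup : b \in up by rewrite mem_filter eb.
  by rewrite upF ?upG //=; have := ecov _ bt; rewrite inE eb.
have blo : b \in lo by rewrite mem_filter eb.
rewrite loF ?loG //=; have := flat_pair_setU (flag_pair ft bt) eX.
by rewrite eb.
Qed.

(** By orthogonality, e is not the only element outside the two flats F and G around its jump; any
    other one jumps at the same place. *)
Lemma residue_twin t e : flag t -> e \in residue t ->
  exists e', [/\ e' != e, e' \in residue t & {in t, forall b, (e' \in b.1) = (e \in b.1)}].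
Proof.
move=> ft et; have [F [G [fF fG eF eG FG]]] := residue_jump ft et.
have eX : e \in X by move: et; rewrite inE => /andP[].
have e0 : e \in X :\: (F :|: G) by rewrite !inE negb_or eF eG.
have : X :\: (F :|: G) != [set e] by exact: (flat_dual_flat_setU d _ fF fG).
rewrite eqEsubset sub1set e0 andbT => /subsetPn[e'].
rewrite !inE negb_or => /andP[/andP[e'F e'G] e'X] ne.
have e'b b : b \in t -> (e' \in b.1) = (e \in b.1).
  move=> bt; have := FG b bt; case: ifP => eb /and3P[h1 h2 h3].
    have := flat_pair_setU (flag_pair ft bt) e'X.
    by rewrite (contraNF (subsetP h2 e')) // orbF.
  by rewrite (contraNF (subsetP h1 e')).
exists e'; split => //.
rewrite inE e'X /=; apply/and3P; split.
- by apply: contra e'F; apply/subsetP/loops_sub.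
- by apply: contra e'G; apply/subsetP/loops_sub.
apply/hasPn => b bt; rewrite inE e'b //; have := FG b bt.
by case: ifP => //= eb /and3P[_ /subsetP h _]; apply: contra e'G; apply: h.
Qed.

(** Rank in the product of the lattice of flats of [r] and the opposite of that of [s]. The excluded
    bottom and top have heights 0 and |X|. *)
Definition height b : nat := r b.1 + (s X - s b.2).

Lemma height_lt b c : is_flat X r b.1 -> is_flat X s b.2 -> c.1 \subset X ->
  is_flat X s c.2 -> pair_le b c -> b != c -> height b < height c.
Proof.
move=> fb1 fb2 sc1 fc2 /andP[h1 h2] ne.
have le1 := rank_mono rP h1; have le2 := rank_mono sP h2.
have := rank_mono sP (flat_sub fb2); have := rank_mono sP (flat_sub fc2).
rewrite /height ltnNge => le3 le4; apply: contra ne => le.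
have e1 : c.1 = b.1 by apply: (flat_eq rP fb1); nlia.
have e2 : b.2 = c.2 by apply: (flat_eq sP fc2 h2 (flat_sub fb2)); nlia.
by rewrite (surjective_pairing b) (surjective_pairing c) e1 e2.
Qed.

Lemma flat_pair_height_lt b c : is_flat_pair b -> is_flat_pair c ->
  pair_le b c -> b != c -> height b < height c.
Proof.
move=> /and5P[fb1 fb2 _ _ _] /and5P[fc1 fc2 _ _ _].
by apply: height_lt => //; apply: flat_sub fc1.
Qed.

Lemma height_bounds b : is_flat_pair b -> 0 < height b < #|X|.
Proof.
move=> pb; have [s1 s2] := pair_sub pb.
case/and5P: (pb) => f1 f2 _ n1 n2; rewrite -(dual_total d) /height.
have le1 := rank_mono rP s1; have le2 := rank_mono sP s2.
apply/andP; split; rewrite ltnNge.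
  apply: contra n1 => le; apply/eqP; rewrite (surjective_pairing b); congr (_, _).
    by apply: (rank0_flat rP f1); nlia.
  by apply/esym/(flat_eq sP f2) => //; nlia.
apply: contra n2 => le; apply/eqP; rewrite (surjective_pairing b); congr (_, _).
  by apply/esym/(flat_eq rP f1) => //; nlia.
by apply: (rank0_flat sP f2); nlia.
Qed.

(** Here v is the height of (F, G), for the flats F and G around the jump of an uncovered element:
    members before the jump are strictly lower, members after it strictly higher. *)
Lemma height_hole t : flag t -> exists v, [/\ 0 < v, v < #|X|
  & {in t, forall b, height b != v /\ (b.1 = X -> v < height b)}].
Proof.
move=> ft; have /set0Pn[e et] : residue t != set0 by case/and3P: ft.
have [F [G [fF fG eF eG FG]]] := residue_jump ft et.
have eX : e \in X by move: et; rewrite inE => /andP[].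
have rF : r F < r X by apply: (flat_lt rP fF (flat_sub fF) eX eX eF).
have sG : s G < s X by apply: (flat_lt sP fG (flat_sub fG) eX eX eG).
exists (r F + (s X - s G)); rewrite -(dual_total d); split; [nlia|nlia|].
move=> b bt; have [s1 s2] := pair_sub (flag_pair ft bt).
have le1 := rank_mono rP s1; have le2 := rank_mono sP s2; rewrite /height.
have := FG b bt; case: ifP => eb /and3P[h1 h2 h3].
  have lt1 := flat_lt rP fF h1 eX eb eF; have le3 := rank_mono sP h2.
  by split=> *; nlia.
have lt1 := flat_lt sP fG h2 eX h3 eG; have le3 := rank_mono rP h1.
split=> [|bX]; first by nlia.
by rewrite bX eX in eb.
Qed.

Lemma flag_size_le t v m : flag t -> uniq t -> 0 < v <= m ->
  {in t, forall b, height b != v /\ height b <= m} -> size t < m.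
Proof.
move=> ft ut /andP[v0 vm] tm.
have : uniq (v :: map height t).
  rewrite /= map_inj_in_uniq ?ut ?andbT.
    by apply/mapP => -[b /tm[/eqP ne _] eq]; rewrite eq in ne.
  move=> b c bt ct eq; apply/eqP; apply: contraT => ne.
  have pb := flag_pair ft bt; have pc := flag_pair ft ct.
  case/orP: (flag_cmp ft bt ct) => h.
    by have := flat_pair_height_lt pb pc h ne; nlia.
  by rewrite eq_sym in ne; have := flat_pair_height_lt pc pb h ne; nlia.
move/uniq_leq_size => /(_ (iota 1 m)); rewrite size_iota /= size_map; apply.
move=> x; rewrite inE mem_iota => /orP[/eqP->|/mapP[b bt ->]]; first nlia.
by have [_] := tm _ bt; case/andP: (height_bounds (flag_pair ft bt)); nlia.
Qed.

(** Distinct members have distinct heights among 1, ..., |X| - 1, and one of these is missed. *)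
Lemma flag_size t : flag t -> uniq t -> size t <= #|X| - 2.
Proof.
move=> ft ut; have [v [v0 vX tv]] := height_hole ft.
suff : size t < #|X|.-1 by nlia.
apply: (flag_size_le ft ut (v := v)); first nlia.
move=> b bt; have [h _] := tv b bt; split=> //.
by have := height_bounds (flag_pair ft bt); nlia.
Qed.

(** The heights stop at |X| - s G, and the missed height is below it since (X, G) comes after the
    jump. *)
Lemma flag_size_top t G : flag t -> uniq t -> (X, G) \in t ->
  {in t, forall b, pair_le b (X, G)} -> size t < #|X| - s G.
Proof.
move=> ft ut topt top; have [v [v0 vX tv]] := height_hole ft.
have pG := flag_pair ft topt.
have hG : height (X, G) = #|X| - s G.
  rewrite /height -(dual_total d) /=.
  by have := rank_mono sP (pair_sub pG).2; rewrite /=; nlia.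
have [_ /(_ erefl) vG] := tv _ topt.
rewrite -hG; apply: (flag_size_le ft ut (v := v)); first nlia.
move=> b bt; have [h _] := tv b bt; split=> //.
have [->//|ne] := eqVneq b (X, G).
exact: ltnW (flat_pair_height_lt (flag_pair ft bt) pG (top b bt) ne).
Qed.

(* The elements that are not the least element of their class, for the relation
   "uncovered and in the same first components". *)
Definition spare t : {set E} :=
  [set e in X | ~~ covered t e &&
    [exists e', [&& enum_rank e' < enum_rank e, e' \in X, ~~ covered t e'
                  & all (fun b => (e \in b.1) == (e' \in b.1)) t]]].

Lemma covered_cons b t e : covered (b :: t) e = (e \in b.1 :&: b.2) || covered t e.
Proof. by []. Qed.

Lemma spare_cons b t : spare (b :: t) \subset spare t.
Proof.
apply/subsetP => e; rewrite !inE covered_cons negb_or => /and3P[-> /andP[_ ->] /=].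
case/existsP => e' /and4P[lt e'X]; rewrite negb_or /= => /andP[_ nc] /andP[_ al].
by apply/existsP; exists e'; rewrite lt e'X nc.
Qed.

(** If no spare element were lost, every element of the class of e other than its least element m
    would remain uncovered and equivalent to a smaller one, hence, by descent, to m. Then b would
    neither cover nor separate e and e'. *)
Lemma spare_proper b t e e' : e \in X -> e' \in X -> e != e' ->
  ~~ covered t e -> ~~ covered t e' -> {in t, forall c : pair, (e' \in c.1) = (e \in c.1)} ->
  [|| e \in b.1 :&: b.2, e' \in b.1 :&: b.2 | (e \in b.1) != (e' \in b.1)] ->
  spare (b :: t) \proper spare t.
Proof.
move=> eX e'X ne ce ce' same sep; rewrite properEneq spare_cons andbT.
apply/negP => /eqP eqV.
pose K f := [&& f \in X, ~~ covered t f & all (fun c => (f \in c.1) == (e \in c.1)) t].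
have Ke : K e by rewrite /K eX ce; apply/allP => c _ /=.
have Ke' : K e' by rewrite /K e'X ce'; apply/allP => c /same /= ->.
case: (arg_minnP (fun f => val (enum_rank f)) Ke) => m Km minm.
have step f : K f -> f != m -> [/\ f \notin b.1 :&: b.2, m \notin b.1 :&: b.2
    & (f \in b.1) = (m \in b.1)].
  have [k] := ubnP (enum_rank f); elim: k f => // k IH f /ltnSE lek Kf fm.
  case/and3P: (Kf) => fX cf /allP alf.
  have fV : f \in spare t.
    rewrite inE fX cf /=; apply/existsP; exists m.
    case/and3P: (Km) => -> -> /allP alm /=; apply/andP; split.
      rewrite ltn_neqAle minm // andbT; apply: contra fm => /eqP/val_inj/enum_rank_inj ->.
      exact: eqxx.
    by apply/allP => c ct; rewrite (eqP (alf _ ct)) (eqP (alm _ ct)).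
  move: fV; rewrite -eqV inE covered_cons negb_or fX /= => /andP[/andP[cbf _]].
  case/existsP => g /and4P[ltg gX]; rewrite covered_cons negb_or => /andP[cbg cg].
  rewrite /= => /andP[/eqP eqb /allP alg].
  have Kg : K g.
    by rewrite /K gX cg; apply/allP => c ct; rewrite -(eqP (alg _ ct)) (eqP (alf _ ct)).
  have [gm|gm] := eqVneq g m; first by rewrite -gm eqb.
  have [_ h1 h2] := IH g (leq_trans ltg lek) Kg gm.
  by rewrite eqb.
have [em|em] := eqVneq e m; have [e'm|e'm] := eqVneq e' m.
- by rewrite em e'm eqxx in ne.
- by have [h1 h2 h3] := step _ Ke' e'm; move: sep; rewrite em (negbTE h1) (negbTE h2) h3 eqxx.
- by have [h1 h2 h3] := step _ Ke em; move: sep; rewrite e'm (negbTE h1) (negbTE h2) h3 eqxx.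
- have [h1 h2 h3] := step _ Ke em; have [h1' _ h3'] := step _ Ke' e'm.
  by move: sep; rewrite (negbTE h1) (negbTE h1') h3 h3' eqxx.
Qed.

(** The larger of two twins is spare. *)
Lemma spare_flag t : flag t -> 0 < #|spare t|.
Proof.
move=> ft; have /set0Pn[e et] : residue t != set0 by case/and3P: ft.
have [e' [ne e't same]] := residue_twin ft et.
suff H a a' : a \in residue t -> a' \in residue t -> enum_rank a' < enum_rank a ->
    {in t, forall b : pair, (a' \in b.1) = (a \in b.1)} -> a \in spare t.
  case: (ltngtP (enum_rank e') (enum_rank e)) => [lt|lt|/val_inj/enum_rank_inj eq].
  - by apply/card_gt0P; exists e; apply: H et e't lt same.
  - by apply/card_gt0P; exists e'; apply: H e't et lt _ => b /same ->.
  - by rewrite eq eqxx in ne.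
rewrite !inE => /and4P[aX _ _ ca] /and4P[a'X _ _ ca'] lt eqb.
rewrite aX ca /=; apply/existsP; exists a'; rewrite lt a'X ca' /=.
by apply/allP => b bt; rewrite eqb.
Qed.

End Flags.

Local Open Scope ring_scope.

(** * Vanishing of degrees *)

Section DegreeModels.
Variables (E : finType) (A R : comNzRingType).
Local Notation pair := ({set E} * {set E})%type.
Implicit Types (X : {set E}) (r s : {set E} -> nat) (x : pair -> A) (t : seq pair).

(* The part of the structure of the Chow ring of a conormal fan used to compute
   degrees: x b is the class of the ray of the biflat b. *)
Record degree_model X r s x (deg : {additive A -> R}) : Prop := DegreeModel {
  model_nonflag : forall a t, ~~ flag X r s t -> deg (a * \prod_(b <- t) x b) = 0;
  model_fst : forall a i j, i \in X -> j \in X ->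
    i \notin closure X r set0 -> j \notin closure X r set0 ->
    deg (a * \sum_(b : pair | i \in b.1) x b) = deg (a * \sum_(b : pair | j \in b.1) x b);
  model_snd : forall a i j, i \in X -> j \in X ->
    i \notin closure X s set0 -> j \notin closure X s set0 ->
    deg (a * \sum_(b : pair | i \in b.2) x b) = deg (a * \sum_(b : pair | j \in b.2) x b);
  model_max : forall t, flag X r s t -> uniq t -> size t = (#|X| - 2)%N ->
    deg (\prod_(b <- t) x b) = 1 }.

Definition gamma_elt X x i : A := \sum_(b : pair | (i \in b.1) && (b.1 != X)) x b.

Definition delta_elt x i : A := \sum_(b : pair | i \in b.1 :&: b.2) x b.

Section OneModel.
Variables (X : {set E}) (r s : {set E} -> nat) (x : pair -> A) (deg : {additive A -> R}).
Hypotheses (d : dual_ranks X r s) (mod : degree_model X r s x deg).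

Let rP : rank_axioms r. Proof. by case: d. Qed.
Let sP : rank_axioms s. Proof. by case: d. Qed.

Lemma deg_mul_sum a (P : pred pair) :
  deg (a * \sum_(b : pair | P b) x b) = \sum_(b : pair | P b) deg (a * x b).
Proof. by rewrite mulr_sumr raddf_sum. Qed.

Lemma deg_nonpair a b : ~~ is_flat_pair X r s b -> deg (a * x b) = 0.
Proof.
move=> nb; suff : deg (a * \prod_(c <- [:: b]) x c) = 0 by rewrite big_seq1.
by apply: (model_nonflag mod); rewrite /flag /= (negbTE nb).
Qed.

Lemma gamma_elt_indep a i j : i \in X -> j \in X ->
  i \notin closure X r set0 -> j \notin closure X r set0 ->
  deg (a * gamma_elt X x i) = deg (a * gamma_elt X x j).
Proof.
move=> iX jX iL jL; have := model_fst mod a iX jX iL jL.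
have split k : k \in X -> deg (a * \sum_(b : pair | k \in b.1) x b) =
    \sum_(b : pair | b.1 == X) deg (a * x b) + deg (a * gamma_elt X x k).
  move=> kX; rewrite !deg_mul_sum (bigID (fun b : pair => b.1 == X)) /=; congr (_ + _).
  by apply: eq_bigl => b; case: eqP => [->|]; rewrite ?kX ?andbF.
by rewrite !split // => /addrI.
Qed.

(** As F ∪ G = X, the indicator of F ∩ G is the sum of those of F and G minus 1. So delta is the sum
    of the two linear sums minus the sum of all variables, which does not depend on i. *)
Lemma delta_elt_indep a i j : i \in X -> j \in X ->
  i \notin closure X r set0 -> j \notin closure X r set0 ->
  i \notin closure X s set0 -> j \notin closure X s set0 ->
  deg (a * delta_elt x i) = deg (a * delta_elt x j).
Proof.
move=> iX jX iL jL iC jC.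
have split k : k \in X -> deg (a * delta_elt x k) =
    deg (a * \sum_(b : pair | k \in b.1) x b) + deg (a * \sum_(b : pair | k \in b.2) x b)
    - \sum_b deg (a * x b).
  move=> kX; apply/eqP; rewrite eq_sym subr_eq eq_sym !deg_mul_sum; apply/eqP.
  rewrite [in LHS]big_mkcond /= [X in _ = X + _]big_mkcond /= [X in _ = _ + X]big_mkcond /=.
  rewrite -!big_split /=; apply: eq_bigr => b _; rewrite inE.
  have [pb|nb] := boolP (is_flat_pair X r s b); last first.
    by rewrite deg_nonpair // !if_same.
  have := flat_pair_setU pb kX.
  by case: (k \in b.1); case: (k \in b.2) => //= _; rewrite ?add0r ?addr0.
by rewrite !split // (model_fst mod a iX jX iL jL) (model_snd mod a iX jX iC jC).
Qed.

Hypothesis loopless : closure X r set0 = set0.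

Lemma not_loop i : i \notin closure X r set0.
Proof. by rewrite loopless inE. Qed.

Variable e0 : E.
Hypotheses (e0X : e0 \in X) (e0C : e0 \notin closure X s set0).

Local Notation gam := (gamma_elt X x e0).
Local Notation del := (delta_elt x e0).
Local Notation mon t := (\prod_(b <- t) x b).

(** One factor gamma is rewritten with an element i suited to t; only the pairs extending t to a
    flag survive. *)
Lemma gamma_step a t i : i \in X ->
    (forall b : pair, i \in b.1 -> b.1 != X -> flag X r s (b :: t) ->
       deg (a * mon (b :: t)) = 0) ->
  deg (a * gam * mon t) = 0.
Proof.
move=> iX IH; rewrite -mulrA [gam * _]mulrC mulrA.
rewrite (@gamma_elt_indep _ e0 i) ?not_loop // /gamma_elt deg_mul_sum.
apply: big1 => b /andP[ib bX].
have -> : a * mon t * x b = a * mon (b :: t) by rewrite big_cons; ring.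
have [ft|nft] := boolP (flag X r s (b :: t)); first exact: IH.
exact: (model_nonflag mod).
Qed.

Lemma delta_step a t i : i \in X -> i \notin closure X s set0 ->
    (forall b : pair, i \in b.1 :&: b.2 -> flag X r s (b :: t) ->
       deg (a * mon (b :: t)) = 0) ->
  deg (a * del * mon t) = 0.
Proof.
move=> iX iC IH; rewrite -mulrA [del * _]mulrC mulrA.
rewrite (@delta_elt_indep _ e0 i) ?not_loop //.
rewrite /delta_elt deg_mul_sum.
apply: big1 => b ib.
have -> : a * mon t * x b = a * mon (b :: t) by rewrite big_cons; ring.
have [ft|nft] := boolP (flag X r s (b :: t)); first exact: IH.
exact: (model_nonflag mod).
Qed.

(** Each factor delta is expanded at an uncovered i that has a twin. The new pair covers i, so a
    spare element is lost; but every flag has one. *)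
Lemma delta_vanish m a t : (#|spare X t| <= m)%N -> deg (a * del ^+ m * mon t) = 0.
Proof.
have [ft|nft _] := boolP (flag X r s t); last exact: (model_nonflag mod).
elim: m a t ft => [|m IH] a t ft le.
  by have := spare_flag d ft; rewrite ltnNge le.
have -> : a * del ^+ m.+1 = (a * del ^+ m) * del by rewrite exprSr mulrA.
have /set0Pn[i it] : residue X r s t != set0 by case/and3P: ft.
have [i' [ne i't same]] := residue_twin d ft it.
move: it i't; rewrite inE => /and4P[iX _ iC ci]; rewrite inE => /and4P[i'X _ _ ci'].
apply: (delta_step iX iC) => b ib fbt; apply: IH => //.
rewrite -ltnS; apply: leq_trans le; apply: proper_card.
by rewrite eq_sym in ne; apply: (spare_proper iX i'X ne ci ci' same); rewrite ib.
Qed.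

(** Each factor gamma is expanded at an i outside all first components. The new first component
    contains i but is not X, hence separates i from some i' in the same class, and a spare element
    is lost. *)
Lemma gamma_delta_vanish k m a t : {in t, forall b : pair, b.1 != X} ->
  (#|spare X t| <= k + m)%N -> deg (a * gam ^+ k * del ^+ m * mon t) = 0.
Proof.
have [ft|nft _ _] := boolP (flag X r s t); last exact: (model_nonflag mod).
elim: k a t ft => [|k IH] a t ft tX le; first by rewrite expr0 mulr1 delta_vanish.
have -> : a * gam ^+ k.+1 * del ^+ m = (a * gam ^+ k * del ^+ m) * gam.
  by rewrite exprS; ring.
have [i [iX it]] : exists i, i \in X /\ {in t, forall b : pair, i \notin b.1}.
  have [->|t0] := eqVneq t [::]; first by exists e0.
  have ct : allrel (@pair_cmp E) t t by case/and3P: ft.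
  have [p pt pmax] := chain_max ct t0.
  have [sp _] := pair_sub (flag_pair ft pt).
  have /properP[_ [i iX ip]] : p.1 \proper X by rewrite properEneq tX.
  exists i; split=> // b /pmax /andP[/subsetP h _]; exact: contra (h i) ip.
apply: (gamma_step iX) => b ib bX fbt; apply: IH => //.
  by move=> c; rewrite inE => /orP[/eqP-> //|/tX].
rewrite -ltnS; apply: leq_trans le; apply: proper_card.
have bb : b \in b :: t by rewrite inE eqxx.
have [sb _] := pair_sub (flag_pair fbt bb).
have /properP[_ [i' i'X i'b]] : b.1 \proper X by rewrite properEneq bX.
have i't : {in t, forall c : pair, i' \notin c.1}.
  move=> c ct; have cb : c \in b :: t by rewrite inE ct orbT.
  have /andP[/subsetP h _] := flag_le fbt cb bb ib (it c ct).
  exact: contra (h i') i'b.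
apply: (@spare_proper _ _ b t i i') => //.
- by apply: contraNneq i'b => <-.
- by apply/hasPn => c /it; rewrite inE => /negbTE->.
- by apply/hasPn => c /i't; rewrite inE => /negbTE->.
- by move=> c ct; rewrite (negbTE (it c ct)) (negbTE (i't c ct)).
- by rewrite ib (negbTE i'b) !orbT.
Qed.

(** Covered elements and least elements of classes are not spare. If [b.2] is X, at least two
    elements are covered and there is a class; otherwise j is covered and the complements of [b.1]
    and [b.2] give two classes. *)
Lemma spare_single (b : pair) j : is_flat_pair X r s b -> b.1 != X ->
  j \in b.1 :&: b.2 -> b != ([set j], X) -> (#|spare X [:: b]| <= #|X| - 3)%N.
Proof.
move=> pb bX jb bj; have [s1 s2] := pair_sub pb.
(* The least element of X \ B is not spare when X \ B is stable under passing to equivalent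
   uncovered elements. *)
have least (B : {set E}) : B \subset X -> B != X ->
    (forall e e', e \in X -> e \notin B -> e' \in X -> e' \notin b.1 :&: b.2 ->
       (e \in b.1) = (e' \in b.1) -> e' \notin B) ->
    exists2 m, m \in X :\: B & m \notin spare X [:: b].
  move=> sB nB Bb; have /properP[_ [i iX iB]] : B \proper X by rewrite properEneq nB.
  have Pi : i \in X :\: B by rewrite inE iB.
  case: (arg_minnP (fun e => val (enum_rank e)) Pi) => m mB minm.
  have {}mB : m \in X :\: B by [].
  exists m => //; move: (mB); rewrite in_setD => /andP[{}mB mX].
  rewrite inE mX /=; apply/negP => /andP[_ /existsP[e' /and4P[lt e'X]]].
  rewrite /covered /= orbF andbT => ce' /eqP e'b.
  have /minm : e' \in X :\: B by rewrite inE e'X (Bb m).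
  by rewrite leqNgt lt.
have [m1 m1b m1s] : exists2 m, m \in X :\: b.1 & m \notin spare X [:: b].
  by apply: least => // e e' _ eb _ _ <-.
have sub : spare X [:: b] \subset X :\: (b.1 :&: b.2).
  by apply/subsetP => e; rewrite !inE /covered /= orbF inE => /and3P[-> -> _].
have cardX : #|X :\: (b.1 :&: b.2)| = (#|X| - #|b.1 :&: b.2|)%N.
  by rewrite cardsDS // subIset // s1.
have sX : (#|b.1 :&: b.2| <= #|X|)%N by apply: subset_leq_card; rewrite subIset // s1.
have cI : (0 < #|b.1 :&: b.2|)%N by apply/card_gt0P; exists j.
have [b2X|b2X] := eqVneq b.2 X.
  have eI : b.1 :&: b.2 = b.1 by apply/setIidPl; rewrite b2X.
  have cI2 : (1 < #|b.1 :&: b.2|)%N.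
    rewrite ltn_neqAle cI andbT; apply: contra bj => /eqP/esym/eqP/cards1P[y].
    rewrite eI => by1; apply/eqP; rewrite (surjective_pairing b) b2X by1.
    by move: jb; rewrite eI by1 inE => /eqP->.
  have : (#|m1 |: spare X [:: b]| <= #|X :\: (b.1 :&: b.2)|)%N.
    apply: subset_leq_card; rewrite subUset sub andbT sub1set.
    by move: m1b; rewrite !inE negb_and => /andP[-> ->].
  by rewrite cardsU1 m1s cardX; nlia.
have [m2 m2b m2s] : exists2 m, m \in X :\: b.2 & m \notin spare X [:: b].
  apply: least => // e e' eX eb _; have := flat_pair_setU pb eX.
  by rewrite (negbTE eb) orbF inE => -> + e'b; rewrite -e'b.
have : (#|m1 |: (m2 |: spare X [:: b])| <= #|X :\: (b.1 :&: b.2)|)%N.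
  apply: subset_leq_card; rewrite !subUset sub andbT !sub1set.
  by move: m1b m2b; rewrite !inE !negb_and => /andP[-> ->] /andP[-> ->]; rewrite orbT.
rewrite !cardsU1 m2s cardX inE (negbTE m1s) orbF inE.
have -> : (m1 == m2) = false.
  apply/negP => /eqP m12; move: m1b m2b; rewrite -m12 !inE => /andP[+ mX] /andP[+ _].
  by have := flat_pair_setU pb mX; case: (m1 \in b.1) => //= ->.
by nlia.
Qed.

(** Every factor can be expanded so as to add a new member below (X, G): for delta at an uncovered
    element, which is not in G, and for gamma at an element outside the first components other than
    X. By [flag_size_top] there is room for fewer than |X| - 2 members. *)
Lemma top_vanish k m a t G : uniq t -> (X, G) \in t -> (1 < s G)%N ->
    {in t, forall b, pair_le b (X, G)} -> (#|X| - 2 <= size t + k + m)%N ->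
  deg (a * gam ^+ k * del ^+ m * mon t) = 0.
Proof.
elim: k m a t => [|k IHk] m.
  elim: m => [|m IHm] a t ut tG sG top le.
    rewrite !expr0 !mulr1; apply: (model_nonflag mod); apply/negP => ft.
    by have := flag_size_top d ft ut tG top; nlia.
  have [ft|nft] := boolP (flag X r s t); last exact: (model_nonflag mod).
  have -> : a * gam ^+ 0 * del ^+ m.+1 = (a * del ^+ m) * del.
    by rewrite expr0 mulr1 exprSr mulrA.
  have /set0Pn[i it] : residue X r s t != set0 by case/and3P: ft.
  move: it; rewrite inE => /and4P[iX _ iC ci].
  apply: (delta_step iX iC) => b ib fbt.
  have bt c : c \in t -> c \in b :: t by rewrite inE => ->; rewrite orbT.
  have iG : i \notin G by move/hasPn/(_ _ tG): ci => /=; rewrite in_setI iX.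
  have := IHm a (b :: t); rewrite expr0 mulr1; apply.
  - rewrite /= ut andbT; apply: contra ci => bt'; apply/hasP; exists b; by rewrite ?ib.
  - exact: bt.
  - by [].
  - move=> c; rewrite inE => /orP[/eqP->|/top //].
    have /orP[//|/andP[/= _ /subsetP h]] : pair_cmp b (X, G).
      by apply: (flag_cmp fbt); [rewrite inE eqxx | exact: bt].
    by move: ib; rewrite inE => /andP[_ /h ib]; rewrite ib in iG.
  - by rewrite /=; nlia.
move=> a t ut tG sG top le.
have [ft|nft] := boolP (flag X r s t); last exact: (model_nonflag mod).
have -> : a * gam ^+ k.+1 * del ^+ m = (a * gam ^+ k * del ^+ m) * gam.
  by rewrite exprS; ring.
have [i [iX it]] : exists i, i \in X /\ {in t, forall b : pair, b.1 != X -> i \notin b.1}.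
  pose t' := [seq b : pair <- t | b.1 != X].
  have [t0|t0] := eqVneq t' [::].
    exists e0; split=> // b bt bX.
    have : b \in t' by rewrite mem_filter bX.
    by rewrite t0.
  have ct : allrel (@pair_cmp E) t' t'.
    apply/allrelP => b c; rewrite !mem_filter => /andP[_ bt] /andP[_ ct].
    exact: flag_cmp ft bt ct.
  have [p + pmax] := chain_max ct t0.
  rewrite mem_filter => /andP[pX pt].
  have [sp _] := pair_sub (flag_pair ft pt).
  have /properP[_ [i iX ip]] : p.1 \proper X by rewrite properEneq pX.
  exists i; split=> // b bt bX.
  have /pmax /andP[/subsetP h _] : b \in t' by rewrite mem_filter bX.
  exact: contra (h i) ip.
apply: (gamma_step iX) => b ib bX fbt.
have bt c : c \in t -> c \in b :: t by rewrite inE => ->; rewrite orbT.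
apply: IHk => //.
- rewrite /= ut andbT; apply/negP => bt'.
  by have := it b bt' bX; rewrite ib.
- exact: bt.
- move=> c; rewrite inE => /orP[/eqP->|/top //].
  have /orP[//|/andP[/= h _]] : pair_cmp b (X, G).
    by apply: (flag_cmp fbt); [rewrite inE eqxx | exact: bt].
  have bb : b \in b :: t by rewrite inE eqxx.
  have [sb _] := pair_sub (flag_pair fbt bb).
  by move: bX; rewrite eqEsubset sb h.
- by rewrite /=; nlia.
Qed.

(** F is the largest first component of t, or empty. Each factor gamma, expanded at an element
    outside F, replaces F by a larger flat other than X, which can happen fewer than r X - r F
    times. *)
Lemma gamma_rank_vanish m a t F : is_flat X r F -> F != X ->
    {in t, forall b : pair, b.1 \subset F} ->
    F = set0 \/ (exists2 b : pair, b \in t & b.1 = F) -> (r X <= m + r F)%N ->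
  deg (a * gam ^+ m * mon t) = 0.
Proof.
elim: m a t F => [|m IH] a t F fF FX tF Ft le.
  by case/eqP: FX; apply/esym/(flat_eq rP fF) => //; apply: flat_sub fF.
have -> : a * gam ^+ m.+1 = (a * gam ^+ m) * gam by rewrite exprSr mulrA.
have /properP[sF [i iX iF]] : F \proper X by rewrite properEneq FX (flat_sub fF).
apply: (gamma_step iX) => b ib bX fbt.
have bb : b \in b :: t by rewrite inE eqxx.
have tb (c : pair) : c \in t -> c.1 \subset b.1.
  move=> ct; have cb : c \in b :: t by rewrite inE ct orbT.
  by case/andP: (flag_le fbt cb bb ib (contra (subsetP (tF _ ct) i) iF)).
have Fb : F \subset b.1 by case: Ft => [->|[c /tb + <-]]; rewrite ?sub0set.
have fb : is_flat X r b.1 by case/and5P: (flag_pair fbt bb).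
apply: (IH _ _ b.1) => //.
- by move=> c; rewrite inE => /orP[/eqP->|/tb].
- by right; exists b.
- by have := flat_lt rP fF Fb iX ib iF; nlia.
Qed.

(** Here s X = 1, so the only flats of [s] are the coloops and X, and in a flag the first component
    of a pair determines the second. Each factor gamma, expanded at i outside F, leaves the single
    term in which F grows to the closure of F and i. *)
Lemma gamma_max m t F : #|X| = (r X).+1 -> is_flat X r F -> F != X ->
    {in t, forall b : pair, b.1 \subset F} ->
    F = set0 \/ (exists2 b : pair, b \in t & b.1 = F) ->
    flag X r s t -> uniq t -> r F = size t -> (size t + m = #|X| - 2)%N ->
  deg (gam ^+ m * mon t) = 1.
Proof.
move=> cX; have sX1 : s X = 1%N by have := dual_total d; nlia.
elim: m t F => [|m IH] t F fF FX tF Ft ft ut rF sz.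
  by rewrite expr0 mul1r; apply: (model_max mod) => //; nlia.
have -> : gam ^+ m.+1 * mon t = (gam ^+ m * mon t) * gam by rewrite exprS; ring.
have /properP[sF [i iX iF]] : F \proper X by rewrite properEneq FX (flat_sub fF).
rewrite (@gamma_elt_indep _ e0 i) ?not_loop // [gamma_elt X x i]/gamma_elt deg_mul_sum.
pose C := closure X s set0; pose F0 := closure X r (i |: F).
have iFX : i |: F \subset X by rewrite subUset sub1set iX.
have fF0 : is_flat X r F0 by apply: closure_flat.
have rF0 : r F0 = (size t).+1 by rewrite /F0 (rank_closure rP iFX) (flatP rP fF iX iF) rF.
have iF0 : i \in F0 by apply: (subsetP (sub_closure _ iFX)); rewrite !inE eqxx.
have FF0 : F \subset F0 by apply: subset_trans (sub_closure _ iFX); apply: subsetUr.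
have F0X : F0 != X by apply/eqP => eq; move: rF0; rewrite eq; nlia.
have F0n0 : F0 != set0 by apply/set0Pn; exists i.
(* If F0 contains all non-coloops, the second component X would leave nothing uncovered; otherwise C
   would not complete F0 to X. *)
pose G0 := if X :\: C \subset F0 then C else X; pose b0 : pair := (F0, G0).
have fC : is_flat X s C by apply: closure_flat; rewrite ?sub0set.
have G0C : G0 = C \/ (G0 = X /\ ~~ (X :\: C \subset F0)).
  by rewrite /G0; case: ifP; [left | right].
have pb0 : is_flat_pair X r s b0.
  rewrite /is_flat_pair /= fF0 /=; apply/and4P; split.
  - by rewrite /G0; case: ifP => // _; apply: ground_flat.
  - rewrite eqEsubset subUset (flat_sub fF0) /= /G0; case: ifP => h.
      rewrite (flat_sub fC) /=; apply/subsetP => e eX; rewrite inE.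
      by case: (boolP (e \in C)) => eC; rewrite ?orbT // (subsetP h) // inE eC.
    by rewrite subxx subsetUr.
  - by rewrite loopless xpair_eqE (negbTE F0n0).
  - by rewrite xpair_eqE (negbTE F0X).
have uniqG (b : pair) : i \in b.1 -> b.1 != X -> flag X r s (b :: t) -> b.1 = F0 -> b = b0.
  move=> ib bX fbt bF; rewrite (surjective_pairing b) bF; congr (_, _).
  have bb : b \in b :: t by rewrite inE eqxx.
  have pb := flag_pair fbt bb; have [_ sb2] := pair_sub pb.
  have fb2 : is_flat X s b.2 by case/and5P: pb.
  have [rb|rb] := posnP (s b.2).
    have bC := rank0_flat sP fb2 rb; rewrite -/C in bC.
    rewrite bC /G0; case: ifP => // /negP[]; apply/subsetP => e; rewrite inE => /andP[eC eX].
    by have := flat_pair_setU pb eX; rewrite bF bC (negbTE eC) orbF.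
  have b2X : b.2 = X by apply/esym/(flat_eq sP fb2) => //; nlia.
  rewrite b2X /G0; case: ifP => // h.
  have /set0Pn[e] : residue X r s (b :: t) != set0 by case/and3P: fbt.
  rewrite inE => /and4P[eX _ eC]; rewrite covered_cons negb_or b2X bF in_setI eX andbT.
  by rewrite (subsetP h) // in_setD eC.
(* A larger flat has rank at least [size t + 2], and the m remaining factors gamma are then too
   many. *)
have other (b : pair) : i \in b.1 -> b.1 != X -> b != b0 -> deg (gam ^+ m * mon t * x b) = 0.
  move=> ib bX nb.
  have -> : gam ^+ m * mon t * x b = gam ^+ m * mon (b :: t) by rewrite big_cons; ring.
  have [fbt|nft] := boolP (flag X r s (b :: t)); last exact: (model_nonflag mod).
  have bb : b \in b :: t by rewrite inE eqxx.
  have tb (c : pair) : c \in t -> c.1 \subset b.1.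
    move=> ct; have cb : c \in b :: t by rewrite inE ct orbT.
    by case/andP: (flag_le fbt cb bb ib (contra (subsetP (tF _ ct) i) iF)).
  have Fb : F \subset b.1 by case: Ft => [->|[c /tb + <-]]; rewrite ?sub0set.
  have pb := flag_pair fbt bb; have fb : is_flat X r b.1 by case/and5P: pb.
  have F0b : F0 \subset b.1 by apply: closure_min; rewrite // subUset sub1set ib.
  rewrite -[gam ^+ m]mul1r; apply: (@gamma_rank_vanish m 1 (b :: t) _ fb bX).
  - by move=> c; rewrite inE => /orP[/eqP->|/tb].
  - by right; exists b.
  - have [le|lt] := leqP (r b.1) (r F0).
      have eq : b.1 = F0 by apply: (flat_eq rP fF0 F0b (pair_sub pb).1 le).
      by rewrite (uniqG b) ?eqxx in nb.
    by nlia.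
rewrite (bigD1 b0) /=; last by rewrite iF0 F0X.
rewrite [X in _ + X]big1 ?addr0 => [|b /andP[/andP[ib bX] nb]]; last exact: other.
have -> : gam ^+ m * mon t * x b0 = gam ^+ m * mon (b0 :: t) by rewrite big_cons; ring.
have tF0 (c : pair) : c \in t -> c.1 \subset F0 by move=> ct; apply: subset_trans FF0; apply: tF.
have le0 c : c \in t -> pair_le c b0.
  move=> ct; rewrite /pair_le tF0 //=.
  have pc := flag_pair ft ct; have fc2 : is_flat X s c.2 by case/and5P: pc.
  case: G0C => [->|[-> nsub]]; first exact: loops_sub fc2.
  have [rc|rc] := posnP (s c.2).
    have cC := rank0_flat sP fc2 rc; rewrite -/C in cC.
    case/negP: nsub; apply/subsetP => e; rewrite inE => /andP[eC eX].
    have := flat_pair_setU pc eX; rewrite cC (negbTE eC) orbF.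
    by apply/subsetP/tF0.
  have -> : c.2 = X by apply/esym/(flat_eq sP fc2 (pair_sub pc).2) => //; nlia.
  exact: subxx.
apply: (IH _ F0) => //.
- by move=> c; rewrite inE => /orP[/eqP->|/tF0].
- by right; exists b0; rewrite ?inE ?eqxx.
- apply/and3P; split.
  + by rewrite /= pb0; apply/allP => c /(flag_pair ft).
  + apply/allrelP => c c'; rewrite !inE => /orP[/eqP->|ct] /orP[/eqP->|c't].
    * by rewrite /pair_cmp pair_lexx.
    * by rewrite /pair_cmp le0 ?orbT.
    * by rewrite /pair_cmp le0.
    * exact: flag_cmp ft ct c't.
  + case: G0C => [G0C|[G0X nsub]].
      have /set0Pn[e] : residue X r s t != set0 by case/and3P: ft.
      rewrite inE => /and4P[eX eL eC et]; apply/set0Pn; exists e.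
      rewrite inE eX eL eC covered_cons negb_or et andbT /= G0C inE.
      by rewrite (negbTE eC) andbF.
    case/subsetPn: nsub => e; rewrite inE => /andP[eC eX] eF0; apply/set0Pn; exists e.
    rewrite inE eX eC loopless inE covered_cons negb_or inE (negbTE eF0) /=.
    by apply/hasPn => c /tF0 /subsetP h; rewrite inE (contraNF (h e)).
- rewrite /= ut andbT; apply/negP => /tF /subsetP/(_ i iF0); exact/negP.
- by rewrite /=; nlia.
Qed.

End OneModel.
End DegreeModels.

(** * Contraction of an element *)

Section Twist.
Variables (A R : comNzRingType) (deg : {additive A -> R}) (c : A).
(** For c the variable of a ray, this is the degree on the star of that ray. *)
Definition twist (a : A) : R := deg (a * c).
Fact twist_is_zmod_morphism : zmod_morphism twist.
Proof. by move=> a b; rewrite /twist mulrBl raddfB. Qed.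
HB.instance Definition _ := GRing.isZmodMorphism.Build A R twist twist_is_zmod_morphism.
End Twist.

Lemma uniq_map_inj_in (S S' : eqType) (f : S -> S') (u : seq S) :
  uniq (map f u) -> {in u &, injective f}.
Proof.
elim: u => //= a u IH /andP[na uu] y z; rewrite !inE.
case/orP => [/eqP->|yu] /orP[/eqP->|zu] // e.
- by rewrite e map_f in na.
- by rewrite -e map_f in na.
- exact: IH.
Qed.

Section Contraction.
Variables (E : finType) (A R : comNzRingType).
Local Notation pair := ({set E} * {set E})%type.
Variables (X : {set E}) (r s : {set E} -> nat) (x : pair -> A) (deg : {additive A -> R}) (j : E).
Hypotheses (d : dual_ranks X r s) (mod : degree_model X r s x deg).
Hypotheses (jX : j \in X) (rj : r [set j] = 1%N) (sj : s [set j] = 1%N).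
Implicit Types (b c : pair) (t u : seq pair).

Let rP : rank_axioms r. Proof. by case: d. Qed.
Let sP : rank_axioms s. Proof. by case: d. Qed.

Local Notation X' := (X :\ j).
Local Notation r' := (contraction r j).
Local Notation T := (closure X r [set j]).
Local Notation L := (closure X r set0).
Local Notation C := (closure X s set0).
Local Notation top := ((T, X) : pair).

Definition pair_del b : pair := (b.1 :\ j, b.2 :\ j).

(** The sum over the two possible lifts of b, which are the pairs with j in the first component that
    become b when j is removed. Both are needed for the linear relations of the minor to follow from
    those of the original model. *)
Definition contract_ray b : A :=
  if is_flat_pair X' r' s b then x (j |: b.1, b.2) + x (j |: b.1, j |: b.2) else 0.

Local Notation x' := contract_ray.
Local Notation deg' := (twist deg (x top)).

Let d' : dual_ranks X' r' s := dual_ranks_contraction d jX.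

Lemma loops_contraction : closure X' r' set0 = T :\ j.
Proof. by rewrite (closure_contraction j d) setU0. Qed.

Lemma not_coloop : j \notin C.
Proof. by rewrite mem_loops // sj. Qed.

Lemma coloops_contraction : closure X' s set0 = C.
Proof.
by rewrite closure_deletion; apply/setDidPl; rewrite disjoint_sym disjoints1 not_coloop.
Qed.

Lemma not_loop_j : j \notin L.
Proof. by rewrite mem_loops // rj. Qed.

Lemma mem_T : j \in T.
Proof. by rewrite (subsetP (sub_closure _ _)) ?sub1set ?inE. Qed.

Lemma T_flat : is_flat X r T.
Proof. by apply: closure_flat; rewrite ?sub1set. Qed.

Lemma rank_T : r T = 1%N.
Proof. by rewrite (rank_closure rP) ?sub1set. Qed.

Lemma top_pair : is_flat_pair X r s top.
Proof.
rewrite /is_flat_pair /= T_flat ground_flat //=; apply/and3P; split.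
- by rewrite eqEsubset subUset (closure_sub X r) subxx subsetUr.
- by rewrite xpair_eqE negb_and; apply/orP; left; apply: contraNneq not_loop_j => <-; exact: mem_T.
- by rewrite xpair_eqE negb_and; apply/orP; right; apply: contraNneq not_coloop => <-.
Qed.

(** As j is not a loop of [r], it is spanned by X \ j in [s]. *)
Lemma flat_deletion_ground G : is_flat X s G -> G :\ j = X' -> G = X.
Proof.
move=> fG GX; have [jG|jG] := boolP (j \in G).
  by rewrite -(setD1K jG) GX setD1K.
have GX' : G = X' by rewrite -GX; apply/esym/setDidPl; rewrite disjoint_sym disjoints1.
have := flatP sP fG jX jG; rewrite {1}GX' setD1K // => h.
have := dual_rank d (flat_sub fG); have := dual_total d.
have := cardsD1 j X; rewrite jX -GX'.
have -> : X :\: G = [set j].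
  by apply/setP => e; rewrite GX' !inE; case: eqP => [->|]; rewrite ?jX ?andNb //=; case: (e \in X).
by rewrite rj; nlia.
Qed.

Lemma pair_del_flat b : is_flat_pair X r s b -> j \in b.1 -> b != top ->
  pair_del b != (X', C) -> is_flat_pair X' r' s (pair_del b).
Proof.
move=> pb jb nt nC; have [s1 s2] := pair_sub pb.
case/and5P: pb => f1 f2 /eqP U _ _.
rewrite /is_flat_pair /= (flat_contraction d) // f1 (flat_deletion j d) //=.
rewrite loops_contraction coloops_contraction nC andbT -setDUl U eqxx /=.
apply: contra nt => /eqP[e1 e2]; rewrite (surjective_pairing b); apply/eqP; congr (_, _).
  by rewrite -(setD1K jb) e1 setD1K // mem_T.
exact: flat_deletion_ground.
Qed.

Lemma contract_pair_sub b : is_flat_pair X' r' s b -> j \notin b.1 /\ j \notin b.2.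
Proof.
case/pair_sub => s1 s2; split.
  by apply/negP => /(subsetP s1); rewrite !inE eqxx.
by apply/negP => /(subsetP s2); rewrite !inE eqxx.
Qed.

(** An element uncovered by [top] is outside T, so it is neither j nor a loop of the contraction. *)
Lemma lift_flag t u : all (is_flat_pair X' r' s) t -> [seq pair_del c | c <- u] = t ->
  flag X r s (top :: u) -> flag X' r' s t.
Proof.
move=> bt ut ft; apply/and3P; split=> //.
  apply/allrelP => b c; rewrite -ut => /mapP[b' b'u ->] /mapP[c' c'u ->].
  have : pair_cmp b' c' by apply: (flag_cmp ft); rewrite inE ?b'u ?c'u orbT.
  by case/orP => /andP[h1 h2]; apply/orP; [left|right]; rewrite /pair_le !setSD.
have /set0Pn[e] : residue X r s (top :: u) != set0 by case/and3P: ft.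
rewrite inE covered_cons negb_or in_setI => /and5P[eX eL eC + cu].
rewrite /= eX andbT => eT; have ej : e != j by apply: contraNneq eT => ->; apply: mem_T.
apply/set0Pn; exists e; rewrite inE loops_contraction coloops_contraction in_setD1 ej eX eC /=.
rewrite in_setD1 (negbTE eT) andbF /=; apply: contra cu => /hasP[b].
rewrite -ut => /mapP[c cu -> /=]; rewrite !inE ej /= => h.
by apply/hasP; exists c; rewrite ?inE.
Qed.

(** Expanding each variable into its two lifts gives one product for each sequence u of lifts of
    t. *)
Lemma prod_lifts a t : all (is_flat_pair X' r' s) t ->
    (forall u, [seq pair_del c | c <- u] = t -> all (fun c => j \in c.1) u ->
       deg (a * \prod_(c <- u) x c) = 0) ->
  deg (a * \prod_(b <- t) x' b) = 0.
Proof.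
elim: t a => [|b t IH] a; first by move=> _ /(_ [::]); rewrite !big_nil; apply.
move=> /= /andP[pb pt] h; have [j1 j2] := contract_pair_sub pb.
rewrite big_cons {1}/contract_ray pb mulrDl mulrDr raddfD /= !mulrA !IH ?addr0 //.
  move=> u ut ju; have := h ((j |: b.1, j |: b.2) :: u); rewrite big_cons mulrA; apply.
    by rewrite /= ut /pair_del /= !setU1K // -surjective_pairing.
  by rewrite /= !inE eqxx.
move=> u ut ju; have := h ((j |: b.1, b.2) :: u); rewrite big_cons mulrA; apply.
  rewrite /= ut /pair_del /= setU1K //; congr (_ :: _).
  by rewrite (setDidPl _) -?surjective_pairing // disjoint_sym disjoints1.
by rewrite /= !inE eqxx.
Qed.

(** The lift that has j in its second component only when the closure forces it. For maximal flags
    it is the only one to survive. *)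
Definition normal_lift b : pair := (j |: b.1, closure X s b.2).

Lemma normal_lift_cases b : is_flat_pair X' r' s b ->
  [/\ pair_del (normal_lift b) = b, is_flat X s (closure X s b.2) &
   (closure X s b.2 = b.2 \/ closure X s b.2 = j |: b.2)].
Proof.
move=> pb; have [j1 j2] := contract_pair_sub pb; have [_ s2] := pair_sub pb.
case/and5P: pb => _ f2 _ _ _; have eD := closure_flat_deletion f2.
split.
- by rewrite /pair_del /= setU1K // eD -surjective_pairing.
- by apply: closure_flat => //; apply: subset_trans s2 (subsetDl _ _).
- have [jc|jc] := boolP (j \in closure X s b.2).
    by right; rewrite -{2}eD setD1K.
  by left; rewrite -{2}eD; apply/esym/setDidPl; rewrite disjoint_sym disjoints1.
Qed.

Lemma prod_normal_lifts a t : all (is_flat_pair X' r' s) t ->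
    (forall u, [seq pair_del c | c <- u] = t -> all (fun c => j \in c.1) u ->
       u != map normal_lift t -> deg (a * \prod_(c <- u) x c) = 0) ->
  deg (a * \prod_(b <- t) x' b) = deg (a * \prod_(b <- map normal_lift t) x b).
Proof.
elim: t a => [|b t IH] a; first by rewrite !big_nil.
move=> /= /andP[pb pt] h; have [j1 j2] := contract_pair_sub pb.
have [nb fn cn] := normal_lift_cases pb.
have main y z : pair_del y = b -> pair_del z = b -> j \in y.1 -> j \in z.1 ->
    y = normal_lift b -> z != y ->
    deg (a * (x y + x z) * \prod_(b <- t) x' b)
      = deg (a * x y * \prod_(b <- map normal_lift t) x b).
  move=> yb zb jy jz yn zy; rewrite mulrDr mulrDl raddfD /= [X in _ + X]prod_lifts //.
    rewrite addr0 IH // => u ut ju nu; have := h (y :: u).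
    rewrite big_cons mulrA; apply; rewrite /= ?ut ?yb ?jy //.
    by rewrite eqseq_cons negb_and nu orbT.
  move=> u ut ju; have := h (z :: u); rewrite big_cons mulrA; apply; rewrite /= ?ut ?zb ?jz //.
  by rewrite eqseq_cons -yn (negbTE zy).
rewrite !big_cons {1}/contract_ray pb !mulrA.
have d0 : pair_del (j |: b.1, b.2) = b.
  rewrite /pair_del /= setU1K // (setDidPl _) -?surjective_pairing //.
  by rewrite disjoint_sym disjoints1.
have d1 : pair_del (j |: b.1, j |: b.2) = b.
  by rewrite /pair_del /= !setU1K // -surjective_pairing.
have ne : (j |: b.1, b.2) != (j |: b.1, j |: b.2) :> pair.
  by rewrite xpair_eqE eqxx /=; apply: contraNneq j2 => ->; rewrite !inE eqxx.
case: cn => cn.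
  have -> : normal_lift b = (j |: b.1, b.2) by rewrite /normal_lift cn.
  apply: main => //; rewrite /= ?inE ?eqxx //; first by rewrite /normal_lift cn.
  by rewrite eq_sym.
have -> : normal_lift b = (j |: b.1, j |: b.2) by rewrite /normal_lift cn.
rewrite [x _ + x _]addrC; apply: main => //; rewrite /= ?inE ?eqxx //.
by rewrite /normal_lift cn.
Qed.

Lemma flat_setI F G : is_flat X s F -> is_flat X s G -> is_flat X s (F :&: G).
Proof.
move=> fF fG; rewrite /is_flat eqEsubset sub_closure ?andbT; last first.
  by rewrite subIset // (flat_sub fF).
by rewrite subsetI !closure_min ?subsetIl ?subsetIr.
Qed.

Lemma top_le b : is_flat_pair X r s b -> j \in b.1 -> pair_le top b.
Proof.
move=> pb jb; have [s1 s2] := pair_sub pb; case/and5P: pb => f1 _ _ _ _.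
by rewrite /pair_le s2 andbT; apply: closure_min; rewrite ?sub1set.
Qed.

(* An abnormal lift b of a maximal flag could be refined by inserting the pair
   obtained from b by removing j from its second component, which is too much. *)
Lemma lift_unique t u : flag X' r' s t -> uniq t -> size t = (#|X'| - 2)%N ->
  [seq pair_del c | c <- u] = t -> all (fun c => j \in c.1) u ->
  flag X r s (top :: u) -> u = map normal_lift t.
Proof.
move=> ft ut st dut ju fu.
have uu : uniq u by apply: (@map_uniq _ _ pair_del); rewrite dut.
have cX : #|X| = #|X'|.+1 by rewrite (cardsD1 j X) jX.
have X2 : (1 < #|X'|)%N by have [v [v0 vX _]] := height_hole d' ft; nlia.
have pu c : c \in u -> is_flat_pair X r s c.
  by move=> cu; apply: (flag_pair fu); rewrite inE cu orbT.
have pdu c : c \in u -> is_flat_pair X' r' s (pair_del c).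
  by move=> cu; apply: (flag_pair ft); rewrite -dut map_f.
pose abnormal c := (j \in c.2) && is_flat X s (c.2 :\ j).
have [no|some] := boolP (has abnormal u); last first.
  rewrite -dut -map_comp -[LHS]map_id; apply/eq_in_map => c cu /=.
  have jc : j \in c.1 by apply: (allP ju).
  have [_ _ cn] := normal_lift_cases (pdu c cu).
  have f2 : is_flat X s c.2 by case/and5P: (pu c cu).
  rewrite /normal_lift /= setD1K // [LHS]surjective_pairing; congr (_, _).
  have [j2|j2] := boolP (j \in c.2).
    case: cn => /= cn; last by rewrite cn setD1K.
    by case/hasP: some; exists c; rewrite // /abnormal j2 /is_flat cn eqxx.
  have -> : c.2 :\ j = c.2 by apply/setDidPl; rewrite disjoint_sym disjoints1.
  by rewrite (eqP f2).
pose v := filter abnormal u.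
have v0 : v != [::] by rewrite -has_filter.
have cv : allrel (@pair_cmp E) v v.
  apply/allrelP => b c; rewrite !mem_filter => /andP[_ bu] /andP[_ cu].
  by apply: (flag_cmp fu); rewrite inE ?bu ?cu orbT.
(* The largest abnormal lift c is refined. A member above c with j in its second component would be
   abnormal too, as an intersection of flats is a flat, so the refinement is comparable with all
   members. *)
have [c + cmax] := chain_max cv v0.
rewrite mem_filter => /andP[/andP[jc2 fc] cu].
have jc : j \in c.1 by apply: (allP ju).
pose new : pair := (c.1, c.2 :\ j).
have pc := pu c cu.
have pnew : is_flat_pair X r s new.
  case/and5P: pc => f1 f2 /eqP U _ _; rewrite /is_flat_pair f1 fc /=; apply/and3P; split.
  - apply/eqP; rewrite -U; apply/setP => e; rewrite !inE.
    by case: eqP => [->|]; rewrite ?jc.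
  - by rewrite xpair_eqE negb_and; apply/orP; left; apply: contraNneq not_loop_j => <-.
  - case/and5P: (pdu c cu) => _ _ _ _; rewrite coloops_contraction.
    by apply: contra => /eqP[e1 e2]; rewrite /pair_del e1 e2.
have le_new b : b \in u -> pair_cmp b new.
  move=> bu; have /orP[h|h] : pair_cmp b c by apply: (flag_cmp fu); rewrite inE ?bu ?cu orbT.
    apply/orP; left; case/andP: h => h1 h2; rewrite /pair_le h1 /=.
    by apply: subset_trans h2; apply: subsetDl.
  have [bv|bv] := boolP (b \in v).
    apply/orP; left; have := cmax b bv; case/andP => h1 h2; rewrite /pair_le h1 /=.
    by apply: subset_trans h2; apply: subsetDl.
  apply/orP; right; case/andP: h => h1 h2; rewrite /pair_le h1 /=.
  apply/subsetP => e eb; rewrite !inE (subsetP h2 e eb) andbT.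
  apply: contraNneq bv => ej; rewrite mem_filter bu andbT /abnormal -{1}ej eb /=.
  have -> : b.2 :\ j = b.2 :&: (c.2 :\ j).
    by rewrite setIDA (setIidPl h2).
  by apply: flat_setI => //; case/and5P: (pu b bu).
have new_top : pair_le top new by apply: top_le.
have fnew : flag X r s (new :: top :: u).
  apply/and3P; split.
  - by rewrite /= pnew; case/and3P: fu.
  - apply/allrelP => b b'; rewrite ![_ \in new :: _]inE.
    have cmp_new e : e \in top :: u -> pair_cmp e new.
      by rewrite inE => /orP[/eqP->|/le_new //]; rewrite /pair_cmp new_top.
    case/orP => [/eqP->|bu] /orP[/eqP->|b'u].
    + by rewrite /pair_cmp pair_lexx.
    + by rewrite pair_cmpC cmp_new.
    + exact: cmp_new.
    + exact: flag_cmp fu bu b'u.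
  - have /set0Pn[e] : residue X r s (top :: u) != set0 by case/and3P: fu.
    rewrite inE => /and4P[eX eL eC cove]; apply/set0Pn; exists e.
    rewrite inE eX eL eC covered_cons negb_or cove andbT /=.
    have : ~~ covered u e by move: cove; rewrite covered_cons negb_or => /andP[].
    by move/hasPn/(_ c cu); apply: contra; rewrite !inE => /and3P[-> _ ->].
(* With [new] and [top], the flag has |X| - 1 members, one more than is possible. *)
have := flag_size d fnew; rewrite /= cX -(size_map pair_del u) dut st.
suff -> : [&& new \notin top :: u, top \notin u & uniq u] by move/(_ isT); nlia.
rewrite uu andbT inE negb_or -andbA; apply/and3P; split.
- by apply/eqP => -[_ e2]; move: jX; rewrite -e2 !inE eqxx.
- apply/negP => nu.
  have : new = c.
    apply: (@uniq_map_inj_in _ _ pair_del u) => //; first by rewrite dut.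
    by rewrite /pair_del /= setDDl setUid.
  by move/(congr1 (fun b : pair => j \in b.2)); rewrite /= !inE eqxx jc2.
- apply/negP => tu; have := pdu _ tu; case/and5P => _ _ _ /eqP + _.
  by rewrite loops_contraction.
Qed.

(** Closure is monotone, so comparability is kept; it adds at most j to the second components, so an
    element uncovered in the minor stays uncovered. *)
Lemma normal_flag t : flag X' r' s t -> flag X r s (top :: map normal_lift t).
Proof.
move=> ft.
have pt b : b \in t -> is_flat_pair X' r' s b by apply: flag_pair ft.
have pn b : b \in t -> is_flat_pair X r s (normal_lift b).
  move=> bt; have pb := pt b bt; have [nb fn cn] := normal_lift_cases pb.
  have [j1 j2] := contract_pair_sub pb; have [s1 s2] := pair_sub pb.
  have jb1 : j |: b.1 \subset X by rewrite subUset sub1set jX (subset_trans s1 (subsetDl _ _)).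
  have s2X : b.2 \subset X := subset_trans s2 (subsetDl _ _).
  case/and5P: (pb) => f1 _ /eqP U _ nC; rewrite /is_flat_pair /= fn.
  rewrite -(@flat_contraction _ X r s j d) ?setU11 // setU1K // f1 /=; apply/and3P; split.
  - rewrite eqEsubset subUset jb1 closure_sub /=; apply/subsetP => e eX.
    have [->|ej] := eqVneq e j; first by rewrite in_setU setU11.
    have : e \in b.1 :|: b.2 by rewrite U in_setD1 ej.
    rewrite !in_setU => /orP[->|eb2]; first by rewrite orbT.
    by rewrite (subsetP (sub_closure _ s2X)) ?orbT.
  - rewrite xpair_eqE negb_and; apply/orP; left.
    by apply: contraNneq not_loop_j => <-; rewrite setU11.
  - rewrite coloops_contraction in nC; apply: contra nC => /eqP[e1 e2].
    rewrite -nb /pair_del /= e1 e2; apply/eqP; congr (_, _).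
    by apply/setDidPl; rewrite disjoint_sym disjoints1 not_coloop.
have cn b : b \in t -> pair_le top (normal_lift b).
  by move=> bt; apply: top_le; rewrite ?pn //= setU11.
apply/and3P; split.
- rewrite /= top_pair; apply/allP => _ /mapP[b bt ->]; exact: pn.
- apply/allrelP => b c; rewrite ![_ \in top :: _]inE.
  case/orP => [/eqP->|/mapP[b' b't ->]] /orP[/eqP->|/mapP[c' c't ->]].
  + by rewrite /pair_cmp pair_lexx.
  + by rewrite /pair_cmp cn.
  + by rewrite /pair_cmp cn ?orbT.
  + have : pair_cmp b' c' by apply: flag_cmp ft _ _.
    case/orP => /andP[h1 h2]; apply/orP; [left|right].
      by rewrite /pair_le /= setUS //= closure_mono.
    by rewrite /pair_le /= setUS //= closure_mono.
have /set0Pn[e] : residue X' r' s t != set0 by case/and3P: ft.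
rewrite inE loops_contraction coloops_contraction => /and4P[eX' eT eC cove].
have [ej eX] : e != j /\ e \in X by move: eX'; rewrite !inE => /andP[].
have eT' : e \notin T by apply: contra eT => eT; rewrite in_setD1 ej.
apply/set0Pn; exists e; rewrite inE eX eC covered_cons in_setI negb_or negb_and eT' /=.
apply/andP; split; first by apply: contra eT'; apply/subsetP/closure_mono/sub0set.
apply: contra cove => /hasP[_ /mapP[b bt ->]]; rewrite in_setI /= in_setU1 (negbTE ej) /= => /andP[e1 e2].
apply/hasP; exists b => //; rewrite in_setI e1 /=.
have [nb _ _] := normal_lift_cases (pt b bt).
by rewrite -nb /= in_setD1 ej.
Qed.

Lemma map_pair_del_normal t : all (is_flat_pair X' r' s) t ->
  [seq pair_del c | c <- map normal_lift t] = t.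
Proof.
move=> pt; rewrite -map_comp -[RHS]map_id; apply/eq_in_map => b bt /=.
by have [] := normal_lift_cases (allP pt b bt).
Qed.

(** A pair below [top] without j in its first component has first component of rank 0 and second
    component X: it is the excluded bottom. *)
Lemma deg_incomparable a b : (j \notin b.1) || ~~ is_flat_pair X r s b ->
  deg (a * x b * x top) = 0.
Proof.
have -> : a * x b * x top = a * \prod_(c <- [:: top; b]) x c.
  by rewrite !big_cons big_nil; ring.
move=> h; apply: (model_nonflag mod); apply: contraL h => fb.
have tb c : c \in [:: top; b] -> is_flat_pair X r s c by apply: flag_pair fb.
have pb : is_flat_pair X r s b by apply: tb; rewrite !inE eqxx orbT.
rewrite negb_or pb negbK andbT; apply: contraT => jb.
have bb : b \in [:: top; b] by rewrite !inE eqxx orbT.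
have /andP[/= h1 h2] := flag_le fb bb (mem_head _ _) mem_T jb.
case/and5P: (pb) => f1 f2 _ /eqP nL _; case: nL.
have [s1 s2] := pair_sub pb.
rewrite (surjective_pairing b); congr (_, _).
  by apply: (rank0_flat rP f1); have := flat_lt rP f1 h1 jX mem_T jb; rewrite rank_T; nlia.
by apply/eqP; rewrite eqEsubset s2 h2.
Qed.

(** Removing j sends the pairs compatible with [top] to pairs of the minor, except [top] itself,
    which goes to the excluded bottom, and the pairs sent to (X', C), the excluded top. These
    exceptions form the correction term. *)
Lemma deg_twist_sum a (P P' : pred pair) :
    (forall b, is_flat_pair X r s b -> j \in b.1 -> P b = P' (pair_del b)) ->
  deg' (a * \sum_(b : pair | P' b) x' b)
    + \sum_(b : pair | [&& j \in b.1, P b & (b == top) || (pair_del b == (X', C))])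
        deg (a * x b * x top)
  = deg' (a * \sum_(b : pair | P b) x b).
Proof.
move=> PP; set exc := fun b => (b == top) || (pair_del b == (X', C)).
pose g b := deg (a * x b * x top).
have g0 b : (j \notin b.1) || ~~ is_flat_pair X r s b -> g b = 0 by apply: deg_incomparable.
have sumE (Q : pred pair) z : deg' (a * \sum_(b : pair | Q b) z b) =
    \sum_(b : pair | Q b) deg (a * z b * x top).
  by rewrite /twist mulr_sumr mulr_suml raddf_sum.
rewrite !sumE [RHS](bigID exc) /= [RHS]addrC; congr (_ + _); last first.
  rewrite [RHS](bigID (fun b : pair => j \in b.1)) /= [X in _ = _ + X]big1 ?addr0 //; last first.
    by move=> b /andP[_ jb]; apply: g0; rewrite jb.
  by apply: eq_bigl => b; rewrite /exc; case: (j \in b.1); rewrite ?andbT ?andbF.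
transitivity (\sum_(b : pair | [&& is_flat_pair X' r' s (pair_del b), j \in b.1 & P' (pair_del b)]) g b).
  rewrite [RHS](partition_big pair_del (fun b' => is_flat_pair X' r' s b' && P' b')) /=; last first.
    by move=> b /and3P[-> _ ->].
  rewrite (bigID (is_flat_pair X' r' s)) /= addrC big1 ?add0r; last first.
    by move=> b /andP[_ nb]; rewrite /contract_ray (negbTE nb) mulr0 mul0r raddf0.
  apply: eq_big => [b|b' /andP[Pb pb]]; first by rewrite andbC.
  have [j1 j2] := contract_pair_sub pb.
  have d0 : pair_del (j |: b'.1, b'.2) = b'.
    rewrite /pair_del /= setU1K // (setDidPl _) -?surjective_pairing //.
    by rewrite disjoint_sym disjoints1.
  have d1 : pair_del (j |: b'.1, j |: b'.2) = b'.
    by rewrite /pair_del /= !setU1K // -surjective_pairing.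
  have ne : (j |: b'.1, j |: b'.2) != (j |: b'.1, b'.2) :> pair.
    by rewrite xpair_eqE eqxx /=; apply: contraNneq j2 => <-; rewrite !inE eqxx.
  rewrite /contract_ray pb mulrDr mulrDl raddfD /=.
  rewrite (bigD1 (j |: b'.1, b'.2)) /=; last by rewrite d0 pb Pb setU11 eqxx.
  rewrite (bigD1 (j |: b'.1, j |: b'.2)) /=; last by rewrite d1 pb Pb setU11 eqxx ne.
  rewrite big1 ?addr0 // => b /andP[/andP[/andP[/and3P[_ jb _] /eqP db] n0] n1].
  have [jb2|jb2] := boolP (j \in b.2).
    by case/eqP: n1; rewrite [LHS]surjective_pairing -db /= !setD1K.
  case/eqP: n0; rewrite [LHS]surjective_pairing -db /= setD1K //.
  by rewrite (setDidPl _) // disjoint_sym disjoints1.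
rewrite big_mkcond [RHS]big_mkcond /=; apply: eq_bigr => b _.
have [jb|jb] := boolP (j \in b.1); last by rewrite andbF -/(g b) g0 ?jb ?if_same.
have [pb|pb] := boolP (is_flat_pair X r s b); last first.
  by rewrite -/(g b) g0 ?pb ?orbT ?if_same.
rewrite PP // /exc negb_or andbC /=.
suff -> : is_flat_pair X' r' s (pair_del b) = (b != top) && (pair_del b != (X', C)) by [].
apply/idP/andP => [h|[h1 h2]]; last exact: pair_del_flat.
split; last by case/and5P: h => _ _ _ _; rewrite coloops_contraction.
case/and5P: h => _ _ _ + _; apply: contra => /eqP->.
by rewrite loops_contraction /pair_del.
Qed.

Lemma deg_twist_eq a (P P' : pred pair) :
    (forall b, is_flat_pair X r s b -> j \in b.1 -> P b = P' (pair_del b)) ->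
    (forall b, P b -> j \in b.1 -> b != top /\ pair_del b != (X', C)) ->
  deg' (a * \sum_(b : pair | P' b) x' b) = deg' (a * \sum_(b : pair | P b) x b).
Proof.
move=> h1 h2; have := deg_twist_sum a h1.
rewrite [X in _ + X]big_pred0 ?addr0 // => b.
by apply/and3P => -[jb Pb]; have [/negbTE-> /negbTE->] := h2 b Pb jb.
Qed.

Lemma prod_cons b t : x b * \prod_(c <- t) x c = \prod_(c <- b :: t) x c.
Proof. by rewrite big_cons. Qed.

(** In both linear relations the correction terms agree for i and k: both elements are outside T and
    inside X, and both are in X' and outside C. A maximal flag of the minor has one surviving lift,
    which is maximal together with [top]. *)
Lemma contraction_model : degree_model X' r' s x' deg'.
Proof.
split.
- move=> a t nft; rewrite -[LHS]/(deg (a * \prod_(b <- t) x' b * x top)).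
  rewrite -mulrA [_ * x top]mulrC mulrA.
  have [pt|] := boolP (all (is_flat_pair X' r' s) t); last first.
    case/allPn => b bt nb; suff -> : \prod_(c <- t) x' c = 0 by rewrite mulr0 raddf0.
    by rewrite (big_rem b bt) /= {1}/contract_ray (negbTE nb) mul0r.
  apply: prod_lifts => // u ut _; rewrite -mulrA prod_cons.
  by apply: (model_nonflag mod); apply: contra nft; apply: lift_flag.
- move=> a i k; rewrite !in_setD1 => /andP[ij iX] /andP[kj kX].
  rewrite loops_contraction !in_setD1 ij kj /= => iT kT.
  have nL e : e \notin T -> e \notin L by apply: contra; apply/subsetP/closure_mono/sub0set.
  have := model_fst mod (a * x top) iX kX (nL _ iT) (nL _ kT).
  rewrite ![a * x top * _]mulrAC -!/(twist deg (x top) _).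
  rewrite -(@deg_twist_sum a (fun b => i \in b.1) (fun b => i \in b.1)); last first.
    by move=> b _ _; rewrite /= in_setD1 ij.
  rewrite -(@deg_twist_sum a (fun b => k \in b.1) (fun b => k \in b.1)); last first.
    by move=> b _ _; rewrite /= in_setD1 kj.
  rewrite [X in _ + X = _ -> _](_ : _ = \sum_(b : pair | [&& j \in b.1, k \in b.1 & (b == top) || (pair_del b == (X', C))]) deg (a * x b * x top)).
    by move/addIr.
  apply: eq_bigl => b; case: (j \in b.1) => //=; case: eqP => [->|_] /=.
    by rewrite (negbTE iT) (negbTE kT).
  case: eqP => [[e1 _]|]; last by rewrite !andbF.
  have h e : e != j -> e \in X -> e \in b.1.
    by move=> ej eX; have : e \in b.1 :\ j; [rewrite e1 !inE ej | rewrite inE => /andP[]].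
  by rewrite !h.
- move=> a i k; rewrite !in_setD1 => /andP[ij iX] /andP[kj kX].
  rewrite coloops_contraction => iC kC.
  have := model_snd mod (a * x top) iX kX iC kC.
  rewrite ![a * x top * _]mulrAC -!/(twist deg (x top) _).
  rewrite -(@deg_twist_sum a (fun b => i \in b.2) (fun b => i \in b.2)); last first.
    by move=> b _ _; rewrite /= in_setD1 ij.
  rewrite -(@deg_twist_sum a (fun b => k \in b.2) (fun b => k \in b.2)); last first.
    by move=> b _ _; rewrite /= in_setD1 kj.
  rewrite [X in _ + X = _ -> _](_ : _ = \sum_(b : pair | [&& j \in b.1, k \in b.2 & (b == top) || (pair_del b == (X', C))]) deg (a * x b * x top)).
    by move/addIr.
  apply: eq_bigl => b; case: (j \in b.1) => //=; case: eqP => [->|_] /=.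
    by rewrite iX kX.
  case: eqP => [[_ e2]|]; last by rewrite !andbF.
  have h e : e != j -> e \notin C -> e \notin b.2.
    by move=> ej; apply: contra => eb; rewrite -e2 in_setD1 ej.
  by rewrite (negbTE (h _ ij iC)) (negbTE (h _ kj kC)).
- move=> t ft ut st; have pt : all (is_flat_pair X' r' s) t by case/and3P: ft.
  rewrite -[LHS]/(deg (\prod_(b <- t) x' b * x top)) mulrC prod_normal_lifts //.
    rewrite prod_cons; apply: (model_max mod).
    + exact: normal_flag.
    + rewrite /=; have := map_pair_del_normal pt => nt.
      rewrite (@map_uniq _ _ pair_del) ?nt // andbT; apply/negP => tn.
      have : pair_del top \in t by rewrite -nt map_f.
      move/(allP pt)/and5P => [_ _ _ /eqP + _].
      by rewrite loops_contraction.
    + have [v [v0 vX _]] := height_hole d' ft.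
      by rewrite /= size_map st (cardsD1 j X) jX; nlia.
  move=> u dut ju nu; rewrite prod_cons -[\prod_(_ <- _) _]mul1r.
  by apply: (model_nonflag mod); apply: contra nu => fu; apply/eqP/lift_unique.
Qed.

End Contraction.

(** * Deletion-contraction *)

Section CharPoly.
Variable E : finType.
Implicit Types (X A B : {set E}) (r : {set E} -> nat) (j e : E).

(* Whitney's expansion of the characteristic polynomial, at q + 1. *)
Definition shifted_charpoly X r : {poly int} :=
  \sum_(A : {set E} | A \subset X) (-1) ^+ #|A| *: ('X + 1) ^+ (r X - r A).

Lemma sum_subsets_split (V : nmodType) X j (f : {set E} -> V) : j \in X ->
  \sum_(A : {set E} | A \subset X) f A
    = \sum_(A : {set E} | A \subset X :\ j) (f A + f (j |: A)).
Proof.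
move=> jX; rewrite big_split /= (bigID (fun A : {set E} => j \in A)) /= addrC; congr (_ + _).
  by apply: eq_bigl => A; rewrite subsetD1.
rewrite (reindex_onto (fun A => j |: A) (fun A => A :\ j)) /=; last first.
  by move=> A /andP[_ jA]; rewrite setD1K.
apply: eq_bigl => A; rewrite setU11 andbT subUset sub1set jX /= subsetD1; congr (_ && _).
apply/eqP/idP => [<-|jA]; last by rewrite setU1K.
by rewrite !inE eqxx.
Qed.

Lemma cardsU1_notin j A : j \notin A -> (-1) ^+ #|j |: A| = - (-1) ^+ #|A| :> int.
Proof. by move=> jA; rewrite cardsU1 jA add1n exprS mulN1r. Qed.

Lemma shifted_charpoly_deletion X r j : rank_axioms r -> j \in X ->
    r [set j] = 1%N -> r (X :\ j) = r X ->
  shifted_charpoly X r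
    = shifted_charpoly (X :\ j) r - shifted_charpoly (X :\ j) (contraction r j).
Proof.
move=> rP jX rj rX; rewrite /shifted_charpoly (sum_subsets_split _ jX) big_split /= rX.
congr (_ + _); rewrite -sumrN; apply: eq_bigr => A; rewrite subsetD1 => /andP[_ jA].
rewrite cardsU1_notin // scaleNr; congr (- (_ *: _ ^+ _)).
rewrite /contraction setD1K // rj.
have := rank_mono rP (subsetUl [set j] A); rewrite rj; nlia.
Qed.

Lemma shifted_charpoly_loop X r e : rank_axioms r -> e \in X -> r [set e] = 0%N ->
  shifted_charpoly X r = 0.
Proof.
move=> rP eX re; rewrite /shifted_charpoly (sum_subsets_split _ eX) big1 // => A.
rewrite subsetD1 => /andP[_ eA]; rewrite cardsU1_notin // scaleNr.
by rewrite (rankU1_sub rP (sub0set A)) ?subrr // setU0 re (rank0 rP).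
Qed.

Lemma rank_cardD r A B : rank_axioms r -> A \subset B -> (r B + #|A| <= r A + #|B|)%N.
Proof.
move=> rP sAB; apply: (rank_ind (P := fun B => (r B + #|A| <= r A + #|B|)%N) sAB) => //.
by move=> D e _ _ _ eD le; rewrite cardsU1 eD; have := rankU1 rP e D; nlia.
Qed.

(** When all elements are coloops the characteristic polynomial is (q - 1)^|X|. *)
Lemma shifted_charpoly_free X r : rank_axioms r -> r X = #|X| ->
  shifted_charpoly X r = 'X ^+ #|X|.
Proof.
move=> rP rX; have {rX} rA A : A \subset X -> r A = #|A|.
  by move=> sA; have := rank_cardD rP sA; have := rank_card rP A; nlia.
have [m] := ubnP #|X|; elim: m X rA => // m IH X rA /ltnSE le.
have [X0|[j jX]] := set_0Vmem X.
  rewrite X0 cards0 expr0 /shifted_charpoly (big_pred1 set0) => [|A]; last by rewrite subset0.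
  by rewrite cards0 subnn !expr0 scale1r.
have cX := cardsD1 j X; rewrite jX in cX.
rewrite cX exprS -IH; [|move=> A sA; apply/rA/(subset_trans sA)/subsetDl|nlia].
rewrite /shifted_charpoly (sum_subsets_split _ jX) mulr_sumr; apply: eq_bigr => A sA.
have jA : j \notin A by move: sA; rewrite subsetD1 => /andP[].
have sA' := subset_trans sA (subsetDl _ _).
have sA'' : j |: A \subset X by rewrite subUset sub1set jX.
have leA := subset_leq_card sA.
rewrite cardsU1_notin // !rA ?subsetDl // cardsU1 jA cX !add1n subSn // subSS exprS.
by rewrite scaleNr -scalerBr -scalerAr mulrDl mul1r addrK.
Qed.

Lemma coef_XaddC1_exp m k : (m <= k)%N ->
  (('X + 1 : {poly int}) ^+ m)`_k = (k == m)%:R.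
Proof.
have mon : 'X + 1 \is @monic int by rewrite -polyC1 monicXaddC.
have sz : size (('X + 1 : {poly int}) ^+ m) = m.+1.
  have := size_exp ('X + 1 : {poly int}) m; rewrite -polyC1 size_XaddC mul1n polyC1 => e.
  by rewrite -[LHS]prednK ?e // lt0n size_poly_eq0 monic_neq0 // monic_exp.
rewrite leq_eqVlt => /orP[/eqP<-|lt].
  by rewrite eqxx; have := monic_exp m mon; rewrite monicE lead_coefE sz => /eqP.
by rewrite nth_default ?sz // gtn_eqF.
Qed.

(** Without loops, the empty set is the only subset of rank 0, so it alone contributes in degrees at
    least r X. *)
Lemma shifted_charpoly_coef X r k : rank_axioms r -> closure X r set0 = set0 ->
  (r X <= k)%N -> (shifted_charpoly X r)`_k = (k == r X)%:R.
Proof.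
move=> rP ll le; rewrite /shifted_charpoly coef_sum (bigD1 set0) ?sub0set //=.
rewrite cards0 expr0 scale1r rank0 // subn0 coef_XaddC1_exp // big1 ?addr0 // => A /andP[sA A0].
have [e eA] := set0Pn _ A0; rewrite coefZ.
have re : r [set e] != 0%N.
  by rewrite -(mem_loops rP (subsetP sA e eA)) ll inE.
have := rank_mono rP (_ : [set e] \subset A); rewrite sub1set => /(_ eA) leA.
have rX0 := rank_mono rP sA.
rewrite coef_XaddC1_exp; last by nlia.
by rewrite gtn_eqF ?mulr0 //; nlia.
Qed.

(* The coefficient of q^k in the reduced characteristic polynomial at q + 1,
   without its sign. *)
Definition reduced_coef X r k : int :=
  (-1) ^+ (r X + k.+1) * (shifted_charpoly X r)`_k.+1.

End CharPoly.

(** * Exchange of a matroid and its dual *)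

Section Swap.
Variables (E : finType) (A R : comNzRingType).
Local Notation pair := ({set E} * {set E})%type.
Variables (X : {set E}) (r s : {set E} -> nat) (x : pair -> A) (deg : {additive A -> R}).

Definition swap (b : pair) : pair := (b.2, b.1).

Lemma swapK : involutive swap. Proof. by case. Qed.

Lemma flat_pair_swap b : is_flat_pair X s r (swap b) = is_flat_pair X r s b.
Proof.
case: b => F G; rewrite /is_flat_pair /= setUC !xpair_eqE.
by case: (is_flat X r F) => //=; rewrite ?andbF // ![_ && (_ == X)]andbC [X in _ && (_ && X)]andbC.
Qed.

Lemma pair_cmp_swap b c : pair_cmp (swap b) (swap c) = pair_cmp b c.
Proof. by rewrite /pair_cmp /pair_le /= orbC; congr (_ || _); apply: andbC. Qed.

Lemma covered_swap t e : covered (map swap t) e = covered t e.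
Proof. by rewrite /covered has_map; apply: eq_has => b /=; rewrite setIC. Qed.

Lemma flag_swap t : flag X s r (map swap t) = flag X r s t.
Proof.
rewrite /flag all_map allrel_mapl allrel_mapr; congr [&& _, _ & _].
- by apply: eq_all => b; apply: flat_pair_swap.
- by apply: eq_allrel => b c; apply: pair_cmp_swap.
- congr (_ != set0); apply/setP => e; rewrite !inE covered_swap; congr (_ && _); rewrite andbCA //.
Qed.

Lemma sum_swap (P : pred pair) :
  \sum_(b : pair | P b) x (swap b) = \sum_(b : pair | P (swap b)) x b.
Proof.
rewrite [RHS](reindex_inj (inv_inj swapK)) /=.
by apply: eq_bigl => b; rewrite swapK.
Qed.

(** Applied before and after a contraction in [s], this gives the model of a deletion in [r]. *)
Lemma swap_model : degree_model X r s x deg -> degree_model X s r (x \o swap) deg.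
Proof.
move=> mod; have fs t : flag X r s (map swap t) = flag X s r t.
  by rewrite -[in RHS](mapK swapK t) -flag_swap (mapK swapK).
split.
- by move=> a t nf; rewrite -(big_map swap xpredT x); apply: (model_nonflag mod); rewrite fs.
- by move=> a i j iX jX iC jC; rewrite !(sum_swap (fun b => _ \in b.1)); apply: (model_snd mod).
- by move=> a i j iX jX iC jC; rewrite !(sum_swap (fun b => _ \in b.2)); apply: (model_fst mod).
- move=> t ft ut st; rewrite -(big_map swap xpredT x); apply: (model_max mod).
  + by rewrite fs.
  + by rewrite (map_inj_uniq (inv_inj swapK)).
  + by rewrite size_map.
Qed.

End Swap.

(** * Induction on the size of the ground set *)

Section Induction.
Variables (E : finType) (A R : comNzRingType).
Local Notation pair := ({set E} * {set E})%type.
Implicit Types (X : {set E}) (r s : {set E} -> nat) (x : pair -> A) (deg : {additive A -> R}).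

(** Changing the index of gamma or delta is allowed only under [deg], not in the ring, so powers are
    rewritten one factor at a time. *)
Lemma deg_exp_congr (deg : {additive A -> R}) (u v : A) :
    (forall a, deg (a * u) = deg (a * v)) ->
  forall k a, deg (a * u ^+ k) = deg (a * v ^+ k).
Proof.
move=> uv k; elim: k => [|k IH] a; first by rewrite !expr0.
by rewrite !exprS !mulrA IH mulrAC uv mulrAC.
Qed.

Lemma deg_exp2_congr (deg : {additive A -> R}) (u v u' v' : A) k m a :
    (forall a, deg (a * u) = deg (a * u')) -> (forall a, deg (a * v) = deg (a * v')) ->
  deg (a * (u ^+ k * v ^+ m)) = deg (a * (u' ^+ k * v' ^+ m)).
Proof.
move=> uu vv; rewrite mulrA (deg_exp_congr vv) mulrAC (deg_exp_congr uu).
by rewrite -mulrA [v' ^+ m * _]mulrC.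
Qed.

(** Coloops are allowed because deletion creates them. Only e must not be a coloop, so that delta
    can be moved to other non-coloops; in each minor e is replaced by a new element. *)
Theorem degree_gamma_delta X r s x deg e k :
    dual_ranks X r s -> closure X r set0 = set0 -> degree_model X r s x deg ->
    e \in X -> e \notin closure X s set0 -> (k <= #|X| - 2)%N ->
  deg (gamma_elt X x e ^+ k * delta_elt x e ^+ (#|X| - 2 - k)) = (reduced_coef X r k)%:~R.
Proof.
have [n] := ubnP #|X|.
elim: n X r s x deg e k => // n IH X r s x deg j k /ltnSE leXn d ll mod jX jC lek.
have [rP sP _] := d.
have rj1 : r [set j] = 1%N.
  apply/eqP; rewrite eqn_leq rank1_le // lt0n -(mem_loops rP jX) ll inE //.
have sj1 : s [set j] = 1%N.
  by apply/eqP; rewrite eqn_leq rank1_le // lt0n -(mem_loops sP jX).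
have tot := dual_total d.
have rX0 := rank_mono rP (_ : [set j] \subset X); rewrite sub1set jX rj1 in rX0.
have sX0 := rank_mono sP (_ : [set j] \subset X); rewrite sub1set jX sj1 in sX0.
move: rX0 sX0 => /(_ isT) rX0 /(_ isT) sX0.
have f0 : is_flat X r set0 by rewrite /is_flat ll.
have X0 : set0 != X by apply: contraTneq jX => <-; rewrite inE.
(* Without delta, the degree is 1 if r X = |X| - 1 and 0 if r X is smaller; so is the leading
   coefficient or the one beyond it. *)
have [ek|nk] := eqVneq k (#|X| - 2)%N.
  rewrite ek subnn expr0 mulr1 -ek.
  have [rX|rX] := eqVneq #|X| (r X).+1.
    rewrite -[_ ^+ k]mulr1 -(big_nil 1 *%R xpredT x).
    rewrite (gamma_max d mod ll jX (t := [::]) (F := set0)) //; last 3 first.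
    - by left.
    - apply/and3P; split=> //; apply/set0Pn; exists j.
      by rewrite inE jX ll jC inE.
    - by rewrite (rank0 rP).
    rewrite /reduced_coef (_ : k.+1 = r X); last by nlia.
    rewrite (shifted_charpoly_coef rP ll) // eqxx mulr1 addnn -mul2n exprM sqrrN !expr1n.
    by [].
  rewrite -[_ ^+ k]mulr1 -(big_nil 1 *%R xpredT x) -[_ ^+ k]mul1r.
  rewrite (gamma_rank_vanish d mod ll jX _ f0) //; last 2 first.
  - by left.
  - by rewrite (rank0 rP); nlia.
  rewrite /reduced_coef (shifted_charpoly_coef rP ll); last by nlia.
  by rewrite (_ : (k.+1 == r X) = false) ?mulr0 //; apply/negbTE; nlia.
have [m em] : exists m, (#|X| - 2 - k = m.+1)%N by exists (#|X| - 2 - k).-1; nlia.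
have rXj : r (X :\ j) = r X.
  have := dual_rank d (_ : [set j] \subset X); rewrite sub1set cards1 => /(_ jX).
  by rewrite sj1; nlia.
have cX : #|X| = #|X :\ j|.+1 by rewrite (cardsD1 j X) jX.
pose T := closure X r [set j]; pose S := closure X s [set j].
pose g := gamma_elt X x j; pose dl := delta_elt x j.
have recur : deg (g ^+ k * dl ^+ m.+1) =
    deg (g ^+ k * dl ^+ m * x ([set j], X)) + deg (g ^+ k * dl ^+ m * x (X, S)).
  have -> : g ^+ k * dl ^+ m.+1 = g ^+ k * dl ^+ m * \sum_(b : pair | j \in b.1 :&: b.2) x b.
    by rewrite exprSr mulrA.
  have jS : j \in S by rewrite (subsetP (sub_closure _ _)) ?sub1set ?inE.
  have ne : (X, S) != ([set j], X) :> pair.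
    apply/eqP => -[e _]; move: em cX; rewrite e cards1; nlia.
  rewrite deg_mul_sum (bigD1 ([set j], X)) /=; last by rewrite !inE eqxx.
  rewrite (bigD1 (X, S)) /=; last by rewrite in_setI jX jS ne.
  rewrite big1 ?addr0 // => b /andP[/andP[jb b1] b2].
  have [pb|pb] := boolP (is_flat_pair X r s b); last exact: (deg_nonpair mod).
  have -> : x b = \prod_(c <- [:: b]) x c by rewrite big_seq1.
  (* If [b.1] is not X, at most |X| - 3 = k + m elements are spare, and the k + m remaining factors
     kill the term. *)
  have [bX|bX] := eqVneq b.1 X; last first.
    rewrite -[g ^+ k]mul1r; apply: (gamma_delta_vanish d mod ll jX jC).
      by move=> c; rewrite inE => /eqP->.
    by have := spare_single pb bX jb b1; nlia.
  have eb : b = (X, b.2) by rewrite [LHS]surjective_pairing bX.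
  have fb : is_flat X s b.2 by case/and5P: pb.
  have [_ sb] := pair_sub pb.
  have jb2 : j \in b.2 by move: jb; rewrite in_setI => /andP[].
  have Sb : S \subset b.2 by apply: closure_min; rewrite // sub1set.
  have rS : s S = 1%N by rewrite /S (rank_closure sP) ?sub1set.
  have sG : (1 < s b.2)%N.
    rewrite ltnNge; apply: contra b2 => le; rewrite {1}eb; apply/eqP; congr (_, _).
    by apply: (flat_eq sP _ Sb sb); rewrite ?rS // closure_flat ?sub1set.
  rewrite -[g ^+ k]mul1r; apply: (top_vanish d mod ll jX jC _ _ _ sG) => //.
  - by rewrite inE {2}eb eqxx.
  - by move=> c; rewrite inE => /eqP->; rewrite {1}eb pair_lexx.
  - by rewrite /=; nlia.
have jE (B : {set E}) e : e != j -> (e \in B :\ j) = (e \in B) by move=> ej; rewrite in_setD1 ej.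
have term1 : deg (g ^+ k * dl ^+ m * x ([set j], X)) =
    (reduced_coef (X :\ j) (contraction r j) k)%:~R.
  have jT : j \in T by rewrite (subsetP (sub_closure _ _)) ?sub1set ?inE.
  (* If {j} is not a flat, ({j}, X) is not a flat pair, and the contraction has a loop: both sides
     vanish. *)
  have [TE|TE] := eqVneq T [set j]; last first.
    rewrite (deg_nonpair mod); last by rewrite /is_flat_pair /= /is_flat -/T (negbTE TE).
    have /subsetPn[e eT ej] : ~~ (T \subset [set j]).
      by apply: contra TE => sT; rewrite eqEsubset sT sub1set.
    rewrite inE in ej; have eX : e \in X by apply: (subsetP (closure_sub X r [set j])).
    rewrite /reduced_coef (@shifted_charpoly_loop _ _ _ e) ?coef0 ?mulr0 //.
    - exact: contraction_axioms d.
    - by rewrite in_setD1 ej.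
    - move: eT; rewrite inE /contraction setUC => /andP[_ /eqP->]; exact: subnn.
  (* Orthogonality of the empty flat and the flat of coloops: j is not the only non-coloop. The new
     e is used in the minor. *)
  have [e ej /andP[eX eC]] : exists2 e, e != j & (e \in X) && (e \notin closure X s set0).
    have : X :\: (set0 :|: closure X s set0) != [set j].
      by apply: (flat_dual_flat_setU d) => //; rewrite closure_flat ?sub0set.
    rewrite set0U eqEsubset sub1set in_setD jC jX !andbT => /subsetPn[e].
    by rewrite in_setD inE => /andP[eC eX] ej; exists e; rewrite // eX.
  have eT : e \notin T by rewrite TE inE.
  have eL : e \notin closure X r set0 by rewrite ll inE.
  have jL : j \notin closure X r set0 by rewrite ll inE.
  have d' := dual_ranks_contraction d jX.
  have mod' := contraction_model d mod jX rj1 sj1.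
  have -> : x ([set j], X) = x (T, X) by rewrite TE.
  rewrite -[LHS]/(twist deg (x (T, X)) (g ^+ k * dl ^+ m)).
  have ge a : twist deg (x (T, X)) (a * g) =
      twist deg (x (T, X)) (a * gamma_elt (X :\ j) (contract_ray X r s x j) e).
    transitivity (twist deg (x (T, X)) (a * gamma_elt X x e)).
      rewrite /twist /= ![a * _ * x _]mulrAC.
      exact: (gamma_elt_indep mod).
    symmetry; apply: (deg_twist_eq d mod jX rj1 sj1).
      move=> b pb jb; rewrite /= jE //; congr (_ && ~~ _).
      by apply/eqP/eqP => [->//|h]; rewrite -(setD1K jb) h setD1K.
    move=> b /andP[eb bX] jb; split; first by apply: contraNneq eT => bT; rewrite bT in eb.
    by apply: contraNneq bX => -[h _]; rewrite -(setD1K jb) h setD1K.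
  have de a : twist deg (x (T, X)) (a * dl) =
      twist deg (x (T, X)) (a * delta_elt (contract_ray X r s x j) e).
    transitivity (twist deg (x (T, X)) (a * delta_elt x e)).
      rewrite /twist /= ![a * _ * x _]mulrAC.
      exact: (delta_elt_indep mod).
    symmetry; apply: (deg_twist_eq d mod jX rj1 sj1).
      by move=> b pb jb; rewrite !in_setI /= !jE.
    move=> b; rewrite in_setI => /andP[eb1 eb2] jb; split.
      by apply: contraNneq eT => bT; rewrite bT in eb1.
    by apply: contraNneq eC => -[_ h]; rewrite -h jE.
  have := @deg_exp2_congr (twist deg (x (T, X))) _ _ _ _ k m 1 ge de; rewrite !mul1r => ->.
  have -> : m = (#|X :\ j| - 2 - k)%N by nlia.
  apply: (IH (X :\ j) (contraction r j) s) => //.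
  - by nlia.
  - by rewrite (loops_contraction j d) -/T TE setDv.
  - by rewrite jE.
  - by rewrite (coloops_contraction d jX sj1).
  - by nlia.
have term2 : deg (g ^+ k * dl ^+ m * x (X, S)) = (reduced_coef (X :\ j) r k)%:~R.
  have jS : j \in S by rewrite (subsetP (sub_closure _ _)) ?sub1set ?inE.
  have SX' : S \subset X by apply: closure_sub.
  (* If S = X, the pair (X, X) is in no flag, while X \ j is free; the only nonzero coefficient of
     its polynomial is in degree |X| - 1, beyond k + 1. *)
  have [SE|SE] := eqVneq S X.
    rewrite SE; have -> : x (X, X) = \prod_(c <- [:: (X, X)]) x c by rewrite big_seq1.
    rewrite (model_nonflag mod); last first.
      apply/and3P => -[_ _ /set0Pn[e]]; rewrite inE => /and4P[eX _ _].
      by rewrite covered_cons in_setI /= eX.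
    have sX1 : s X = 1%N by rewrite -SE /S (rank_closure sP) ?sub1set.
    rewrite /reduced_coef shifted_charpoly_free //; last by nlia.
    by rewrite coefXn (_ : (k.+1 == #|X :\ j|) = false) ?mulr0 //; apply/negbTE; nlia.
  have /properP[_ [e eX eS]] : S \proper X by rewrite properEneq SE.
  have ej : e != j by apply: contraNneq eS => ->.
  have eC : e \notin closure X s set0.
    by apply: contra eS; apply/subsetP/closure_mono/sub0set.
  have eL : e \notin closure X r set0 by rewrite ll inE.
  have jL : j \notin closure X r set0 by rewrite ll inE.
  have ds := dual_ranks_sym d.
  have mods := swap_model mod.
  have d' := dual_ranks_sym (dual_ranks_contraction ds jX).
  have mod' := swap_model (contraction_model ds mods jX sj1 rj1).
  pose x1 := contract_ray X s r (x \o @swap E) j.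
  rewrite -[LHS]/(twist deg ((x \o @swap E) (S, X)) (g ^+ k * dl ^+ m)).
  set dd := twist deg _.
  have ge a : dd (a * g) = dd (a * gamma_elt (X :\ j) (x1 \o @swap E) e).
    transitivity (dd (a * gamma_elt X x e)).
      rewrite /dd /twist /= ![a * _ * x _]mulrAC.
      exact: (gamma_elt_indep mod).
    have -> : gamma_elt X x e = \sum_(b : pair | (e \in b.2) && (b.2 != X)) (x \o @swap E) b.
      by rewrite (sum_swap x (fun b => (e \in b.2) && (b.2 != X))).
    have -> : gamma_elt (X :\ j) (x1 \o @swap E) e
        = \sum_(b : pair | (e \in b.2) && (b.2 != X :\ j)) x1 b.
      by rewrite /gamma_elt (sum_swap x1 (fun b => (e \in b.1) && (b.1 != X :\ j))).
    symmetry; apply: (deg_twist_eq ds mods jX sj1 rj1).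
      move=> b pb jb; rewrite /= jE //; congr (_ && ~~ _).
      apply/eqP/eqP => [->//|h]; apply: (flat_deletion_ground ds jX sj1 rj1) h.
      by case/and5P: pb.
    move=> b /andP[eb bX] jb; split; first by apply: contraNneq bX => ->.
    by apply: contraNneq eL => -[_ h]; rewrite -h jE.
  have de a : dd (a * dl) = dd (a * delta_elt (x1 \o @swap E) e).
    transitivity (dd (a * delta_elt x e)).
      rewrite /dd /twist /= ![a * _ * x _]mulrAC.
      exact: (delta_elt_indep mod).
    have -> : delta_elt x e = \sum_(b : pair | e \in b.2 :&: b.1) (x \o @swap E) b.
      by rewrite (sum_swap x (fun b => e \in b.2 :&: b.1)).
    have -> : delta_elt (x1 \o @swap E) e = \sum_(b : pair | e \in b.2 :&: b.1) x1 b.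
      by rewrite /delta_elt (sum_swap x1 (fun b => e \in b.1 :&: b.2)).
    symmetry; apply: (deg_twist_eq ds mods jX sj1 rj1).
      by move=> b pb jb; rewrite !in_setI /= !jE.
    move=> b; rewrite in_setI => /andP[eb2 eb1] jb; split.
      by apply: contraNneq eS => bT; rewrite bT in eb1.
    by apply: contraNneq eL => -[_ h]; rewrite -h jE.
  have := @deg_exp2_congr dd _ _ _ _ k m 1 ge de; rewrite !mul1r => h; apply: etrans h _.
  have -> : m = (#|X :\ j| - 2 - k)%N by nlia.
  apply: (IH (X :\ j) r (contraction s j)) => //.
  - by nlia.
  - by rewrite closure_deletion ll set0D.
  - by rewrite jE.
  - by rewrite (loops_contraction j ds) -/S jE.
  - by nlia.
rewrite em recur term1 term2 -intrD; congr (_%:~R).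
rewrite /reduced_coef (shifted_charpoly_deletion rP jX rj1 rXj) coefB rXj.
rewrite /contraction setD1K // rj1.
(* The contraction has rank one less, so the sign in [reduced_coef] absorbs the minus sign of
   deletion-contraction. *)
have -> : (r X + k.+1 = (r X - 1 + k.+1).+1)%N by nlia.
by rewrite exprS; ring.
Qed.

End Induction.

(** * Functionals from Minkowski weights *)

Section MonomialSupport.
Variable N : nat.
Implicit Types (m : 'X_{1..N}) (b c : 'I_N) (D : {set 'I_N}).

Definition msupport m : {set 'I_N} := [set b | m b != 0%N].

Lemma msupportDU m b : msupport (m + U_(b)) = b |: msupport m.
Proof.
apply/setP => c; rewrite !inE mnmDE mnm1E addn_eq0 negb_and orbC eqb0 negbK.
by rewrite eq_sym.
Qed.

Lemma msupport_in m b : b \in msupport m -> msupport (m + U_(b)) = msupport m.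
Proof. by move=> bm; rewrite msupportDU (setUidPr _) ?sub1set. Qed.

Definition squarefree m : bool := [forall b, (m b <= 1)%N].

Lemma mdegDU m b : mdeg (m + U_(b)) = (mdeg m).+1.
Proof. by rewrite mdegD mdeg1 addn1. Qed.

Lemma mdeg_squarefree m : squarefree m -> mdeg m = #|msupport m|.
Proof.
move=> /forallP sm; rewrite mdegE -sum1_card big_mkcond [RHS]big_mkcond /=.
by apply: eq_bigr => b _; rewrite inE; have := sm b; case: (m b) => [|[]].
Qed.

End MonomialSupport.

(* A Minkowski weight defines a functional on the top degree of the Chow ring:
   the values on monomials are determined by descending induction on the size of
   their support, and the constant weight 1 on a balanced fan is consistent. *)
Section WeightFunctional.
Variables (N k : nat) (R : comNzRingType).
Variables (face : pred {set 'I_N}) (lin : ('I_N -> R) -> Prop).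
Implicit Types (m : 'X_{1..N}) (b c : 'I_N) (D : {set 'I_N}) (l : 'I_N -> R).

Hypothesis face_sub : forall D D', D' \subset D -> face D -> face D'.
Hypothesis lin_comb : forall l (I : finType) (P : pred I) (f : I -> R) (g : I -> 'I_N -> R),
  lin l -> (forall i, P i -> lin (g i)) -> lin (fun b => l b - \sum_(i | P i) f i * g i b).
Hypothesis dual_basis : forall D b, face D -> b \in D ->
  exists2 l, lin l & forall c, c \in D -> l c = (c == b)%:R.
Hypothesis balanced : forall D l, face D -> #|D|.+1 = k -> lin l ->
  (forall b, b \in D -> l b = 0) -> \sum_(c | (c \notin D) && face (c |: D)) l c = 0.

(** At stage j the linear relations hold for multiples of monomials with more than N - j variables;
    stage 0 asks for none. The next stage changes the values only at monomials with exactly N - j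
    variables, one of them repeated. *)
Lemma weight_functional_step (j : nat) : exists phi : 'X_{1..N} -> R,
  [/\ forall m, mdeg m != k -> phi m = 0,
      forall m, ~~ face (msupport m) -> phi m = 0,
      forall m, squarefree m -> face (msupport m) -> mdeg m = k -> phi m = 1
    & forall m l, (N < #|msupport m| + j)%N -> lin l -> \sum_b l b * phi (m + U_(b))%MM = 0].
Proof.
elim: j => [|j [phi [phi_deg phi_face phi_sqf phi_lin]]].
  exists (fun m => if [&& squarefree m, face (msupport m) & mdeg m == k] then 1 else 0); split.
  - by move=> m /negbTE->; rewrite !andbF.
  - by move=> m /negbTE->; rewrite andbF.
  - by move=> m -> -> ->; rewrite eqxx.
  - by move=> m l; have := max_card (mem (msupport m)); rewrite card_ord addn0 leqNgt => /negbTE->.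
have /choice[dl dlP] : forall Db : {set 'I_N} * 'I_N, exists l,
    face Db.1 -> Db.2 \in Db.1 -> lin l /\ forall c, c \in Db.1 -> l c = (c == Db.2)%:R.
  move=> [D b] /=; have [fD|] := boolP (face D); last by exists (fun=> 0).
  have [bD|] := boolP (b \in D); last by exists (fun=> 0).
  by have [l l1 l2] := dual_basis fD bD; exists l.
(* One copy of the repeated variable b is traded, through the linear form dual to b on the support,
   for variables outside the support. The value is thus expressed by monomials with larger
   support. *)
pose new m b := - \sum_(c | c \notin msupport m) dl (msupport m, b) c * phi (m - U_(b) + U_(c))%MM.
pose phi' m := if (#|msupport m| + j == N)%N && ((mdeg m == k) && face (msupport m)) then
    if [pick b | (1 < m b)%N] is Some b then new m b else phi m else phi m.
exists phi'; split.
- by move=> m /negbTE nk; rewrite /phi' nk andbF phi_deg ?nk.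
- by move=> m nf; rewrite /phi' (negbTE nf) !andbF phi_face.
- move=> m /[dup] sm /forallP s1 fm dm; rewrite /phi'; case: ifP => _; last exact: phi_sqf.
  by case: pickP => [b|_]; [rewrite ltnNge s1 | exact: phi_sqf].
move=> m l; rewrite addnS ltnS leq_eqVlt => /orP[/eqP eN|lt] lin_l; last first.
  rewrite -[RHS](phi_lin m l lt lin_l); apply: eq_bigr => b _; congr (_ * _).
  rewrite /phi' gtn_eqF // msupportDU.
  by apply: leq_trans lt _; rewrite leq_add2r subset_leq_card // subsetUr.
set D := msupport m.
have [fD|nfD] := boolP (face D); last first.
  apply: big1 => b _; rewrite /phi' msupportDU.
  have nf : ~~ face (b |: D) by apply: contra nfD; apply: face_sub; apply: subsetUr.
  by rewrite (negbTE nf) !andbF phi_face ?mulr0 // msupportDU.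
have [dm|ndm] := eqVneq (mdeg m).+1 k; last first.
  apply: big1 => b _; rewrite /phi' mdegDU (negbTE ndm) andbF phi_deg ?mulr0 //.
  by rewrite mdegDU.
have big_supp m' c : msupport m' = D -> c \notin D ->
    (N < #|msupport (m' + U_(c))| + j)%N.
  by move=> sm cD; rewrite msupportDU sm cardsU1 cD add1n addSn ltnS -eN.
have phi'_out c : c \notin D -> phi' (m + U_(c))%MM = phi (m + U_(c))%MM.
  move=> cD; rewrite /phi' gtn_eqF //; exact: (big_supp m).
have dlP' b : b \in D -> lin (dl (D, b)) /\ forall c, c \in D -> dl (D, b) c = (c == b)%:R.
  by move=> bD; apply: (dlP (D, b)).
(* The relation given by the functional dual to b, for a monomial of support D + c. *)
have rel m0 b c : msupport m0 = D -> b \in D -> c \notin D ->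
    phi (m0 + U_(c) + U_(b))%MM =
      - \sum_(c' | c' \notin D) dl (D, b) c' * phi (m0 + U_(c) + U_(c'))%MM.
  move=> sm0 bD cD; have [lb lbD] := dlP' b bD.
  have := phi_lin (m0 + U_(c))%MM _ (big_supp m0 c sm0 cD) lb.
  rewrite (bigID (fun c' => c' \in D)) /= (bigD1 b) //= lbD // eqxx mul1r.
  rewrite big1 ?addr0 => [/eqP|c' /andP[c'D c'b]].
    by rewrite addr_eq0 => /eqP.
  by rewrite lbD // (negbTE c'b) mul0r.
have pickE b0 : (1 < m b0)%N -> exists2 m0, m = (m0 + U_(b0))%MM & msupport m0 = D /\ b0 \in D.
  move=> mb0; have le : (U_(b0) <= m)%MM by rewrite lep1mP -lt0n ltnW.
  have e : m = (m - U_(b0) + U_(b0))%MM by rewrite submK.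
  exists (m - U_(b0))%MM => //; split; last by rewrite inE -lt0n ltnW.
  apply/setP => c; rewrite !inE mnmBE mnm1E; have [<-|_] := eqVneq b0 c; last by rewrite subn0.
  by rewrite subn1 -!lt0n -ltnS prednK ?mb0 // ltnW.
have phi'_in b : b \in D -> phi' (m + U_(b))%MM =
    - \sum_(c | c \notin D) dl (D, b) c * phi (m + U_(c))%MM.
  move=> bD; rewrite /phi' msupport_in // mdegDU dm eqxx (introT eqP (esym eN)) fD /=.
  case: pickP => [b0 mb0|/(_ b)]; last first.
    move: bD; rewrite inE -lt0n mnmDE mnm1E eqxx addn1 ltnS => -> //.
  rewrite /new msupport_in // -/D.
  have [eb|nb] := eqVneq b0 b.
    rewrite eb; congr (- _); apply: eq_bigr => c _; congr (_ * phi _).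
    by rewrite addmK.
  have [m0 em [sm0 b0D]] : exists2 m0, m = (m0 + U_(b0))%MM & msupport m0 = D /\ b0 \in D.
    by apply: pickE; move: mb0; rewrite mnmDE mnm1E eq_sym (negbTE nb) addn0.
  congr (- _).
  (* The picked variable b0 may differ from b. Trading both gives a double sum in which they play
     symmetric roles, so the value does not depend on the pick. *)
  transitivity (- \sum_(c | c \notin D) \sum_(c' | c' \notin D)
      dl (D, b0) c * (dl (D, b) c' * phi (m0 + U_(c) + U_(c'))%MM)).
    rewrite -sumrN; apply: eq_bigr => c cD; rewrite -mulr_sumr -mulrN -(rel m0) //.
    congr (_ * phi _); rewrite em -[(m0 + _ + U_(b))%MM]addmA [(U_(b0) + U_(b))%MM]addmC.
    by rewrite addmA addmK -!addmA [(U_(b) + _)%MM]addmC.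
  rewrite exchange_big /= -sumrN; apply: eq_bigr => c' c'D.
  rewrite em -addmA [(U_(b0) + _)%MM]addmC addmA rel // mulrN mulr_sumr; congr (- _).
  by apply: eq_bigr => c cD; rewrite mulrCA -!addmA [(U_(c) + _)%MM]addmC.
(* Subtracting dual forms makes l vanish on the support of m, so that only larger supports
   remain. *)
pose l0 b := l b - \sum_(i | i \in D) l i * dl (D, i) b.
have lin_l0 : lin l0 by apply: lin_comb => // i iD; case: (dlP' i iD).
have l0D b : b \in D -> l0 b = 0.
  move=> bD; rewrite /l0 (bigD1 b) //= (dlP' b bD).2 // eqxx mulr1.
  rewrite big1 ?addr0 ?subrr // => i /andP[iD ib].
  by rewrite (dlP' i iD).2 // eq_sym (negbTE ib) mulr0.
transitivity (\sum_(c | c \notin D) l0 c * phi (m + U_(c))%MM).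
  rewrite (bigID (fun b => b \in D)) /= addrC.
  under [X in X + _]eq_bigr => c cD do rewrite phi'_out //.
  under [X in _ + X]eq_bigr => b bD do rewrite phi'_in // mulrN mulr_sumr.
  rewrite sumrN exchange_big /= -sumrB; apply: eq_bigr => c cD.
  by rewrite /l0 mulrBl mulr_suml; congr (_ - _); apply: eq_bigr => b _; rewrite mulrA.
(* For squarefree m the relation is the balancing condition. Otherwise, trading one copy of a
   repeated variable reduces it to relations of the previous stage. *)
have [sm|] := boolP (squarefree m).
  rewrite -[RHS](balanced fD _ lin_l0 l0D); last by rewrite -mdeg_squarefree.
  rewrite [RHS]big_mkcondr /=; apply: eq_bigr => c cD; case: ifP => fc.
    rewrite phi_sqf ?mulr1 ?msupportDU ?mdegDU //.
    apply/forallP => b; rewrite mnmDE mnm1E; have := forallP sm b.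
    by case: eqP => [<- _|_]; [move: cD; rewrite inE negbK => /eqP-> | rewrite addn0].
  by rewrite phi_face ?mulr0 // msupportDU fc.
rewrite negb_forall => /existsP[b0]; rewrite -ltnNge => mb0.
have [m0 em [sm0 b0D]] := pickE b0 mb0.
have e c : c \notin D -> l0 c * phi (m + U_(c))%MM =
    - \sum_(c' | c' \notin D) dl (D, b0) c' * (l0 c * phi (m0 + U_(c') + U_(c))%MM).
  move=> cD; rewrite {1}em -addmA [(U_(b0) + _)%MM]addmC addmA rel // mulrN mulr_sumr.
  by congr (- _); apply: eq_bigr => c' _; rewrite mulrCA -!addmA [(U_(c) + _)%MM]addmC.
rewrite (eq_bigr _ e) sumrN exchange_big /= big1 ?oppr0 // => c' c'D.
rewrite -mulr_sumr; suff -> : \sum_(c | c \notin D) l0 c * phi (m0 + U_(c') + U_(c))%MM = 0.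
  by rewrite mulr0.
rewrite -[RHS](phi_lin (m0 + U_(c'))%MM _ (big_supp m0 c' sm0 c'D) lin_l0).
rewrite [RHS](bigID (fun b => b \in D)) /= [X in _ = X + _]big1 ?add0r //.
by move=> b bD; rewrite l0D // mul0r.
Qed.

Lemma weight_functional : exists phi : 'X_{1..N} -> R,
  [/\ forall m, ~~ face (msupport m) -> phi m = 0,
      forall m, squarefree m -> face (msupport m) -> mdeg m = k -> phi m = 1
    & forall m l, lin l -> \sum_b l b * phi (m + U_(b))%MM = 0].
Proof.
have [phi [_ h1 h2 h3]] := weight_functional_step N.+1.
by exists phi; split=> // m l; apply: h3; rewrite addnS ltnS leq_addl.
Qed.

End WeightFunctional.

Section LinearExtension.
Variables (N : nat) (R : comNzRingType) (phi : 'X_{1..N} -> R).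

Definition mlinear (p : {mpoly R[N]}) : R := \sum_(m <- msupp p) p@_m * phi m.

Lemma mlinear_sum (p : {mpoly R[N]}) (t : seq 'X_{1..N}) :
  uniq t -> {subset msupp p <= t} -> mlinear p = \sum_(m <- t) p@_m * phi m.
Proof.
move=> ut sub; rewrite (bigID (mem (msupp p))) /= [X in _ + X]big1 ?addr0 => [|m /memN_msupp_eq0->].
  rewrite -big_filter /mlinear; apply: perm_big; apply: uniq_perm; rewrite ?filter_uniq // => m.
  by rewrite mem_filter; case: (boolP (m \in msupp p)) => // /sub->.
by rewrite mul0r.
Qed.

Fact mlinear_is_linear : linear_for *%R mlinear.
Proof.
move=> c p q; pose t := undup (msupp (c *: p + q) ++ (msupp p ++ msupp q)).
rewrite !(@mlinear_sum _ t) ?undup_uniq //; try by move=> m h; rewrite mem_undup !mem_cat h ?orbT.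
rewrite mulr_sumr -big_split; apply: eq_bigr => m _.
by rewrite mcoeffD mcoeffZ mulrDl mulrA.
Qed.

HB.instance Definition _ := GRing.isLinear.Build R {mpoly R[N]} R *%R mlinear mlinear_is_linear.

Lemma mlinearX m : mlinear 'X_[m] = phi m.
Proof. by rewrite /mlinear msuppX big_seq1 mcoeffX eqxx mul1r. Qed.

End LinearExtension.

(** * Unimodularity and balancing of the conormal fan *)

Section Holes.
Variables (E : finType) (R : comNzRingType).
Local Notation pair := ({set E} * {set E})%type.
Implicit Types (X : {set E}) (r s : {set E} -> nat) (u v : E -> R) (b c p q : pair).

Definition set_sum u (B : {set E}) : R := \sum_(e in B) u e.

(** The value at e_F + f_G of the linear form with coefficients u and v. *)
Definition pair_value u v b : R := set_sum u b.1 + set_sum v b.2.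

Definition flat_cover X r s b : bool :=
  [&& is_flat X r b.1, is_flat X s b.2 & b.1 :|: b.2 == X].

Definition strictly_between p q c : bool :=
  [&& pair_le p c, pair_le c q, c != p & c != q].

(** The elements that jump between p and q, from the second to the first components. *)
Definition gap X p q : {set E} := X :\: (p.1 :|: q.2).

Lemma set_sumD u (A B : {set E}) : A \subset B ->
  set_sum u B - set_sum u A = \sum_(e in B :\: A) u e.
Proof.
move=> sAB; rewrite /set_sum [X in X - _](big_setID A) /= (setIidPr sAB).
by rewrite addrAC subrr add0r.
Qed.

(** The flats covering F inside F' partition F' \ F. *)
Lemma set_sum_covers X r u (F F' : {set E}) : rank_axioms r -> is_flat X r F ->
    is_flat X r F' -> F \subset F' ->
  \sum_(B : {set E} | [&& is_flat X r B, F \subset B, B \subset F' & r B == (r F).+1])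
    (set_sum u B - set_sum u F) = set_sum u F' - set_sum u F.
Proof.
move=> rP fF fF' sFF'; rewrite set_sumD //.
transitivity (\sum_(B : {set E} | [&& is_flat X r B, F \subset B, B \subset F' & r B == (r F).+1])
    \sum_(e in F' :\: F | e \in B) u e).
  apply: eq_bigr => B /and4P[_ sFB sBF' _]; rewrite set_sumD //; apply: eq_bigl => e.
  rewrite !inE; case: (e \in F) => //=.
  by case eB: (e \in B); rewrite ?andbF // (subsetP sBF').
rewrite (exchange_big_dep (fun e => e \in F' :\: F)) /=; last by move=> B e _ /andP[].
apply: eq_bigr => e; rewrite in_setD => /andP[eF eF'].
have eX : e \in X by apply: (subsetP (flat_sub fF')).
have sX : e |: F \subset X by rewrite subUset sub1set eX (flat_sub fF).
rewrite (big_pred1 (closure X r (e |: F))) // => B /=.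
rewrite eF eF' /=; apply/andP/eqP => [[/and4P[fB sFB sBF' /eqP rB] eB]|->].
  apply: (flat_eq rP (closure_flat rP sX)); rewrite ?(flat_sub fB) //.
    by apply: closure_min; rewrite // subUset sub1set eB.
  by rewrite rB (rank_closure rP sX) (flatP rP fF).
have sc := sub_closure r sX; split; last by rewrite (subsetP sc) // setU11.
rewrite closure_flat // (subset_trans (subsetUr _ _) sc) /=; apply/andP; split.
  by apply: closure_min; rewrite // subUset sub1set eF'.
by rewrite (rank_closure rP sX) (flatP rP fF eX eF).
Qed.

Lemma sum_two (I : finType) (P : pred I) (f : I -> R) (a b : I) : a != b ->
    (forall c : I, P c -> c = a \/ c = b) ->
  \sum_(c | P c) f c = (if P a then f a else 0) + (if P b then f b else 0).
Proof.
move=> nab Pab; rewrite big_mkcond (bigD1 a) //= (bigD1 b) 1?eq_sym //=.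
rewrite big1 ?addr0 // => c /andP[ca cb]; case: ifP => // /Pab[] e.
  by rewrite e eqxx in ca.
by rewrite e eqxx in cb.
Qed.

Lemma eq_pairE (F G : {set E}) b : ((F, G) == b) = (F == b.1) && (G == b.2).
Proof. by case: b. Qed.

Lemma flat_cover_swap X r s b : flat_cover X s r (swap b) = flat_cover X r s b.
Proof. by rewrite /flat_cover /= setUC andbCA. Qed.

Lemma between_swap p q c :
  strictly_between (swap q) (swap p) (swap c) = strictly_between p q c.
Proof.
rewrite /strictly_between !(inj_eq (inv_inj (@swapK E))) /pair_le /=.
case: (q.2 \subset c.2); case: (c.1 \subset q.1); case: (c.2 \subset p.2);
by case: (p.1 \subset c.1); case: (c == q); case: (c == p).
Qed.

Lemma pair_value_swap u v b : pair_value v u (swap b) = pair_value u v b.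
Proof. exact: addrC. Qed.

Lemma gap_swap X p q : gap X (swap q) (swap p) = gap X p q.
Proof. by rewrite /gap setUC. Qed.

Lemma gap_sub2 X r s p q : flat_cover X r s p -> gap X p q \subset p.2.
Proof.
case/and3P => _ _ /eqP U; apply/subsetP => e; rewrite -U !inE negb_or.
by case/andP => /andP[/negbTE->].
Qed.

Lemma gap_sub1 X r s p q : flat_cover X r s q -> gap X p q \subset q.1.
Proof.
case/and3P => _ _ /eqP U; apply/subsetP => e; rewrite -U !inE negb_or.
by case/andP => /andP[_ /negbTE->]; rewrite orbF.
Qed.

Section Ranks.
Variables (X : {set E}) (r s : {set E} -> nat).
Hypothesis d : dual_ranks X r s.
Let rP : rank_axioms r. Proof. by case: d. Qed.
Let sP : rank_axioms s. Proof. by case: d. Qed.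

Lemma flat_cover_sub b : flat_cover X r s b -> b.1 \subset X /\ b.2 \subset X.
Proof. by case/and3P => /flat_sub h1 /flat_sub h2 _. Qed.

(** Only the first component moves, through the flats covering [p.1]; the value at each is its
    increment of u over [p.1], and the increments add up to the one of [q.1], which is 0. *)
Lemma sum_hole_fst u v p q : flat_cover X r s p -> flat_cover X r s q -> pair_le p q ->
    p.2 = q.2 -> r q.1 = (r p.1).+2 -> pair_value u v p = 0 -> pair_value u v q = 0 ->
  \sum_(c | flat_cover X r s c && strictly_between p q c) pair_value u v c = 0.
Proof.
move=> cp cq /andP[pq1 _] e2 rpq vp vq.
have [fp1 fp2 /eqP Up] := and3P cp; have [fq1 _ _] := and3P cq.
rewrite (reindex_onto (fun F => (F, p.2)) fst) /=; last first.
  move=> c /andP[_ /and4P[/andP[_ h1] /andP[_ h2] _ _]].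
  rewrite [RHS]surjective_pairing; congr (_, _); apply/eqP; rewrite eqEsubset h1 andbT.
  by rewrite e2.
have vq' : set_sum u q.1 - set_sum u p.1 = 0.
  move: vp vq; rewrite /pair_value e2 => /eqP; rewrite addr_eq0 => /eqP -> /eqP.
  by rewrite addr_eq0 => /eqP ->; rewrite subrr.
rewrite -[RHS]vq' -(set_sum_covers u rP fp1 fq1 pq1).
apply: eq_big => [F|F _]; last first.
  by move/eqP: vp; rewrite /pair_value addr_eq0 => /eqP ->; rewrite opprK.
rewrite eqxx andbT /flat_cover /strictly_between /pair_le /= fp2 -e2 !subxx !andbT /=.
have [fF|] := boolP (is_flat X r F) => //=.
have [pF|] := boolP (p.1 \subset F); last by rewrite andbF.
have [Fq|] := boolP (F \subset q.1); last by rewrite !andbF.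
have -> : F :|: p.2 == X.
  rewrite eqEsubset subUset (flat_sub fF) (flat_sub fp2) /=.
  by rewrite -{1}Up setSU.
rewrite /= !eq_pairE -e2 eqxx !andbT.
have le1 := rank_mono rP pF; have le2 := rank_mono rP Fq.
apply/andP/eqP => [[n1 n2]|rF].
  have lt1 : (r p.1 < r F)%N.
    rewrite ltnNge; apply: contra n1 => le; apply/eqP.
    by apply: (flat_eq rP fp1 pF (flat_sub fF) le).
  have lt2 : (r F < r q.1)%N.
    rewrite ltnNge; apply: contra n2 => le; apply/eqP/esym.
    by apply: (flat_eq rP fF Fq (flat_sub fq1) le).
  by nlia.
by split; apply/eqP => eF; move: rF; rewrite eF; nlia.
Qed.

(** The candidates are (q.1, p.2) and (p.1, q.2). If the gap is empty both qualify, and their values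
    add up to those of p and q. Otherwise the second does not cover X, and the first covers the
    whole gap, so it is allowed only if [o] holds, that is, if elements stay uncovered elsewhere. *)
Lemma sum_hole_diagonal u v p q (o : bool) : flat_cover X r s p -> flat_cover X r s q ->
    pair_le p q -> r q.1 = (r p.1).+1 -> s p.2 = (s q.2).+1 ->
    (gap X p q = set0 -> o) -> pair_value u v p = 0 -> pair_value u v q = 0 ->
  \sum_(c | [&& flat_cover X r s c, strictly_between p q c
             & o || ~~ (gap X p q \subset c.1 :&: c.2)]) pair_value u v c
    = if (gap X p q != set0) && o then set_sum u q.1 + set_sum v p.2 else 0.
Proof.
move=> cp cq /andP[pq1 pq2] rpq spq go vp vq.
have [fp1 fp2 /eqP Up] := and3P cp; have [fq1 fq2 /eqP Uq] := and3P cq.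
have ne1 : p.1 != q.1 by apply/eqP => e; move: rpq; rewrite e; nlia.
have ne2 : p.2 != q.2 by apply/eqP => e; move: spq; rewrite e; nlia.
rewrite (@sum_two _ _ _ (q.1, p.2) (p.1, q.2)); first last.
- move=> c /and3P[/and3P[fc1 fc2 _] /and4P[/andP[pc1 pc2] /andP[cq1 cq2] np nq] _].
  have c1 : c.1 = p.1 \/ c.1 = q.1.
    have [le|lt] := leqP (r c.1) (r p.1).
      by left; apply: (flat_eq rP fp1 pc1 (flat_sub fc1) le).
    by right; apply/esym/(flat_eq rP fc1 cq1 (flat_sub fq1)); rewrite rpq.
  have c2 : c.2 = p.2 \/ c.2 = q.2.
    have [le|lt] := leqP (s c.2) (s q.2).
      by right; apply: (flat_eq sP fq2 cq2 (flat_sub fc2) le).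
    by left; apply/esym/(flat_eq sP fc2 pc2 (flat_sub fp2)); rewrite spq.
  rewrite [c]surjective_pairing; case: c1 c2 => e1 [] e2; rewrite e1 e2; auto.
    by case/eqP: np; rewrite [c]surjective_pairing e1 e2 -surjective_pairing.
  by case/eqP: nq; rewrite [c]surjective_pairing e1 e2 -surjective_pairing.
- by rewrite xpair_eqE eq_sym (negbTE ne1).
have P1 : flat_cover X r s (q.1, p.2).
  rewrite /flat_cover /= fq1 fp2 eqEsubset subUset (flat_sub fq1) (flat_sub fp2) /=.
  by rewrite -{1}Up setSU.
have B1 : strictly_between p q (q.1, p.2).
  rewrite /strictly_between /pair_le /= pq1 pq2 !subxx /=.
  rewrite !eq_pairE /=.
  by rewrite !eqxx [q.1 == _]eq_sym (negbTE ne1) (negbTE ne2).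
have g1 : gap X p q \subset q.1 :&: p.2.
  by rewrite subsetI (gap_sub1 _ cq) (gap_sub2 _ cp).
have B2 : strictly_between p q (p.1, q.2).
  rewrite /strictly_between /pair_le /= pq1 pq2 !subxx /=.
  rewrite !eq_pairE /=.
  by rewrite !eqxx [q.2 == _]eq_sym (negbTE ne1) (negbTE ne2).
have P2 : flat_cover X r s (p.1, q.2) = (gap X p q == set0).
  rewrite /flat_cover /= fp1 fq2 eqEsubset subUset (flat_sub fp1) (flat_sub fq2) /=.
  by rewrite /gap setD_eq0.
rewrite P1 B1 g1 orbF B2 P2 /=.
case: eqP => [/go ->|_] /=.
  transitivity (pair_value u v p + pair_value u v q); last by rewrite vp vq addr0.
  by rewrite /pair_value /=; ring.
by rewrite addr0.
Qed.

(** Each flat F covering [p.1] inside [q.1] has exactly one admissible second component: [q.2] if F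
    contains the gap, since [p.2] would cover the gap, and [p.2] otherwise, since [q.2] would not
    complete F to X. *)
Lemma sum_hole3_fst u v p q : flat_cover X r s p -> flat_cover X r s q ->
    pair_le p q -> r q.1 = (r p.1).+2 -> s p.2 = (s q.2).+1 -> gap X p q != set0 ->
    set_sum u p.1 = 0 -> set_sum u q.1 = 0 -> set_sum v p.2 = 0 -> set_sum v q.2 = 0 ->
  \sum_(c | [&& flat_cover X r s c, strictly_between p q c
             & ~~ (gap X p q \subset c.1 :&: c.2)]) pair_value u v c = 0.
Proof.
move=> cp cq /andP[pq1 pq2] rpq spq g0 up uq vp vq.
have [fp1 fp2 /eqP Up] := and3P cp; have [fq1 fq2 /eqP Uq] := and3P cq.
have gp2 := gap_sub2 q cp; have gq1 := gap_sub1 p cq.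
have /set0Pn[i ig] := g0.
have iq2 : i \notin q.2 by move: ig; rewrite !inE negb_or => /andP[/andP[]].
pose f (F : {set E}) : pair := (F, if gap X p q \subset F then q.2 else p.2).
rewrite (reindex_onto f fst) /=; last first.
  move=> c /and3P[/and3P[fc1 fc2 /eqP Uc] /and4P[/andP[pc1 pc2] /andP[cq1 cq2] np nq] ng].
  rewrite /f [RHS]surjective_pairing; congr (_, _).
  case: ifP => gc.
    have [le|lt] := leqP (s c.2) (s q.2).
      by apply/esym/(flat_eq sP fq2 cq2 (flat_sub fc2) le).
    have ec2 : p.2 = c.2 by apply: (flat_eq sP fc2 pc2 (flat_sub fp2)); rewrite spq.
    by case/negP: ng; rewrite subsetI gc -ec2.
  have [le|lt] := leqP (s c.2) (s q.2); last first.
    by apply: (flat_eq sP fc2 pc2 (flat_sub fp2)); rewrite spq.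
  have ec2 : c.2 = q.2 by apply: (flat_eq sP fq2 cq2 (flat_sub fc2) le).
  case/negP: gc; apply/subsetP => e; rewrite /gap in_setD -{1}Uc in_setU ec2 in_setU.
  by rewrite negb_or => /andP[/andP[_ /negbTE->]]; rewrite orbF.
transitivity (set_sum u q.1 - set_sum u p.1); last by rewrite uq up subrr.
rewrite -(set_sum_covers u rP fp1 fq1 pq1); apply: eq_big => [F|F _]; last first.
  by rewrite /f /pair_value /= up; case: ifP => _; rewrite ?vp ?vq addr0 subr0.
rewrite eqxx andbT /f /flat_cover /strictly_between /pair_le /=.
have [fF|] := boolP (is_flat X r F) => //=.
have -> : is_flat X s (if gap X p q \subset F then q.2 else p.2) by case: ifP.
have [pF|] := boolP (p.1 \subset F); last by rewrite andbF.
have [Fq|] := boolP (F \subset q.1); last by rewrite !andbF.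
have -> : (if gap X p q \subset F then q.2 else p.2) \subset p.2 by case: ifP.
have -> : q.2 \subset (if gap X p q \subset F then q.2 else p.2) by case: ifP.
have -> : F :|: (if gap X p q \subset F then q.2 else p.2) == X.
  rewrite eqEsubset subUset (flat_sub fF) /=; case: ifP => gF.
    rewrite (flat_sub fq2); apply/subsetP => e eX; rewrite in_setU.
    have [//|eq2] := boolP (e \in q.2); first by rewrite orbT.
    have [/(subsetP pF)->//|ep1] := boolP (e \in p.1).
    by rewrite (subsetP gF) // /gap !inE negb_or ep1 eq2.
  by rewrite (flat_sub fp2) -{1}Up setSU.
have -> : gap X p q \subset F :&: (if gap X p q \subset F then q.2 else p.2) = false.
  case: ifP => gF; apply/negP; rewrite subsetI gF //=.
  by move/subsetP/(_ i ig); apply/negP.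
have le1 := rank_mono rP pF; have le2 := rank_mono rP Fq.
rewrite /= andbT; apply/andP/eqP => [[n1 n2]|rF].
  have lt1 : (r p.1 < r F)%N.
    rewrite ltnNge; apply: contra n1 => le; apply/eqP.
    have eF := flat_eq rP fp1 pF (flat_sub fF) le; rewrite eF [RHS]surjective_pairing.
    congr (_, _); case: ifP => // /subsetP/(_ i ig) ip1.
    by move: ig; rewrite !inE ip1.
  have lt2 : (r F < r q.1)%N.
    rewrite ltnNge; apply: contra n2 => le; apply/eqP.
    have eF := flat_eq rP fF Fq (flat_sub fq1) le; rewrite -eF [RHS]surjective_pairing.
    by congr (_, _); rewrite gq1.
  by nlia.
by split; apply/eqP => /(congr1 fst) /= eF; move: rF; rewrite eF; nlia.
Qed.

End Ranks.
End Holes.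

(** * Unimodularity: linear forms dual to the rays of a flag *)

Section ConormalFan.
Variables (E : finType) (R : comNzRingType).
Local Notation pair := ({set E} * {set E})%type.
Implicit Types (u v : E -> R) (b c p q : pair) (t : seq pair).

Lemma set_sum_delta e (B : {set E}) : set_sum (fun i => (i == e)%:R : R) B = (e \in B)%:R.
Proof.
rewrite /set_sum; have [eB|eB] := boolP (e \in B).
  by rewrite (bigD1 e) //= eqxx big1 ?addr0 // => i /andP[_ /negbTE->].
by rewrite big1 // => i iB; case: eqP iB eB => // ->  ->.
Qed.

Lemma set_sum0 u : set_sum u set0 = 0.
Proof. by rewrite /set_sum big_set0. Qed.

Lemma set_sumB u u' B : set_sum (fun e => u e - u' e) B = set_sum u B - set_sum u' B.
Proof. by rewrite /set_sum sumrB. Qed.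

Variables (X : {set E}) (r s : {set E} -> nat).
Hypotheses (d : dual_ranks X r s).
Hypotheses (loopless : closure X r set0 = set0) (coloopless : closure X s set0 = set0).

Let rP : rank_axioms r. Proof. by case: d. Qed.
Let sP : rank_axioms s. Proof. by case: d. Qed.

(* Both e and i separate the flag, up to the sides of the jump containing i. *)
Lemma flag_cut t i (up : pred pair) : flag X r s t -> i \in residue X r s t ->
    {in t &, forall c c', up c -> pair_le c c' -> up c'} ->
  exists u v, [/\ set_sum u X = 0, set_sum v X = 0 &
    {in t, forall c, pair_value u v c = (up c)%:R - (i \in c.1)%:R}].
Proof.
move=> ft ires upt; have [F [G [_ _ _ _ FG]]] := residue_jump d ft ires.
have iX : i \in X by move: ires; rewrite inE => /andP[].
have ic c : c \in t -> (i \in c.2) = (i \notin c.1).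
  by move=> ct; have := FG c ct; case: (i \in c.1) => /and3P[_ _ /=] => [/negbTE|].
have cfilter (P : pred pair) : allrel (@pair_cmp E) (filter P t) (filter P t).
  by apply/allrelP => b c; rewrite !mem_filter => /andP[_ bt] /andP[_ ct]; exact: flag_cmp ft bt ct.
(* The cut lies between p, the last member outside [up] or else the bottom, and q, the first member
   in [up] or else the top. *)
have [p [p_in plo]] : exists p : pair, ((p \in t) && ~~ up p || (p == (set0, X))) /\
    {in t, forall c, ~~ up c -> pair_le c p}.
  have [lo0|lo0] := eqVneq (filter (predC up) t) [::].
    exists (set0, X); rewrite eqxx orbT; split=> // c ct uc.
    have : c \in filter (predC up) t by rewrite mem_filter /= uc.
    by rewrite lo0.
  have [p + pmax] := chain_max (cfilter _) lo0; rewrite mem_filter => /andP[/= up_p pt].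
  exists p; rewrite pt up_p; split=> // c ct uc; apply: pmax.
  by rewrite mem_filter /= uc.
have [q [q_in qhi]] : exists q : pair, ((q \in t) && up q || (q == (X, set0))) /\
    {in t, forall c, up c -> pair_le q c}.
  have [hi0|hi0] := eqVneq (filter up t) [::].
    exists (X, set0); rewrite eqxx orbT; split=> // c ct uc.
    have : c \in filter up t by rewrite mem_filter /= uc.
    by rewrite hi0.
  have [q + qmin] := chain_min (cfilter _) hi0; rewrite mem_filter => /andP[/= up_q qt].
  exists q; rewrite qt up_q; split=> // c ct uc; apply: qmin.
  by rewrite mem_filter /= uc.
have tsub c : c \in t -> c.1 \subset X /\ c.2 \subset X.
  by move=> ct; apply: pair_sub (flag_pair ft ct).
have pq : pair_le p q /\ p != q.
  have Xn0 : (X == set0) = false by apply/negP => /eqP X0; rewrite X0 inE in iX.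
  case/orP: p_in q_in => [/andP[pt np]|/eqP->] /orP[/andP[qt uq]|/eqP->].
  - split; last by apply: contraTneq uq => <-.
    case/orP: (flag_cmp ft pt qt) => // qp; case/negP: np; exact: upt uq qp.
  - have [s1 s2] := tsub p pt; split; first by rewrite /pair_le s1 sub0set.
    by apply: contraTneq (flag_pair ft pt) => ->; rewrite /is_flat_pair coloopless eqxx !andbF.
  - have [s1 s2] := tsub q qt; split; first by rewrite /pair_le s2 sub0set.
    by apply: contraTneq (flag_pair ft qt) => <-; rewrite /is_flat_pair loopless eqxx !andbF.
  - by rewrite /pair_le !sub0set xpair_eqE eq_sym Xn0.
case: pq => /andP[pq1 pq2] npq.
(* As p and q differ, some e enters the first components, or leaves the second ones, exactly at the
   cut. The term at i makes the coefficients sum to 0. *)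
have [/subsetP sq1|/subsetPn[e eq ep]] := boolP (q.1 \subset p.1); last first.
  have eup c : c \in t -> (e \in c.1) = up c.
    move=> ct; case uc: (up c).
      by have /andP[/subsetP h _] := qhi c ct uc; apply: h.
    by have /andP[/subsetP h _] := plo c ct (negbT uc); apply: contraNF ep => /h.
  have eX : e \in X.
    case/orP: q_in => [/andP[qt _]|/eqP q0]; last by rewrite q0 in eq.
    exact: (subsetP (tsub q qt).1).
  exists (fun x => (x == e)%:R - (x == i)%:R), (fun=> 0); split.
  - by rewrite set_sumB !set_sum_delta eX iX subrr.
  - by rewrite /set_sum big1.
  - move=> c ct; rewrite /pair_value set_sumB !set_sum_delta eup //.
    by rewrite /set_sum [X in _ + X]big1 ?addr0.
have /subsetPn[e ep eq] : ~~ (p.2 \subset q.2).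
  apply: contra npq => sp2; rewrite (surjective_pairing p) (surjective_pairing q) xpair_eqE.
  by rewrite !eqEsubset pq1 pq2 sp2 /= andbT; apply/subsetP.
have edn c : c \in t -> (e \in c.2) = ~~ up c.
  move=> ct; case uc: (up c).
    by have /andP[_ /subsetP h] := qhi c ct uc; apply: contraNF eq => /h.
  by have /andP[_ /subsetP h] := plo c ct (negbT uc); apply: h.
have eX : e \in X.
  case/orP: p_in => [/andP[pt _]|/eqP p0]; last by rewrite p0 in ep.
  exact: (subsetP (tsub p pt).2).
exists (fun=> 0), (fun x => (x == i)%:R - (x == e)%:R); split.
- by rewrite /set_sum big1.
- by rewrite set_sumB !set_sum_delta eX iX subrr.
- move=> c ct; rewrite /pair_value set_sumB !set_sum_delta edn // ic //.
  rewrite /set_sum [X in X + _]big1 ?add0r //.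
  by case: (up c); case: (i \in c.1); rewrite /= ?subrr ?subr0 ?sub0r.
Qed.

(** The difference of the cuts just before b and just after b, with the same i, so that the terms at
    i cancel. *)
Lemma flag_unimodular t b : flag X r s t -> b \in t ->
  exists u v, [/\ set_sum u X = 0, set_sum v X = 0 &
    {in t, forall c, pair_value u v c = (c == b)%:R}].
Proof.
move=> ft bt; have /set0Pn[i ires] : residue X r s t != set0 by case/and3P: ft.
have [|u [v [u0 v0 uv]]] := flag_cut (up := fun c => pair_le b c) ft ires.
  by move=> c c' _ _; apply: pair_le_trans.
have [|u' [v' [u'0 v'0 uv']]] := flag_cut (up := fun c => pair_le b c && (c != b)) ft ires.
  move=> c c' ct c't /andP[bc cb] cc'; rewrite (pair_le_trans bc cc') /=.
  by apply: contra cb => /eqP c'b; rewrite c'b in cc'; rewrite (pair_le_anti cc' bc).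
exists (fun e => u e - u' e), (fun e => v e - v' e); split.
- by rewrite set_sumB u0 u'0 subrr.
- by rewrite set_sumB v0 v'0 subrr.
- move=> c ct; have -> : pair_value (fun e => u e - u' e) (fun e => v e - v' e) c
      = pair_value u v c - pair_value u' v' c.
    by rewrite /pair_value !set_sumB; ring.
  rewrite uv // uv' //; have [->|] := eqVneq c b; first by rewrite pair_lexx /=; ring.
  by rewrite andbT subrr.
Qed.

End ConormalFan.

(** * Balancing around a flag with one member less than a maximal one *)

Section Balancing.
Variables (E : finType) (R : comNzRingType).
Local Notation pair := ({set E} * {set E})%type.
Implicit Types (b c p q : pair).
Variables (X : {set E}) (r s : {set E} -> nat).
Hypotheses (d : dual_ranks X r s).
Hypotheses (loopless : closure X r set0 = set0) (coloopless : closure X s set0 = set0).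

Let rP : rank_axioms r. Proof. by case: d. Qed.
Let sP : rank_axioms s. Proof. by case: d. Qed.

Local Notation h := (height X r s).
Local Notation cover := (flat_cover X r s).

Lemma cover_lt b c : cover b -> cover c -> pair_le b c -> b != c -> (h b < h c)%N.
Proof.
move=> /and3P[fb1 fb2 _] /and3P[fc1 fc2 _].
exact: (height_lt d fb1 fb2 (flat_sub fc1) fc2).
Qed.

Lemma flat_pairE b : is_flat_pair X r s b = cover b && (0 < h b < #|X|)%N.
Proof.
apply/idP/andP => [pb|[/and3P[f1 f2 U] /andP[h0 hX]]].
  by rewrite (height_bounds d pb); case/and5P: pb => f1 f2 U _ _; rewrite /flat_cover f1 f2 U.
rewrite /is_flat_pair f1 f2 U loopless coloopless /=; apply/andP; split.
  by apply: contraTneq h0 => ->; rewrite /height /= (rank0 rP) subnn.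
apply: contraTneq hX => ->; rewrite /height /= (rank0 sP) subn0 (dual_total d).
by rewrite ltnn.
Qed.

Lemma sum_swap_cover u v p q :
  \sum_(c | cover c && strictly_between p q c) pair_value (R := R) u v c
  = \sum_(c | flat_cover X s r c && strictly_between (swap q) (swap p) c) pair_value v u c.
Proof.
rewrite [RHS](reindex_inj (inv_inj (@swapK E))) /=.
apply: eq_big => [c|c _]; first by rewrite flat_cover_swap between_swap.
by rewrite pair_value_swap.
Qed.

(** Either both components move by one rank, or one of them moves by two; in the latter case the gap
    is empty. *)
Lemma sum_hole2 (u v : E -> R) p q (o : bool) : cover p -> cover q -> pair_le p q ->
    h q = (h p).+2 -> (gap X p q = set0 -> o) ->
    pair_value u v p = 0 -> pair_value u v q = 0 ->
  \sum_(c | [&& cover c, strictly_between p q c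
             & o || ~~ (gap X p q \subset c.1 :&: c.2)]) pair_value u v c
    = if (gap X p q != set0) && o then set_sum u q.1 + set_sum v p.2 else 0.
Proof.
move=> cp cq pq hpq go vp vq; have /andP[pq1 pq2] := pq.
have [fp1 fp2 /eqP Up] := and3P cp; have [fq1 fq2 /eqP Uq] := and3P cq.
have le1 := rank_mono rP pq1; have le2 := rank_mono sP pq2.
have le3 := rank_mono sP (flat_sub fp2).
have [e|ne] := eqVneq (r q.1) (r p.1).+1.
  by apply: (sum_hole_diagonal d cp cq pq e _ go vp vq); move: hpq; rewrite /height; nlia.
have g0 : gap X p q = set0 -> \sum_(c | cover c && strictly_between p q c) pair_value u v c = 0 ->
    \sum_(c | [&& cover c, strictly_between p q c
             & o || ~~ (gap X p q \subset c.1 :&: c.2)]) pair_value u v c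
    = if (gap X p q != set0) && o then set_sum u q.1 + set_sum v p.2 else 0.
  move=> ge s0; rewrite ge eqxx (go ge) /= -[RHS]s0.
  by apply: eq_bigl => c; rewrite andbT.
have [e|ne'] := eqVneq (r q.1) (r p.1); last first.
  have e2 : p.2 = q.2.
    by apply: (flat_eq sP fq2 pq2 (flat_sub fp2)); move: hpq; rewrite /height; nlia.
  apply: g0; first by apply/eqP; rewrite /gap -e2 Up setDv.
  by apply: (sum_hole_fst d cp cq pq e2 _ vp vq); move: hpq; rewrite /height; nlia.
have e1 : q.1 = p.1 by apply: (flat_eq rP fp1 pq1 (flat_sub fq1)); rewrite e.
apply: g0; first by apply/eqP; rewrite /gap -e1 Uq setDv.
rewrite sum_swap_cover; apply: (sum_hole_fst (dual_ranks_sym d));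
  rewrite ?flat_cover_swap ?pair_value_swap //=.
  by rewrite /pair_le /= pq1 pq2.
by move: hpq; rewrite /height; nlia.
Qed.

(** Since the gap is nonempty both components move, by two ranks and one rank in some order; duality
    exchanges the orders. *)
Lemma sum_hole3 (u v : E -> R) p q : cover p -> cover q -> pair_le p q ->
    h q = (h p + 3)%N -> gap X p q != set0 ->
    set_sum u p.1 = 0 -> set_sum u q.1 = 0 -> set_sum v p.2 = 0 -> set_sum v q.2 = 0 ->
  \sum_(c | [&& cover c, strictly_between p q c
             & ~~ (gap X p q \subset c.1 :&: c.2)]) pair_value u v c = 0.
Proof.
move=> cp cq pq hpq g0 up uq vp vq; have /andP[pq1 pq2] := pq.
have [fp1 fp2 /eqP Up] := and3P cp; have [fq1 fq2 /eqP Uq] := and3P cq.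
have le1 := rank_mono rP pq1; have le2 := rank_mono sP pq2.
have le3 := rank_mono sP (flat_sub fp2).
have ne1 : (r p.1 < r q.1)%N.
  rewrite ltnNge; apply: contra g0 => le; rewrite /gap.
  by rewrite -(flat_eq rP fp1 pq1 (flat_sub fq1) le) Uq setDv.
have ne2 : (s q.2 < s p.2)%N.
  rewrite ltnNge; apply: contra g0 => le; rewrite /gap.
  by rewrite -(flat_eq sP fq2 pq2 (flat_sub fp2) le) Up setDv.
have [e|ne] := eqVneq (r q.1) (r p.1).+2.
  by apply: (sum_hole3_fst d); rewrite //; move: hpq; rewrite /height; nlia.
rewrite (reindex_inj (inv_inj (@swapK E))) /=.
rewrite -[RHS](@sum_hole3_fst _ _ _ _ _ (dual_ranks_sym d) v u (swap q) (swap p)) //=; first last.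
- by rewrite gap_swap.
- by move: hpq; rewrite /height; nlia.
- by move: hpq; rewrite /height; nlia.
- by rewrite /pair_le /= pq1 pq2.
- by rewrite flat_cover_swap.
- by rewrite flat_cover_swap.
apply: eq_big => [c|c _]; last by rewrite -pair_value_swap.
rewrite gap_swap -{1}(flat_cover_swap X r s) swapK -(between_swap p q) swapK.
by rewrite setIC.
Qed.

Section Chain.
Variables (t : seq pair) (u v : E -> R).
Hypotheses (ft : flag X r s t) (ut : uniq t) (st : (size t + 3 = #|X|)%N).
Hypotheses (u0 : set_sum u X = 0) (v0 : set_sum v X = 0).
Hypothesis uvt : {in t, forall c, pair_value u v c = 0}.

Let bot : pair := (set0, X).
Let top : pair := (X, set0).
Let ext : pred pair := fun b => [|| b == bot, b == top | b \in t].

Lemma ext_cover b : ext b -> cover b.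
Proof.
have f0 : is_flat X r set0 by rewrite /is_flat loopless.
have f0' : is_flat X s set0 by rewrite /is_flat coloopless.
case/or3P => [/eqP->|/eqP->|/(flag_pair ft)]; last by rewrite flat_pairE => /andP[].
  by rewrite /flat_cover /= f0 ground_flat //= set0U.
by rewrite /flat_cover /= f0' ground_flat //= setU0.
Qed.

Lemma ext_value b : ext b -> pair_value u v b = 0.
Proof.
by case/or3P => [/eqP->|/eqP->|/uvt //]; rewrite /pair_value /= set_sum0 ?u0 ?v0 addr0.
Qed.

Lemma bot_le b : b.1 \subset X -> b.2 \subset X -> pair_le bot b.
Proof. by rewrite /pair_le /= sub0set => _ ->. Qed.

Lemma top_ge b : b.1 \subset X -> b.2 \subset X -> pair_le b top.
Proof. by rewrite /pair_le /= sub0set => ->. Qed.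

Lemma ext_cmp b c : ext b -> ext c -> pair_cmp b c.
Proof.
move=> eb ec; have [b1 b2] := flat_cover_sub (ext_cover eb).
have [c1 c2] := flat_cover_sub (ext_cover ec).
case/or3P: eb => [/eqP->|/eqP->|bt].
- by rewrite /pair_cmp bot_le.
- by rewrite /pair_cmp top_ge ?orbT.
case/or3P: ec => [/eqP->|/eqP->|ct].
- by rewrite /pair_cmp bot_le ?orbT.
- by rewrite /pair_cmp top_ge.
- exact: flag_cmp ft bt ct.
Qed.

Lemma ext_le b c : ext b -> ext c -> (h b <= h c)%N -> pair_le b c.
Proof.
move=> eb ec le; have [->|ne] := eqVneq b c; first exact: pair_lexx.
case/orP: (ext_cmp eb ec) => // cb; rewrite eq_sym in ne.
by have := cover_lt (ext_cover ec) (ext_cover eb) cb ne; nlia.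
Qed.

Lemma height_bot : h bot = 0%N. Proof. by rewrite /height /= (rank0 rP) subnn. Qed.

Lemma height_top : h top = #|X|.
Proof. by rewrite /height /= (rank0 sP) subn0 (dual_total d). Qed.

Lemma height_in_t b : b \in t -> (0 < h b < #|X|)%N.
Proof. by move=> bt; exact: (height_bounds d (flag_pair ft bt)). Qed.

(** The |X| - 3 members have distinct heights among |X| - 1 values, so exactly two are missed. *)
Lemma missing_heights : exists a b : nat, [/\ (0 < a)%N, (a < b)%N, (b < #|X|)%N,
   {in t, forall c, h c != a /\ h c != b}
 & forall k, (k <= #|X|)%N -> k != a -> k != b -> exists2 p, ext p & h p = k].
Proof.
pose I := iota 1 (#|X| - 1); pose H := map h t.
have uH : uniq H.
  rewrite map_inj_in_uniq // => b c bt ct e.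
  have eb : ext b by rewrite /ext bt !orbT.
  have ec : ext c by rewrite /ext ct !orbT.
  by apply: pair_le_anti; apply: ext_le => //; rewrite e.
have HI k : k \in H -> k \in I.
  by move=> /mapP[b bt ->]; rewrite mem_iota; have := height_in_t bt; nlia.
pose M := filter (predC (mem H)) I.
have sM : size M = 2%N.
  have := count_predC (mem H) I; rewrite size_iota -!size_filter -/M.
  have -> : size (filter (mem H) I) = size t.
    rewrite -(size_map h t) -/H; apply: perm_size; apply: uniq_perm => //.
      by rewrite filter_uniq // iota_uniq.
    by move=> k; rewrite mem_filter /= andb_idr //; apply: HI.
  by nlia.
have sortM : sorted ltn M by apply: sorted_filter; [exact: ltn_trans | exact: iota_ltn_sorted].
have memM k : (k \in M) = (k \notin H) && (k \in I) by rewrite mem_filter.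
case eM: M sM sortM memM => [//|a [//|b [|//]]] _ /= /andP[ab _] memM.
have := memM a; have := memM b; rewrite !inE !eqxx orbT => /esym/andP[bH bI] /esym/andP[aH aI].
exists a, b; split=> //.
- by move: aI; rewrite mem_iota => /andP[].
- by move: bI; rewrite mem_iota; nlia.
- by move=> c ct; split; [apply: contraNneq aH => <- | apply: contraNneq bH => <-]; apply: map_f.
move=> k kX ka kb; have [->|k0] := posnP k; first by exists bot; rewrite ?height_bot // /ext eqxx.
have [->|kX'] := eqVneq k #|X|; first by exists top; rewrite ?height_top // /ext eqxx orbT.
have := memM k; rewrite !inE (negbTE ka) (negbTE kb) mem_iota => /esym/negbT.
rewrite negb_and negbK => /orP[/mapP[c ct ->]|]; first by exists c; rewrite // /ext ct !orbT.
by move/negP; case; nlia.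
Qed.

Lemma ext_eq b c : ext b -> ext c -> h b = h c -> b = c.
Proof. by move=> eb ec e; apply: pair_le_anti; apply: ext_le; rewrite // e. Qed.

Lemma step_cases p q : ext p -> ext q -> h q = (h p).+1 -> p.1 = q.1 \/ p.2 = q.2.
Proof.
move=> ep eq hpq; have /andP[pq1 pq2] : pair_le p q by apply: ext_le; rewrite // hpq.
have /and3P[fp1 fp2 _] := ext_cover ep; have /and3P[fq1 fq2 _] := ext_cover eq.
have le1 := rank_mono rP pq1; have le2 := rank_mono sP pq2.
have le3 := rank_mono sP (flat_sub fp2).
have [le|lt] := leqP (r q.1) (r p.1).
  by left; apply/esym/(flat_eq rP fp1 pq1 (flat_sub fq1) le).
right; apply: (flat_eq sP fq2 pq2 (flat_sub fp2)).
by move: hpq; rewrite /height; nlia.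
Qed.

(** A quantity unchanged by steps of height one is constant along a run of the chain without missing
    heights. *)
Lemma segment (T : Type) (f : pair -> T) (a b : nat) :
    (forall p q, ext p -> ext q -> h q = (h p).+1 -> f p = f q) ->
    (forall k, (a <= k <= b)%N -> exists2 p, ext p & h p = k) ->
  forall p q, ext p -> ext q -> h p = a -> h q = b -> (a <= b)%N -> f p = f q.
Proof.
move=> fstep; elim: b => [|b IH] full p q ep eq hp hq le.
  by rewrite (@ext_eq p q) // hp hq; nlia.
have [eab|nab] := eqVneq a b.+1; first by rewrite (@ext_eq p q) // hp hq.
have [q' eq' hq'] : exists2 q', ext q' & h q' = b by apply: full; nlia.
rewrite (IH _ p q') //; last by nlia.
- by apply: fstep; rewrite // hq hq'.
- by move=> k kab; apply: full; nlia.
Qed.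

(** Only one component moves; if it is the first, its sum is still the opposite of the sum over the
    common second component. *)
Lemma step_sum p q : ext p -> ext q -> h q = (h p).+1 -> set_sum u p.1 = set_sum u q.1.
Proof.
move=> ep eq hpq; have := ext_value ep; have := ext_value eq.
case: (step_cases ep eq hpq) => [->//|e]; rewrite /pair_value e => /eqP.
by rewrite addr_eq0 => /eqP-> /eqP; rewrite addr_eq0 => /eqP->.
Qed.

Lemma residue_out i q : i \in residue X r s t -> ext q -> i \in q.1 -> i \notin q.2.
Proof.
rewrite inE => /and4P[_ _ _ /hasPn ci] /or3P[/eqP->|/eqP->|qt].
- by rewrite inE.
- by rewrite inE.
- by have := ci q qt; rewrite in_setI negb_and => /orP[/negbTE->|].
Qed.

(** An uncovered element leaves the second component when it enters the first, so its jump moves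
    both components and takes place at a missing height. *)
Lemma step_mem i p q : i \in residue X r s t -> ext p -> ext q -> h q = (h p).+1 ->
  (i \in p.1) = (i \in q.1).
Proof.
move=> ires ep eq hpq.
have /andP[/subsetP pq1 _] : pair_le p q by apply: ext_le; rewrite // hpq.
case: (step_cases ep eq hpq) => [->//|e]; apply/idP/idP => [/pq1 //|iq].
have := residue_out ires eq iq; rewrite -e => ip2.
have iX : i \in X by move: ires; rewrite inE => /andP[].
have /and3P[_ _ /eqP U] := ext_cover ep.
by move: iX; rewrite -U inE (negbTE ip2) orbF.
Qed.

Lemma ext_height b : ext b -> (h b <= #|X|)%N.
Proof.
case/or3P => [/eqP->|/eqP->|/height_in_t]; rewrite ?height_bot ?height_top //.
by case/andP => _ /ltnW.
Qed.

Lemma gap_residue p q : ext p -> ext q ->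
  {in t, forall b, (h b <= h p)%N || (h q <= h b)%N} -> gap X p q \subset residue X r s t.
Proof.
move=> ep eq apq; apply/subsetP => i; rewrite in_setD in_setU negb_or => /andP[/andP[ip iq] iX].
rewrite inE iX loopless coloopless !in_set0 /=; apply/hasPn => b bt.
have eb : ext b by rewrite /ext bt !orbT.
rewrite in_setI; case/orP: (apq b bt) => le.
  by have /andP[/subsetP sb _] := ext_le eb ep le; rewrite (contraNF (sb i)).
by have /andP[_ /subsetP sb] := ext_le eq eb le; rewrite (contraNF (sb i)) ?andbF.
Qed.

Lemma residue_cons c : residue X r s (c :: t) = residue X r s t :\: (c.1 :&: c.2).
Proof.
apply/setP => i; rewrite in_setD ![_ \in residue _ _ _ _]inE covered_cons negb_or.
by do 2![rewrite [RHS]andbCA; congr (_ && _)]; rewrite [RHS]andbCA.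
Qed.

Lemma hole_flag p q c : ext p -> ext q ->
    {in t, forall b, (h b <= h p)%N || (h q <= h b)%N} -> (h p < h c < h q)%N ->
  (c \notin t) && flag X r s (c :: t)
    = [&& cover c, strictly_between p q c & residue X r s (c :: t) != set0].
Proof.
move=> ep eq apq /andP[hpc hcq]; apply/andP/and3P => [[ct fct]|[cc bc rc]].
  have cin : c \in c :: t by rewrite inE eqxx.
  have pc := flag_pair fct cin; have [c1 c2] := pair_sub pc.
  have cc : cover c by move: pc; rewrite flat_pairE => /andP[].
  have cmpc b : ext b -> pair_cmp b c.
    case/or3P => [/eqP->|/eqP->|bt].
    - by rewrite /pair_cmp bot_le.
    - by rewrite /pair_cmp top_ge ?orbT.
    - by apply: (flag_cmp fct); rewrite ?inE ?bt ?eqxx ?orbT.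
  split=> //; last by case/and3P: fct.
  have ncp : c != p by apply: contraTneq hpc => ->; rewrite ltnn.
  have ncq : c != q by apply: contraTneq hcq => ->; rewrite ltnn.
  rewrite /strictly_between ncp ncq !andbT; apply/andP; split.
    case/orP: (cmpc p ep) => // cp.
    by have := cover_lt cc (ext_cover ep) cp ncp; nlia.
  case/orP: (cmpc q eq) => // qc; rewrite eq_sym in ncq.
  by have := cover_lt (ext_cover eq) cc qc ncq; nlia.
case/and4P: bc => pc cq _ _.
have hq := ext_height eq.
have cmpc b : b \in t -> pair_cmp b c.
  move=> bt; have eb : ext b by rewrite /ext bt !orbT.
  case/orP: (apq b bt) => le; apply/orP; [left|right].
    exact: pair_le_trans (ext_le eb ep le) pc.
  exact: pair_le_trans cq (ext_le eq eb le).
split; first by apply/negP => /apq; nlia.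
apply/and3P; split=> //.
  apply/andP; split; last by apply/allP => b; apply: flag_pair ft.
  by rewrite flat_pairE cc; nlia.
apply/allrelP => b b'; rewrite !inE => /orP[/eqP->|bt] /orP[/eqP->|b't].
- by rewrite /pair_cmp pair_lexx.
- by rewrite pair_cmpC cmpc.
- exact: cmpc.
- exact: flag_cmp ft bt b't.
Qed.

Lemma between_height p q c : cover p -> cover q -> cover c -> strictly_between p q c ->
  (h p < h c < h q)%N.
Proof.
move=> cp cq cc /and4P[pc cq' ncp ncq].
by rewrite !cover_lt // eq_sym.
Qed.

(** A new member fills one of the two missing heights a < b. If they are adjacent there is one hole,
    between p1 and q2; otherwise there are two holes, from p1 to q1 and from p2 to q2, and the
    uncovered elements are shared between their gaps. *)
Lemma balanced_sum :
  \sum_(c | (c \notin t) && flag X r s (c :: t)) pair_value u v c = 0.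
Proof.
have [a [b [a0 ab bX tab full]]] := missing_heights.
have e_bot : ext bot by rewrite /ext eqxx.
have e_top : ext top by rewrite /ext eqxx orbT.
have [p1 ep1 hp1] : exists2 p, ext p & h p = a.-1 by apply: full; nlia.
have [q2 eq2 hq2] : exists2 p, ext p & h p = b.+1 by apply: full; nlia.
(* Below the first hole and above the last one, the sums are constant along the chain, hence equal
   to those at the bottom and at the top. *)
have up1 : set_sum u p1.1 = 0.
  rewrite -(set_sum0 u); apply/esym.
  apply: (segment (f := fun p => set_sum u p.1) step_sum _ e_bot ep1 height_bot hp1) => //.
  by move=> k kab; apply: full; nlia.
have uq2 : set_sum u q2.1 = 0.
  rewrite -[RHS]u0; apply: (segment (f := fun p => set_sum u p.1) step_sum _ eq2 e_top hq2 height_top) => //.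
  by move=> k kab; apply: full; nlia.
have vp1 : set_sum v p1.2 = 0 by have := ext_value ep1; rewrite /pair_value up1 add0r.
have vq2 : set_sum v q2.2 = 0 by have := ext_value eq2; rewrite /pair_value uq2 add0r.
have res_p1 i : i \in residue X r s t -> i \notin p1.1.
  move=> ires; suff <- : (i \in bot.1) = (i \in p1.1) by rewrite inE.
  apply: (segment (f := fun p => i \in p.1) _ _ e_bot ep1 height_bot hp1) => //.
    by move=> p q; apply: step_mem.
  by move=> k kab; apply: full; nlia.
have res_q2 i : i \in residue X r s t -> i \in q2.1.
  move=> ires; suff -> : (i \in q2.1) = (i \in top.1).
    by move: ires; rewrite inE => /andP[].
  apply: (segment (f := fun p => i \in p.1) _ _ eq2 e_top hq2 height_top) => //.
    by move=> p q; apply: step_mem.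
  by move=> k kab; apply: full; nlia.
have resX i : i \in residue X r s t -> i \in X by rewrite inE => /andP[].
have res0 : residue X r s t != set0 by case/and3P: ft.
have hc c : (c \notin t) && flag X r s (c :: t) -> h c = a \/ h c = b.
  case/andP => ct fct; have cin : c \in c :: t by rewrite inE eqxx.
  have pc := flag_pair fct cin; have := height_bounds d pc => bc.
  have [->|na] := eqVneq (h c) a; first by left.
  have [->|nb] := eqVneq (h c) b; first by right.
  have [|p ep hp] := full (h c) _ na nb; first by nlia.
  case/or3P: ep hp => [/eqP->|/eqP->|pt] hp.
  - by move: hp; rewrite height_bot; nlia.
  - by move: hp; rewrite height_top; nlia.
  have pin : p \in c :: t by rewrite inE pt orbT.
  have ncp : p != c by apply: contraNneq ct => <-.
  have pp := flag_pair fct pin.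
  case/orP: (flag_cmp fct pin cin) => le.
    by have := flat_pair_height_lt d pp pc le ncp; nlia.
  by rewrite eq_sym in ncp; have := flat_pair_height_lt d pc pp le ncp; nlia.
have [bE|bE] := eqVneq b a.+1.
  have adj : {in t, forall c, (h c <= h p1)%N || (h q2 <= h c)%N}.
    by move=> c ct; have [n1 n2] := tab c ct; rewrite hp1 hq2; nlia.
  have resE : residue X r s t = gap X p1 q2.
    apply/eqP; rewrite eqEsubset gap_residue // andbT; apply/subsetP => i ires.
    rewrite in_setD in_setU negb_or res_p1 // resX // andbT.
    by apply: residue_out; rewrite ?res_q2.
  have le12 : pair_le p1 q2 by apply: ext_le; rewrite // hp1 hq2; nlia.
  rewrite -[RHS](sum_hole3 (ext_cover ep1) (ext_cover eq2) le12 _ _ up1 uq2 vp1 vq2); last 2 first.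
  - by rewrite hp1 hq2; nlia.
  - by rewrite -resE.
  apply: eq_bigl => c; apply/idP/idP => [fc|].
    have hpc : (h p1 < h c < h q2)%N by case: (hc c fc) => ->; rewrite hp1 hq2; nlia.
    by move: fc; rewrite (hole_flag ep1 eq2 adj hpc) residue_cons resE setD_eq0.
  move=> /[dup] h3 /and3P[cc bc _].
  rewrite (hole_flag ep1 eq2 adj); last exact: between_height (ext_cover ep1) (ext_cover eq2) cc bc.
  by rewrite residue_cons resE setD_eq0.
have [q1 eq1 hq1] : exists2 p, ext p & h p = a.+1 by apply: full; nlia.
have [p2 ep2 hp2] : exists2 p, ext p & h p = b.-1 by apply: full; nlia.
have full' k : (a.+1 <= k <= b.-1)%N -> exists2 p, ext p & h p = k by move=> kab; apply: full; nlia.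
have lt12 : (a.+1 <= b.-1)%N by nlia.
have u12 : set_sum u q1.1 = set_sum u p2.1.
  exact: (segment (f := fun p => set_sum u p.1) step_sum full' eq1 ep2 hq1 hp2 lt12).
have mem12 i : i \in residue X r s t -> (i \in q1.1) = (i \in p2.1).
  move=> ires; apply: (segment (f := fun p => i \in p.1) _ full' eq1 ep2 hq1 hp2 lt12).
  by move=> p q; apply: step_mem.
have adj1 : {in t, forall c, (h c <= h p1)%N || (h q1 <= h c)%N}.
  by move=> c ct; have [n1 n2] := tab c ct; rewrite hp1 hq1; nlia.
have adj2 : {in t, forall c, (h c <= h p2)%N || (h q2 <= h c)%N}.
  by move=> c ct; have [n1 n2] := tab c ct; rewrite hp2 hq2; nlia.
have le1 : pair_le p1 q1 by apply: ext_le; rewrite // hp1 hq1; nlia.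
have le2 : pair_le p2 q2 by apply: ext_le; rewrite // hp2 hq2; nlia.
have le3 : pair_le q1 p2 by apply: ext_le; rewrite // hq1 hp2; nlia.
have resE : residue X r s t = gap X p1 q1 :|: gap X p2 q2.
  apply/eqP; rewrite eqEsubset subUset !gap_residue //= andbT; apply/subsetP => i ires.
  rewrite in_setU !in_setD !in_setU !negb_or (resX i ires) !andbT res_p1 //=.
  have nq2 : i \notin q2.2 by apply: residue_out; rewrite ?res_q2.
  rewrite nq2 andbT -mem12 //; case iq1: (i \in q1.1); last by rewrite orbT.
  by rewrite residue_out.
rewrite (bigID (fun c => h c == a)) /=.
have other1 c : strictly_between p1 q1 c -> (gap X p1 q1 :|: gap X p2 q2) :\: (c.1 :&: c.2) != set0
    = (gap X p2 q2 != set0) || ~~ (gap X p1 q1 \subset c.1 :&: c.2).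
  case/and4P => _ /andP[cq1 _] _ _; have /andP[q1p2 _] := le3.
  rewrite setDUl setU_eq0 negb_and orbC [gap X p1 q1 :\: _ == _]setD_eq0; congr (_ || _).
  rewrite (setDidPl _) // -setI_eq0; apply/eqP/setP => i; rewrite in_set0.
  apply/negP; rewrite in_setI in_setI => /and3P[+ ic _].
  rewrite /gap !inE negb_or => /andP[/andP[/negP + _] _]; apply.
  by apply: (subsetP q1p2); apply: (subsetP cq1).
have other2 c : strictly_between p2 q2 c -> (gap X p1 q1 :|: gap X p2 q2) :\: (c.1 :&: c.2) != set0
    = (gap X p1 q1 != set0) || ~~ (gap X p2 q2 \subset c.1 :&: c.2).
  case/and4P => /andP[_ cp2] _ _ _; have /andP[_ p2q1] := le3.
  rewrite setDUl setU_eq0 negb_and [gap X p2 q2 :\: _ == _]setD_eq0; congr (_ || _).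
  rewrite (setDidPl _) // -setI_eq0; apply/eqP/setP => i; rewrite in_set0.
  apply/negP; rewrite in_setI in_setI => /and3P[+ _ ic].
  rewrite /gap !inE negb_or => /andP[/andP[_ /negP +] _]; apply.
  by apply: (subsetP p2q1); apply: (subsetP cp2).
have gapn : gap X p1 q1 = set0 -> gap X p2 q2 != set0.
  by move=> g1; move: res0; rewrite resE g1 set0U.
have gapn' : gap X p2 q2 = set0 -> gap X p1 q1 != set0.
  by move=> g1; move: res0; rewrite resE g1 setU0.
have sum1 := sum_hole2 (ext_cover ep1) (ext_cover eq1) le1 _ gapn (ext_value ep1) (ext_value eq1).
have sum2 := sum_hole2 (ext_cover ep2) (ext_cover eq2) le2 _ gapn' (ext_value ep2) (ext_value eq2).
rewrite [X in X + _](_ : _ = if (gap X p1 q1 != set0) && (gap X p2 q2 != set0)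
    then set_sum u q1.1 + set_sum v p1.2 else 0); last first.
  rewrite -sum1; last by rewrite hp1 hq1; nlia.
  apply: eq_bigl => c; apply/andP/and3P => [[fc /eqP ha]|[cc bc oc]].
    have hpc : (h p1 < h c < h q1)%N by rewrite ha hp1 hq1; nlia.
    move: fc; rewrite (hole_flag ep1 eq1 adj1 hpc) => /and3P[cc bc].
    by rewrite residue_cons resE other1.
  have hpc := between_height (ext_cover ep1) (ext_cover eq1) cc bc.
  rewrite (hole_flag ep1 eq1 adj1 hpc) cc bc residue_cons resE other1 //; split=> //.
  by move: hpc; rewrite hp1 hq1; nlia.
rewrite [X in _ + X](_ : _ = if (gap X p2 q2 != set0) && (gap X p1 q1 != set0)
    then set_sum u q2.1 + set_sum v p2.2 else 0); last first.
  rewrite -sum2; last by rewrite hp2 hq2; nlia.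
  apply: eq_bigl => c; apply/andP/and3P => [[fc /eqP ha]|[cc bc oc]].
    have hb : h c = b by case: (hc c fc) => //.
    have hpc : (h p2 < h c < h q2)%N by rewrite hb hp2 hq2; nlia.
    move: fc; rewrite (hole_flag ep2 eq2 adj2 hpc) => /and3P[cc bc].
    by rewrite residue_cons resE other2.
  have hpc := between_height (ext_cover ep2) (ext_cover eq2) cc bc.
  rewrite (hole_flag ep2 eq2 adj2 hpc) cc bc residue_cons resE other2 //; split=> //.
  by move: hpc; rewrite hp2 hq2; nlia.
(* What remains is the sum of u over [q1.1] and of v over [p2.2]. The former is constant from q1 to
   p2, so the total is the value at p2, which is 0. *)
rewrite [in X in _ + X]andbC; case: ifP => _; last by rewrite addr0.
have := ext_value ep2; rewrite /pair_value -u12 vp1 uq2 addr0 add0r.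
by [].
Qed.

End Chain.
End Balancing.

(** * Matroids *)

Section MatroidRank.
Local Open Scope nat_scope.
Variables (E : finType) (M : matroid E).
Implicit Types (A B Z : {set E}) (e x : E).

Lemma rank_ge A B : B \in bases M -> #|A :&: B| <= rank M A.
Proof. by move=> bB; rewrite /rank (@leq_bigmax_cond _ (mem (bases M)) (fun B => #|A :&: B|)). Qed.

Lemma rank_witness A : exists2 B, B \in bases M & rank M A = #|A :&: B|.
Proof.
have b0 : 0 < #|mem (bases M)| by apply/card_gt0P/set0Pn/bases_neq0.
by have [B bB eB] := eq_bigmax_cond (fun B => #|A :&: B|) b0; exists B.
Qed.

(** A basis attaining the rank of Z is moved by exchanges towards one attaining the rank of A. Each
    exchange inserts an element of A, hence of Z, and removes one element, so the rank of Z is still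
    attained. *)
Lemma rank_extension A Z : A \subset Z ->
  exists B, [/\ B \in bases M, #|A :&: B| = rank M A & #|Z :&: B| = rank M Z].
Proof.
move=> sAZ; have [B2 b2 rA] := rank_witness A; have [B1 b1 rZ] := rank_witness Z.
have [n] := ubnP #|B2 :\: B1|; elim: n B1 b1 rZ => // n IH B1 b1 rZ /ltnSE le.
have [e|ne] := eqVneq #|A :&: B1| (rank M A); first by exists B1.
have lt : #|A :&: B1| < #|A :&: B2| by rewrite -rA ltn_neqAle ne rank_ge.
have /subsetPn[x] : ~~ (A :&: B2 \subset A :&: B1).
  by apply/negP => /subset_leq_card; rewrite leqNgt lt.
rewrite !inE => /andP[xA xB2]; rewrite xA /= => xB1.
have xD : x \in B2 :\: B1 by rewrite inE xB1.
have [y] := bases_coexchange b1 b2 xD; rewrite inE => /andP[yB2 yB1] bB.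
have xy : x != y by apply: contraNneq xB1 => ->.
apply: (IH _ bB).
  apply/eqP; rewrite eqn_leq rank_ge // andbT rZ.
  have -> : Z :&: ((x |: B1) :\ y) = (x |: (Z :&: B1)) :\ y.
    apply/setP => e; rewrite !inE; have [->|_] := eqVneq e x.
      by rewrite (subsetP sAZ) // !andbT.
    by rewrite andbCA.
  have := cardsD1 y (x |: (Z :&: B1)); rewrite cardsU1 !inE (negbTE xB1) andbF.
  by case: (_ || _) => /=; nlia.
apply: leq_trans le; apply: proper_card; apply/properP; split.
  apply/subsetP => e; rewrite !inE negb_and negbK negb_or => /andP[+ eB2].
  by rewrite eB2 andbT => /orP[/eqP ey|/andP[] //]; rewrite -ey eB2 in yB2.
by exists x; rewrite ?inE ?xB1 // !negb_and eqxx xy.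
Qed.

Lemma rank_rank_axioms : rank_axioms (rank M).
Proof.
split.
- by have [B _ ->] := rank_witness set0; rewrite set0I cards0.
- move=> A e; have [B bB rA] := rank_witness A; have [B' bB' rA'] := rank_witness (e |: A).
  apply/andP; split.
    rewrite rA; apply: leq_trans (rank_ge (e |: A) bB).
    by apply: subset_leq_card; apply: setSI; apply: subsetUr.
  rewrite rA'; apply: leq_trans (_ : (#|A :&: B'|).+1 <= _); last by rewrite ltnS rank_ge.
  rewrite setIUl; apply: leq_trans (leq_card_setU _ _) _; rewrite -add1n leq_add2r.
  by apply: leq_trans (subset_leq_card (subsetIl _ _)) _; rewrite cards1.
- move=> A Z e sAZ rA.
  have [eA|eA] := boolP (e \in A).
    by rewrite (setUidPr _) // sub1set (subsetP sAZ).
  (* A basis attaining the ranks of A and of Z with e omits e, or else e would raise the rank of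
     A. *)
  have [B [bB rA1 rZ]] := rank_extension (subset_trans sAZ (subsetUr [set e] Z)).
  have eB : e \notin B.
    apply/negP => eB; have := rank_ge (e |: A) bB; rewrite rA -rA1 setIUl.
    have -> : [set e] :&: B = [set e] by apply/setIidPl; rewrite sub1set.
    by rewrite cardsU1 inE (negbTE eA) add1n ltnn.
  have := rank_ge Z bB; rewrite -rZ setIUl.
  have -> : [set e] :&: B = set0.
    by apply/setP => x; rewrite !inE; case: eqP => [->|//]; rewrite (negbTE eB).
  rewrite set0U => h1; apply/eqP; rewrite eqn_leq.
  have [B' bB' rZ'] := rank_witness Z.
  have h2 : rank M Z <= rank M (e |: Z).
    rewrite rZ'; apply: leq_trans (rank_ge (e |: Z) bB').
    by apply: subset_leq_card; apply: setSI; apply: subsetUr.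
  have h3 := rank_ge Z bB; rewrite -rZ setIUl in h2 *.
  have s0 : [set e] :&: B = set0.
    by apply/setP => x; rewrite !inE; case: eqP => [->|//]; rewrite (negbTE eB).
  by rewrite s0 set0U in h2 *; rewrite h3 h2.
Qed.

Lemma rank_basis B : B \in bases M -> rank M setT = #|B|.
Proof.
move=> bB; have [B' bB' ->] := rank_witness setT.
by rewrite setTI (card_bases bB' bB).
Qed.

End MatroidRank.

Section MatroidDual.
Local Open Scope nat_scope.
Variables (E : finType) (M : matroid E).
Implicit Types (A B F : {set E}) (e x : E).

(** The identity [key] holds for each basis B, and both sides are maximized over the bases. *)
Lemma rank_dual_ranks : dual_ranks setT (rank M) (rank (dual_matroid M)).
Proof.
split; [exact: rank_rank_axioms | exact: rank_rank_axioms | move=> A _].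
have key B : B \in bases M -> #|A :&: ~: B| + rank M setT = #|A| + #|(setT :\: A) :&: B|.
  move=> bB; rewrite (rank_basis bB) -(cardsID A B) -(cardsID B A) setTD -setDE.
  by rewrite [B :&: A]setIC [~: A :&: B]setIC -setDE; nlia.
apply/eqP; rewrite eqn_leq; apply/andP; split.
  have [B] := rank_witness (dual_matroid M) A; rewrite mem_dual_bases => bB ->.
  by rewrite -{1}[B]setCK key // leq_add2l rank_ge.
have [B bB ->] := rank_witness M (setT :\: A).
rewrite -key // leq_add2r; apply: rank_ge; by rewrite mem_dual_bases setCK.
Qed.

Lemma mem_flats F : (F \in flats M) = is_flat setT (rank M) F.
Proof.
have rP := rank_rank_axioms M; rewrite inE; apply/forall_inP/idP => [h|fF x xF].
  rewrite /is_flat eqEsubset sub_closure ?subsetT // andbT; apply/subsetP => e.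
  rewrite inE => /andP[_ /eqP re]; apply/negPn/negP => eF.
  by have := h e eF; rewrite re ltnn.
by rewrite (flatP rP fF (in_setT x) xF).
Qed.

Lemma loopless_closure : loopless M -> closure setT (rank M) set0 = set0.
Proof.
move=> /forallP ll; have rP := rank_rank_axioms M; apply/setP => e; rewrite mem_loops ?inE //.
have := ll e; rewrite negb_forall => /existsP[B]; rewrite negb_imply negbK => /andP[bB eB].
apply/negP => /eqP re; have := rank_ge [set e] bB; rewrite re leqn0 cards_eq0 => /eqP s0.
have : e \in [set e] :&: B by rewrite !inE eqxx eB.
by rewrite s0 inE.
Qed.

End MatroidDual.

(** * Moebius function of the lattice of flats and Whitney's expansion *)

Section MobiusClosure.
Variables (E : finType) (M : matroid E).
Hypothesis ll : loopless M.
Local Notation r := (rank M).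
Local Notation cl := (closure setT r).
Local Open Scope ring_scope.

(** The right-hand side satisfies the recurrence of the Moebius function: summed over the flats
    inside a nonempty F, it counts all subsets of F with signs, which gives 0. *)
Lemma mobius_flat F : F \in flats M ->
  mobius (flats M) set0 F = \sum_(A : {set E} | cl A == F) (-1) ^+ #|A|.
Proof.
have rP := rank_rank_axioms M.
have cl0 : cl set0 = set0 := loopless_closure ll.
have [m] := ubnP #|F|; elim: m F => // m IH F /ltnSE le fF.
rewrite mobiusE; case: eqP => [<-|F0].
  rewrite (big_pred1 set0) ?cards0 // => A; apply/eqP/eqP => [clA|->//].
  by apply/eqP; rewrite -subset0 -clA sub_closure ?subsetT.
have -> : \sum_(C in flats M | (set0 \subset C) && (C \proper F)) mobius (flats M) set0 C
    = \sum_(C in flats M | C \proper F) \sum_(A : {set E} | cl A == C) (-1) ^+ #|A|.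
  apply: eq_big => [C|C /and3P[fC _ CF]]; first by rewrite sub0set.
  by rewrite IH //; apply: leq_trans le; apply: proper_card.
have /set0Pn[e eF] : F != set0 by rewrite eq_sym; apply/eqP.
have zero : \sum_(A : {set E} | A \subset F) (-1) ^+ #|A| = 0 :> int.
  rewrite (sum_subsets_split _ eF) big1 // => A; rewrite subsetD1 => /andP[_ eA].
  by rewrite cardsU1_notin // subrr.
have fF' : is_flat setT r F by rewrite -mem_flats.
apply/eqP; rewrite eq_sym -subr_eq0 opprK -[X in _ == X]zero eq_sym; apply/eqP.
rewrite (bigID (fun A : {set E} => cl A == F)) /=; congr (_ + _).
  apply: eq_bigl => A; apply: andb_idl => /eqP <-; by rewrite sub_closure ?subsetT.
rewrite (partition_big cl (fun C => (C \in flats M) && (C \proper F))) /=; last first.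
  move=> A /andP[sAF nA]; rewrite mem_flats closure_flat ?subsetT //= properEneq nA /=.
  exact: closure_min.
apply: eq_bigr => C /andP[fC /properP[sCF [x xF xC]]]; apply: eq_bigl => A.
apply/andP/idP => [[]//|/eqP clA]; split; last by rewrite clA.
rewrite clA; apply/andP; split.
  by apply: subset_trans sCF; rewrite -clA sub_closure ?subsetT.
by apply: contraNneq xC => ->.
Qed.

Variable R : realType.

(** Grouping subsets by their closure turns the sum over flats into a sum over all subsets. *)
Lemma charpoly_shift :
  matroid_charpoly R M \Po ('X + 1) = map_poly intr (shifted_charpoly setT r).
Proof.
have rP := rank_rank_axioms M.
have -> : matroid_charpoly R M =
    \sum_(A : {set E}) ((-1) ^+ #|A|) *: 'X^(r setT - r A).
  rewrite /matroid_charpoly [RHS](partition_big cl (fun F => F \in flats M)) /=; last first.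
    by move=> A _; rewrite mem_flats closure_flat ?subsetT.
  apply: eq_bigr => F fF; rewrite mobius_flat // rmorph_sum /= scaler_suml.
  apply: eq_bigr => A /eqP <-; rewrite rmorphXn rmorphN1.
  by rewrite /corank (rank_closure rP) ?subsetT.
rewrite /shifted_charpoly [LHS]rmorph_sum [RHS]rmorph_sum /=.
apply: eq_big => [A|A _]; first by rewrite subsetT.
rewrite comp_polyZ map_polyZ /= [in RHS]rmorphXn rmorphN1; congr (_ *: _).
by rewrite [LHS]rmorphXn [RHS]rmorphXn /= comp_polyX rmorphD /= map_polyX rmorph1.
Qed.

End MobiusClosure.

(** * The Chow ring *)

Section ChowModel.
Variables (R : realType) (E : finType) (M : matroid E).
Hypotheses (ll : loopless M) (cl : coloopless M).
Local Notation pair := ({set E} * {set E})%type.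
Local Notation N := #|{: biflat M}|.
Local Notation A := {mpoly R[N]}.
Local Notation r := (rank M).
Local Notation s := (rank (dual_matroid M)).
Local Notation T := [set: E].
Implicit Types (b c : biflat M) (p q : pair) (t : seq pair) (D : {set biflat M}).

Let d : dual_ranks T r s := rank_dual_ranks M.
Let loops0 : closure T r set0 = set0 := loopless_closure ll.
Let coloops0 : closure T s set0 = set0 := loopless_closure cl.

(** An empty component forces the other one to be E, so nonemptiness amounts to excluding the bottom
    and the top. *)
Lemma biflat_pair p : is_biflat M p = is_flat_pair T r s p && (p != (T, T)).
Proof.
case: p => F G; rewrite /is_biflat /is_flat_pair /= !mem_flats loops0 coloops0 !xpair_eqE.
case: (is_flat T r F) => //=; case: (is_flat T s G) => //=; rewrite ?andbF //=.
have [eU|] := eqVneq (F :|: G) T; rewrite ?andbF //= andbT.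
have [F0|F0] := eqVneq F set0 => /=.
  by have -> : G == T by rewrite -eU F0 set0U.
have [G0|G0] := eqVneq G set0 => //=; rewrite ?andbT ?andbF //.
by have -> : F == T by rewrite -eU G0 setU0.
Qed.

Lemma flag_biflat t p : flag T r s t -> p \in t -> is_biflat M p.
Proof.
move=> ft pt; rewrite biflat_pair (flag_pair ft pt) /=.
apply: contraTneq pt => ->; apply/negP => tt.
have /set0Pn[e] : residue T r s t != set0 by case/and3P: ft.
by rewrite inE => /and4P[_ _ _ /hasPn/(_ _ tt)]; rewrite !inE.
Qed.

Lemma flag_is_flag (D : {set biflat M}) : (0 < #|E|)%N ->
  is_flag D = flag T r s (map val (enum D)).
Proof.
move=> E0; rewrite /flag; have -> : all (is_flat_pair T r s) (map val (enum D)).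
  by apply/allP => _ /mapP[b _ ->]; have := valP b; rewrite biflat_pair => /andP[].
rewrite /is_flag /=; congr (_ && _).
  apply/forall_inP/allrelP => [h _ _ /mapP[b bD ->] /mapP[c cD ->]|h b bD].
    by rewrite !mem_enum in bD cD; have /forall_inP/(_ c cD) := h b bD.
  by apply/forall_inP => c cD; apply: (h (val b) (val c)); rewrite map_f // mem_enum.
have covE e : (e \in \bigcup_(b in D) (bF b :&: bG b)) = covered (map val (enum D)) e.
  apply/bigcupP/hasP => [[b bD eb]|[_ /mapP[b bD ->] eb]].
    by exists (val b) => //; rewrite map_f // mem_enum.
  by exists b; rewrite -?(mem_enum (mem D)).
apply/idP/set0Pn => [nT|[e]].
  have /subsetPn[e _ eU] : ~~ (T \subset \bigcup_(b in D) (bF b :&: bG b)).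
    by apply: contra nT => sT; rewrite eqEsubset subsetT.
  by exists e; rewrite inE -covE eU loops0 coloops0 !inE.
rewrite inE => /and4P[_ _ _]; rewrite -covE; apply: contraNneq => ->.
by rewrite inE.
Qed.

(** Pairs that are not biflats, among them (T, T), get the value 0. *)
Definition pair_var p : A := if insub p is Some b then ray_var R b else 0.

Lemma pair_var_val b : pair_var (val b) = ray_var R b.
Proof. by rewrite /pair_var valK. Qed.

Lemma sum_pair_var (P : pred pair) :
  \sum_(p | P p) pair_var p = \sum_(b : biflat M | P (val b)) ray_var R b.
Proof.
rewrite (bigID (is_biflat M)) /= [X in _ + X]big1 ?addr0 => [|p /andP[_ np]]; last first.
  by rewrite /pair_var insubN.
rewrite (reindex_omap (val : biflat M -> pair) (insub : pair -> option (biflat M))) /=; last first.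
  by move=> p /andP[_ pb]; rewrite insubT.
apply: eq_big => [b|b _]; last exact: pair_var_val.
by rewrite (valP b) valK eqxx !andbT.
Qed.

Lemma chow_class_ideal (z : A) : z \in @chow_ideal R E M -> chow_class z = 0.
Proof.
move=> pI; rewrite /chow_class; apply/eqP.
rewrite -(rmorph0 (@chow_class R E M)) /chow_class -Quotient.idealrBE subr0.
exact: pI.
Qed.

Lemma chow_class_eq0 (z : A) : chow_class z = 0 -> z \in @chow_ideal R E M.
Proof.
rewrite -(rmorph0 (@chow_class R E M)) /chow_class => /eqP.
by rewrite -Quotient.idealrBE subr0.
Qed.

Definition coord_fst (i j : E) (p : ambient R E) : R^o := p.1 i - p.1 j.

Definition coord_snd (i j : E) (p : ambient R E) : R^o := p.2 i - p.2 j.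

Lemma coord_fst_linear i j : linear (coord_fst i j).
Proof.
by move=> c [z w] [z' w']; rewrite /coord_fst /= !ffunE /= scalerBr opprD addrACA.
Qed.

Lemma coord_snd_linear i j : linear (coord_snd i j).
Proof.
by move=> c [z w] [z' w']; rewrite /coord_snd /= !ffunE /= scalerBr opprD addrACA.
Qed.

HB.instance Definition _ i j :=
  GRing.isLinear.Build R (ambient R E) R^o *%R (coord_fst i j) (coord_fst_linear i j).
HB.instance Definition _ i j :=
  GRing.isLinear.Build R (ambient R E) R^o *%R (coord_snd i j) (coord_snd_linear i j).

Lemma linear_class (l : {linear ambient R E -> R^o}) : descends l ->
  chow_class (pl_poly M l) = 0.
Proof.
move=> ldesc; apply/chow_class_ideal/asboolP; exists [:: (1, pl_poly M l)].
  by move=> u; rewrite inE => /eqP-> /=; right; exists l.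
by rewrite big_seq1 mul1r.
Qed.

Lemma chow_class_fst i j : chow_class (pl_poly M (coord_fst i j)) = 0.
Proof. by apply: linear_class; split; rewrite /= /coord_fst /= !ffunE ?inE subrr. Qed.

Lemma chow_class_snd i j : chow_class (pl_poly M (coord_snd i j)) = 0.
Proof. by apply: linear_class; split; rewrite /= /coord_snd /= !ffunE ?inE subrr. Qed.

Lemma pl_poly_homog (l : ambient R E -> R) : pl_poly M l \is 1.-homog.
Proof. by apply: rpred_sum => b _; apply/rpredZ; rewrite dhomogX /= mdeg1. Qed.

Lemma pair_var_homog p : pair_var p \is 1.-homog.
Proof.
rewrite /pair_var; case: insub => [b|]; last exact: dhomog0.
by rewrite dhomogX /= mdeg1.
Qed.

Lemma sum_ray_var (P : pred (biflat M)) :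
  \sum_(b | P b) ray_var R b = \sum_b (P b)%:R *: ray_var R b.
Proof. by rewrite big_mkcond; apply: eq_bigr => b _; case: (P b); rewrite ?scale1r ?scale0r. Qed.

Lemma pl_poly_fst i j : pl_poly M (coord_fst i j) =
  \sum_(b : biflat M | i \in (val b).1) ray_var R b -
  \sum_(b : biflat M | j \in (val b).1) ray_var R b.
Proof.
rewrite !sum_ray_var -sumrB; apply: eq_bigr => b _; rewrite -scalerBl; congr (_ *: _).
by rewrite /coord_fst /= !ffunE.
Qed.

Lemma pl_poly_snd i j : pl_poly M (coord_snd i j) =
  \sum_(b : biflat M | i \in (val b).2) ray_var R b -
  \sum_(b : biflat M | j \in (val b).2) ray_var R b.
Proof.
rewrite !sum_ray_var -sumrB; apply: eq_bigr => b _; rewrite -scalerBl; congr (_ *: _).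
by rewrite /coord_snd /= !ffunE.
Qed.

(** On the ray of F|G the maximum is 1 exactly when j is in F and some element is not. *)
Lemma gamma_class j : gamma R M j = chow_class (gamma_elt T pair_var j).
Proof.
rewrite /gamma /gamma_elt sum_pair_var sum_ray_var; congr chow_class.
apply: eq_bigr => b _; congr (_ *: _); rewrite /gamma_pl /= -/(bF b).
under eq_bigr do rewrite !ffunE.
have [jF|jF] := boolP (j \in bF b) => /=; last first.
  by elim/big_rec: _ => // e x _ ->; rewrite sub0r max_r // oppr_le0 ler0n.
have [FT|] := eqVneq (bF b) T.
  by elim/big_rec: _ => // e x _ ->; rewrite FT !inE subrr maxxx.
rewrite -properT => /properP[_ [e _ eF]].
apply/eqP; rewrite eq_le; apply/andP; split.
  apply: bigmax_le => [|k _]; rewrite ?ler01 // lerBlDr lerDl ler0n //.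
by apply: (bigmax_sup e) => //; rewrite (negbTE eF) subr0.
Qed.

(** On the ray of F|G the sum of the two coordinates at k is 1, plus 1 if k is in F ∩ G. Since F ∩ G
    is not E, the least such sum is 1. *)
Lemma delta_class j : delta R M j = chow_class (delta_elt pair_var j).
Proof.
rewrite /delta /delta_elt sum_pair_var sum_ray_var; congr chow_class.
apply: eq_bigr => b _; congr (_ *: _); rewrite /delta_pl /=.
under eq_bigr do rewrite !ffunE.
have /and5P[_ _ _ _ /andP[nT /eqP FG]] := valP b.
have oneU k : (k \in bF b) || (k \in bG b) by rewrite -in_setU /bF /bG FG inE.
have [e eFG] : exists e, ~~ ((e \in bF b) && (e \in bG b)).
  apply/existsP; rewrite -negb_forall; apply: contra nT => /forallP h.
  by apply/andP; split; apply/eqP/setP => k; have /andP[kF kG] := h k; rewrite inE.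
rewrite inE -/(bF b) -/(bG b).
have val1 k : (k \in bF b)%:R + (k \in bG b)%:R = 1 + ((k \in bF b) && (k \in bG b))%:R :> R.
  by have := oneU k; case: (k \in bF b); case: (k \in bG b); rewrite //= ?addr0 ?add0r.
under eq_bigr => k _ do rewrite -addrA -opprD !val1 opprD addrACA subrr add0r.
apply/eqP; rewrite eq_le; apply/andP; split.
  by apply: bigmax_le => [|k _]; rewrite ?ler0n // lerBlDr lerDl ler0n.
by apply: (bigmax_sup e) => //; rewrite (negbTE eFG) subr0.
Qed.

Lemma chow_class_scale (c : R) (z : A) : c *: chow_class z = chow_class (c *: z).
Proof. by rewrite -mul_mpolyC rmorphM. Qed.

(** Used for homogeneous generators g of the Chow ideal: taking a homogeneous component keeps
    multiples of g. *)
Lemma pihomog_mul k e (a g : A) : g \is e.-homog ->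
  exists a', pihomog mdeg k (a * g) = a' * g.
Proof.
move=> hg; exists (\sum_(m <- msupp a | (mdeg m + e == k)%N) a@_m *: 'X_[m]).
rewrite {1}(mpolyE a) mulr_suml linear_sum /= [in RHS]big_mkcond mulr_suml /=.
apply: eq_bigr => m _; rewrite -scalerAl linearZ /=.
have hm : 'X_[m] * g \is (mdeg m + e).-homog by apply: dhomogM; rewrite ?dhomogX.
case: eqP => [e1|/eqP ne]; last by rewrite (pihomog_ne0 ne hm) scaler0 mul0r.
by rewrite -e1 (pihomog_dE hm) scalerAl.
Qed.

Lemma mlinear_mul0 phi (g : A) : (forall m, mlinear phi ('X_[m] * g) = 0) ->
  forall q : A, mlinear phi (q * g) = 0.
Proof.
move=> h q; rewrite (mpolyE q) mulr_suml raddf_sum big1 //= => m _.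
by rewrite -scalerAl linearZ /= h mulr0.
Qed.

Definition cone_mnm D : 'X_{1..N} := (\sum_(b in D) U_(enum_rank b))%MM.

Lemma cone_monomialE D : cone_monomial R D = 'X_[cone_mnm D].
Proof. exact/esym/(big_morph _ (@mpolyXD _ _) (@mpolyX0 _ _)). Qed.

Lemma cone_mnmE D b : cone_mnm D (enum_rank b) = (b \in D).
Proof.
rewrite /cone_mnm mnm_sumE; have [bD|bD] := boolP (b \in D).
  rewrite (bigD1 b) //= mnm1E eqxx big1 // => c /andP[_ cb].
  by rewrite mnm1E (inj_eq enum_rank_inj) (negbTE cb).
rewrite big1 // => c cD; rewrite mnm1E (inj_eq enum_rank_inj).
by case: eqP cD bD => // -> ->.
Qed.

Lemma mdeg_cone_mnm D : mdeg (cone_mnm D) = #|D|.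
Proof. by rewrite mdeg_sum (eq_bigr (fun=> 1%N)) ?sum1_card // => b _; rewrite mdeg1. Qed.

Lemma flag_eq_mem t t' : t =i t' -> flag T r s t = flag T r s t'.
Proof. by move=> e; apply/idP/idP; apply: flag_sub => p; rewrite e. Qed.

End ChowModel.

(** * Existence of the degree map and its model *)

Section DegreeExists.
Variables (R : realType) (E : finType) (M : matroid E).
Hypotheses (ll : loopless M) (cl : coloopless M) (E0 : (0 < #|E|)%N).
Local Notation pair := ({set E} * {set E})%type.
Local Notation N := #|{: biflat M}|.
Local Notation A := {mpoly R[N]}.
Local Notation r := (rank M).
Local Notation s := (rank (dual_matroid M)).
Local Notation T := [set: E].
Implicit Types (b c : biflat M) (p q : pair) (t : seq pair).

Let d : dual_ranks T r s := rank_dual_ranks M.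
Let loops0 : closure T r set0 = set0 := loopless_closure ll.
Let coloops0 : closure T s set0 = set0 := loopless_closure cl.

Definition biflats_of (D : {set 'I_N}) : {set biflat M} := [set b | enum_rank b \in D].

Definition face (D : {set 'I_N}) : bool := is_flag (biflats_of D).

(** Values on the rays of the linear functions on N_{E,E}: the coefficients on each side sum to
    0. *)
Definition linear_weights (l : 'I_N -> R) : Prop :=
  exists u v, [/\ set_sum u T = 0, set_sum v T = 0
    & forall b, l (enum_rank b) = pair_value u v (val b)].

Definition pairs_of (D : {set 'I_N}) : seq pair := map val (enum (biflats_of D)).

Lemma faceE D : face D = flag T r s (pairs_of D).
Proof. exact: flag_is_flag. Qed.

Lemma mem_pairs_of D b : (val b \in pairs_of D) = (enum_rank b \in D).
Proof. by rewrite mem_map ?mem_enum ?inE //; apply: val_inj. Qed.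

Lemma pairs_of_biflat D p : p \in pairs_of D -> exists2 b, p = val b & enum_rank b \in D.
Proof. by case/mapP => b; rewrite mem_enum inE => bD ->; exists b. Qed.

Lemma uniq_pairs_of D : uniq (pairs_of D).
Proof. by rewrite map_inj_uniq ?enum_uniq //; apply: val_inj. Qed.

Lemma size_pairs_of D : size (pairs_of D) = #|D|.
Proof.
rewrite size_map -cardE -(card_imset _ (@enum_rank_inj _)); apply: eq_card => i.
apply/imsetP/idP => [[b]|iD]; first by rewrite inE => bD ->.
by exists (enum_val i); rewrite ?inE enum_valK.
Qed.

Lemma pairs_ofU i D : val (enum_val i : biflat M) :: pairs_of D =i pairs_of (i |: D).
Proof.
move=> p; rewrite inE; apply/orP/idP => [[/eqP->|/pairs_of_biflat[b -> bD]]|].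
- by rewrite mem_pairs_of enum_valK setU11.
- by rewrite mem_pairs_of inE bD orbT.
case/pairs_of_biflat => b ->; rewrite in_setU1 => /orP[/eqP<-|bD].
  by left; rewrite enum_rankK.
by right; rewrite mem_pairs_of.
Qed.

Lemma pair_value_sum (I : finType) (P : pred I) (f : I -> R) (u v : E -> R)
    (w : I -> (E -> R) * (E -> R)) p :
  pair_value (fun e => u e - \sum_(i | P i) f i * (w i).1 e)
             (fun e => v e - \sum_(i | P i) f i * (w i).2 e) p
  = pair_value u v p - \sum_(i | P i) f i * pair_value (w i).1 (w i).2 p.
Proof.
have sum1 z (B : {set E}) (g : I -> E -> R) :
    set_sum (fun e => z e - \sum_(i | P i) f i * g i e) B
      = set_sum z B - \sum_(i | P i) f i * set_sum (g i) B.
  rewrite /set_sum sumrB exchange_big /=; congr (_ - _).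
  by apply: eq_bigr => i _; rewrite mulr_sumr.
rewrite /pair_value !sum1 addrACA -opprD -big_split /=; congr (_ - _).
by apply: eq_bigr => i _; rewrite mulrDr.
Qed.

(** [flag_unimodular] gives the dual forms and [balanced_sum] the balancing condition, carried over
    from sequences of pairs to sets of indices. *)
Lemma conormal_functional : exists phi : 'X_{1..N} -> R,
  [/\ forall m, ~~ face (msupport m) -> phi m = 0,
      forall m, squarefree m -> face (msupport m) -> mdeg m = #|E|.-2 -> phi m = 1
    & forall m l, linear_weights l -> \sum_b l b * phi (m + U_(b))%MM = 0].
Proof.
apply: weight_functional.
- move=> D D' sD; rewrite !faceE; apply: flag_sub => p /pairs_of_biflat[b -> bD].
  by rewrite mem_pairs_of (subsetP sD).
- move=> l I P f g [u [v [u0 v0 luv]]] lin_g.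
  have /choice[w wP] : forall i, exists uv : (E -> R) * (E -> R), P i ->
      [/\ set_sum uv.1 T = 0, set_sum uv.2 T = 0
        & forall b, g i (enum_rank b) = pair_value uv.1 uv.2 (val b)].
    move=> i; have [Pi|] := boolP (P i); last by exists (fun=> 0, fun=> 0).
    by have [u' [v' h]] := lin_g i Pi; exists (u', v').
  exists (fun e => u e - \sum_(i | P i) f i * (w i).1 e),
         (fun e => v e - \sum_(i | P i) f i * (w i).2 e); split.
  + have := pair_value_sum P f u v w (T, set0).
    rewrite /pair_value /= !set_sum0 !addr0 => ->; rewrite u0 sub0r big1 ?oppr0 // => i Pi.
    by have [h _ _] := wP i Pi; rewrite h set_sum0 addr0 mulr0.
  + have := pair_value_sum P f u v w (set0, T).
    rewrite /pair_value /= !set_sum0 !add0r => ->; rewrite v0 sub0r big1 ?oppr0 // => i Pi.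
    by have [_ h _] := wP i Pi; rewrite h set_sum0 addr0 mulr0.
  + move=> b; rewrite pair_value_sum luv; congr (_ - _); apply: eq_bigr => i Pi.
    by have [_ _ ->] := wP i Pi.
- move=> D i; rewrite faceE => fD iD.
  have bt : val (enum_val i : biflat M) \in pairs_of D by rewrite mem_pairs_of enum_valK.
  have [u [v [u0 v0 uv]]] := @flag_unimodular E R T r s d loops0 coloops0 _ _ fD bt.
  exists (fun c : 'I_N => pair_value u v (val (enum_val c : biflat M))).
    by exists u, v; split=> // b; rewrite enum_rankK.
  move=> c cD; rewrite uv; last by rewrite mem_pairs_of enum_valK.
  by rewrite (inj_eq val_inj) (inj_eq enum_val_inj).
move=> D l; rewrite faceE => fD sD [u [v [u0 v0 luv]]] lD.
have uvt : {in pairs_of D, forall c : pair, pair_value u v c = 0}.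
  by move=> _ /pairs_of_biflat[b -> bD]; rewrite -luv lD.
have st : (size (pairs_of D) + 3 = #|T|)%N by rewrite size_pairs_of cardsT; nlia.
rewrite -[RHS](balanced_sum d loops0 coloops0 fD (uniq_pairs_of D) st u0 v0 uvt).
rewrite [RHS](reindex_omap (val : biflat M -> pair) (insub : pair -> option (biflat M))) /=; last first.
  move=> p /andP[_ fp]; rewrite insubT //.
  by apply: (flag_biflat ll cl fp); rewrite inE eqxx.
rewrite [LHS](reindex (@enum_rank (biflat M))) /=; last first.
  by apply: onW_bij; exists enum_val; [exact: enum_rankK | exact: enum_valK].
apply: eq_big => [b|b _]; last exact: luv.
rewrite valK eqxx andbT mem_pairs_of faceE; congr (_ && _).
rewrite -[in RHS](enum_rankK b); apply/esym/flag_eq_mem => p.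
by rewrite pairs_ofU.
Qed.

Lemma cone_mnm_support (D : {set biflat M}) : biflats_of (msupport (cone_mnm D)) = D.
Proof. by apply/setP => b; rewrite !inE cone_mnmE eqb0 negbK. Qed.

(** The linear extension of the functional on monomials vanishes on the Chow ideal, so it can be
    evaluated on representatives. *)
Lemma cap_exists : exists phi : chow R M -> R, is_cap #|E|.-2 (fun=> 1) phi.
Proof.
have [phi [phi_face phi_sqf phi_lin]] := conormal_functional.
have kill (z : A) : z \in @chow_ideal R E M -> mlinear phi z = 0.
  move=> /asboolP[w gen ->]; rewrite raddf_sum /= big_seq big1 // => -[q g] /gen /= gg.
  apply: mlinear_mul0 => m; case: gg => [[D /andP[_ nD] ->]|[l ldesc ->]].
    rewrite cone_monomialE -mpolyXD mlinearX phi_face //.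
    apply: contra nD; rewrite /face !flag_is_flag //; apply: flag_sub => p.
    case/mapP => b; rewrite mem_enum => bD ->; rewrite map_f // mem_enum !inE.
    by rewrite mnmDE cone_mnmE bD addn1.
  rewrite /pl_poly mulr_sumr raddf_sum /=.
  (* The values of l on the unit vectors are the coefficients u and v. *)
  pose el (e : E) : {ffun E -> R^o} := [ffun i => (i == e)%:R].
  have indE (F : {set E}) : indicator R F = \sum_(e in F) el e.
    apply/ffunP => i; rewrite sum_ffunE ffunE.
    rewrite -(set_sum_delta R i F) /set_sum; apply: eq_bigr => e _.
    by rewrite ffunE eq_sym.
  pose u e : R := l (el e, 0); pose v e : R := l (0, el e).
  have lu F : set_sum u F = l (indicator R F, 0).
    have -> : ((indicator R F, 0) : ambient R E) = \sum_(e in F) ((el e, 0) : ambient R E).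
      rewrite indE (big_morph (fun z => (z, 0) : ambient R E) (id1 := 0) (op1 := +%R)) //.
      by move=> y1 y2; congr (_, _); rewrite addr0.
    by rewrite linear_sum.
  have lv F : set_sum v F = l (0, indicator R F).
    have -> : ((0, indicator R F) : ambient R E) = \sum_(e in F) ((0, el e) : ambient R E).
      rewrite indE (big_morph (fun z => (0, z) : ambient R E) (id1 := 0) (op1 := +%R)) //.
      by move=> y1 y2; congr (_, _); rewrite addr0.
    by rewrite linear_sum.
  pose L (i : 'I_N) : R := l (ray R (enum_val i : biflat M)).
  have linL : linear_weights L.
    case: ldesc => l1 l2; exists u, v; split; rewrite ?lu ?lv // => b.
    rewrite /L enum_rankK /pair_value lu lv -linearD /ray; congr (l _).
    by congr (_, _); rewrite ?addr0 ?add0r.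
  rewrite -[RHS](phi_lin m L linL) [RHS](reindex (@enum_rank (biflat M))) /=; last first.
    by apply: onW_bij; exists enum_val; [exact: enum_rankK | exact: enum_valK].
  apply: eq_bigr => b _; rewrite /L enum_rankK -scalerAr linearZ /= /ray_var.
  by rewrite -mpolyXD mlinearX.
have reprE (z : A) : mlinear phi (repr (chow_class z)) = mlinear phi z.
  apply/eqP; rewrite -subr_eq0 -raddfB; apply/eqP/kill/chow_class_eq0.
  by rewrite rmorphB /= {1}/chow_class reprK subrr.
exists (fun a => mlinear phi (repr a)); split.
  move=> c _ _ [y _ ->] [z _ ->].
  by rewrite chow_class_scale -rmorphD !reprE linearP.
move=> D fD sD; rewrite reprE cone_monomialE mlinearX phi_sqf //.
- apply/forallP => i; rewrite -(enum_valK i) cone_mnmE; exact: leq_b1.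
- by rewrite /face cone_mnm_support.
- by rewrite mdeg_cone_mnm.
Qed.

(** A functional as in [is_cap] is controlled only on the top graded piece. The model therefore
    lives on the polynomial ring, where the component of top degree is taken before applying
    [phi]. *)
Lemma cap_model (phi : chow R M -> R) : is_cap #|E|.-2 (fun=> 1) phi ->
  exists deg : {additive A -> R}, degree_model T r s (pair_var R M) deg /\
    forall z : A, z \is #|E|.-2.-homog -> deg z = phi (chow_class z).
Proof.
set k := #|E|.-2 => -[phi_lin phi_w].
pose degf (z : A) : R := phi (chow_class (pihomog mdeg k z)).
have gr (z : A) : chow_graded k (chow_class (pihomog mdeg k z) : chow R M).
  by exists (pihomog mdeg k z) => //; apply: pihomogP.
have degB : zmod_morphism degf.
  move=> y z; rewrite /degf linearB /= rmorphB /= addrC -scaleN1r.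
  by rewrite phi_lin // mulN1r addrC.
pose deg : {additive A -> R} :=
  HB.pack degf (GRing.isZmodMorphism.Build A R degf degB).
have deg0 (a g : A) e : g \is e.-homog -> chow_class g = 0 :> chow R M -> deg (a * g) = 0.
  move=> hg g0; have [a' ea] := pihomog_mul k a hg.
  rewrite -[LHS]/(phi (chow_class (pihomog mdeg k (a * g)))) ea rmorphM /= g0 mulr0.
  transitivity (deg 0); last exact: raddf0.
  by rewrite -[RHS]/(phi (chow_class (pihomog mdeg k 0))) raddf0 rmorph0.
have prod_seq (t : seq pair) : {in t, forall p, is_biflat M p} ->
    exists t' : seq (biflat M), t = map val t'.
  elim: t => [|p t IH] bt; first by exists [::].
  have [t' ->] : exists t' : seq (biflat M), t = map val t'.
    by apply: IH => q qt; apply: bt; rewrite inE qt orbT.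
  have bp : is_biflat M p by apply: bt; rewrite inE eqxx.
  by exists ((exist _ p bp : biflat M) :: t').
exists deg; split; last by move=> z hz; rewrite -[LHS]/(phi (chow_class (pihomog mdeg k z))) pihomog_dE.
split.
- move=> a t nf; have [bt|] := boolP (all (is_biflat M) t); last first.
    case/allPn => p pt np; suff -> : \prod_(q <- t) pair_var R M q = 0 by rewrite mulr0 raddf0.
    by rewrite (big_rem p pt) /= {1}/pair_var insubN // mul0r.
  have [t' et] := prod_seq t (allP bt).
  pose D : {set biflat M} := [set b in t'].
  have memD : map val (enum D) =i t.
    move=> p; rewrite et; apply/mapP/mapP => -[b bD ->]; exists b => //.
      by move: bD; rewrite mem_enum inE.
    by rewrite mem_enum inE.
  have nD : ~~ is_flag D by rewrite flag_is_flag // (flag_eq_mem M memD).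
  (* A monomial with repetitions is a multiple of the squarefree monomial of its support. *)
  have [y ey] : exists y : A, \prod_(p <- t) pair_var R M p = y * cone_monomial R D.
    rewrite et big_map (eq_bigr (fun b => ray_var R b)) => [|b _]; last exact: pair_var_val.
    have ut : uniq (undup t') by apply: undup_uniq.
    have -> : cone_monomial R D = \prod_(b <- undup t') ray_var R b.
      rewrite (big_uniq _ ut) /= /cone_monomial; apply: eq_bigl => b.
      by rewrite inE mem_undup.
    elim: t' {et D memD nD ut} => [|b t' [y ey]]; first by exists 1; rewrite !big_nil mulr1.
    rewrite /= big_cons ey; case: ifP => _; first by exists (ray_var R b * y); rewrite mulrA.
    by exists y; rewrite big_cons mulrCA.
  rewrite ey mulrA; apply: (deg0 _ _ (mdeg (cone_mnm D))).
    by rewrite cone_monomialE dhomogX.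
  apply/chow_class_ideal/asboolP; exists [:: (1, cone_monomial R D)].
    move=> q; rewrite inE => /eqP-> /=; left; exists D => //; rewrite nD andbT.
    apply: contra nD => /eqP->; rewrite flag_is_flag // enum_set0 /=.
    have /card_gt0P[e _] := E0; apply/and3P; split=> //; apply/set0Pn; exists e.
    by rewrite inE loops0 coloops0 !inE.
  by rewrite big_seq1 mul1r.
- move=> a i j _ _ _ _; apply/eqP; rewrite -subr_eq0 -raddfB -mulrBr; apply/eqP.
  rewrite !sum_pair_var -pl_poly_fst.
  by apply: (deg0 _ _ 1); [exact: pl_poly_homog | exact: chow_class_fst].
- move=> a i j _ _ _ _; apply/eqP; rewrite -subr_eq0 -raddfB -mulrBr; apply/eqP.
  rewrite !sum_pair_var -pl_poly_snd.
  by apply: (deg0 _ _ 1); [exact: pl_poly_homog | exact: chow_class_snd].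
- move=> t ft ut st.
  have [t' et] := prod_seq t (fun p pt => flag_biflat ll cl ft pt).
  have ut' : uniq t' by move: ut; rewrite et map_inj_uniq //; apply: val_inj.
  pose D : {set biflat M} := [set b in t'].
  have memD : map val (enum D) =i t.
    move=> p; rewrite et; apply/mapP/mapP => -[b bD ->]; exists b => //.
      by move: bD; rewrite mem_enum inE.
    by rewrite mem_enum inE.
  have eD : \prod_(p <- t) pair_var R M p = cone_monomial R D.
    rewrite et big_map (eq_bigr (fun b => ray_var R b)) => [|b _]; last exact: pair_var_val.
    by rewrite (big_uniq _ ut') /= /cone_monomial; apply: eq_bigl => b; rewrite inE.
  have sD : #|D| = k.
    rewrite /k -subn2 -cardsT -st et size_map cardsE; exact/card_uniqP.
  rewrite eD -[LHS]/(phi (chow_class (pihomog mdeg k (cone_monomial R D)))).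
  rewrite pihomog_dE; last first.
    by rewrite cone_monomialE dhomogX /= mdeg_cone_mnm sD.
  by rewrite phi_w // flag_is_flag // (flag_eq_mem M memD).
Qed.

End DegreeExists.

(** * Coefficients of the reduced characteristic polynomial *)

Lemma degree_reduced_coef (R : realType) (E : finType) (M : matroid E) k i j :
    loopless M -> coloopless M -> (k < rank M setT)%N ->
  degree (gamma R M i ^+ k * delta R M j ^+ (#|E|.-2 - k))
    = (reduced_coef setT (rank M) k)%:~R.
Proof.
move=> ll cl kr; have d := rank_dual_ranks M; have [rP sP _] := d.
have loops0 := loopless_closure ll; have coloops0 := loopless_closure cl.
have E0 : (0 < #|E|)%N by apply/card_gt0P; exists i.
have kE : (k <= #|E|.-2)%N.
  have := dual_total d; rewrite cardsT => rs.
  have : (0 < rank (dual_matroid M) setT)%N.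
    apply: leq_trans (rank_mono sP (subsetT [set i])).
    by rewrite lt0n -(mem_loops sP (in_setT i)) coloops0 inE.
  by nlia.
(* By [cap_exists], the default branch of [cap] does not occur. *)
have is_capP : is_cap #|E|.-2 (fun=> 1) (@degree R E M).
  rewrite /degree /cap; case: pselect => [h|[]]; first exact: (projT2 (cid h)).
  exact: cap_exists.
have [deg [mod degE]] := cap_model ll cl E0 is_capP.
rewrite !gamma_class // !delta_class // -!rmorphXn -rmorphM /= -degE.
  have gi a : deg (a * gamma_elt setT (pair_var R M) i) = deg (a * gamma_elt setT (pair_var R M) j).
    by apply: (gamma_elt_indep mod); rewrite ?loops0 ?inE.
  have := @deg_exp2_congr _ _ deg _ (delta_elt (pair_var R M) j) _ _ k (#|E|.-2 - k) 1 gi (fun=> erefl).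
  rewrite !mul1r => ->; rewrite -subn2 -cardsT.
  by apply: (degree_gamma_delta d) => //; rewrite ?coloops0 ?inE // cardsT subn2.
rewrite -[X in X.-homog](subnKC kE) -[X in (X + _)%N]mul1n -[X in (_ + X)%N]mul1n.
by apply: dhomogM; apply: dhomogMn; apply: rpred_sum => p _; apply: pair_var_homog.
Qed.

(** This is the value of the characteristic polynomial at 1, the signed count of all subsets of
    X. *)
Lemma shifted_charpoly_coef0 (E : finType) (X : {set E}) (r : {set E} -> nat) j :
  j \in X -> (shifted_charpoly X r)`_0 = 0.
Proof.
move=> jX; rewrite /shifted_charpoly coef_sum.
have coef1 m : (('X + 1 : {poly int}) ^+ m)`_0 = 1.
  by rewrite -horner_coef0 !hornerE expr1n.
under eq_bigr do rewrite coefZ coef1 mulr1.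
rewrite (sum_subsets_split _ jX) big1 // => A; rewrite subsetD1 => /andP[_ jA].
by rewrite cardsU1_notin // subrr.
Qed.

Theorem theorem1p2 (R : realType) (E : finType) (M : matroid E) (n r : nat)
    (n_ge1 : (1 <= n)%N) (cardE : #|E| = n.+1) (rankM : rank M [set: E] = r.+1)
    (noloops : loopless M) (nocoloops : coloopless M) (i j : E) :
  reduced_matroid_charpoly R M \Po ('X + 1) =
    \sum_(k < r.+1)
      ((-1) ^+ (r - k) * degree (gamma R M i ^+ k * delta R M j ^+ (n - k - 1)))
        *: 'X^k.
Proof.
set Q := RHS.
have rP := rank_rank_axioms M; have ll := loopless_closure noloops.
(* After the shift, division by q - 1 becomes division by q, and coefficients can be compared one by
   one. *)
have shiftE : matroid_charpoly R M \Po ('X + 1) = Q * 'X.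
  rewrite charpoly_shift // /Q mulr_suml; apply/polyP => k.
  under eq_bigr => l _ do rewrite -scalerAl -exprSr.
  rewrite coef_map [RHS]coef_sum; under [RHS]eq_bigr do rewrite coefZ coefXn.
  case: k => [|k].
    rewrite (@shifted_charpoly_coef0 _ _ _ i) ?inE // raddf0 big1 // => l _.
    by rewrite mulr0.
  have [kr|rk] := ltnP k r.+1; last first.
    rewrite shifted_charpoly_coef ?rankM ?gtn_eqF ?(leqW rk) //.
    rewrite raddf0 big1 // => l _; rewrite eqSS gtn_eqF ?mulr0 //.
    exact: leq_trans (ltn_ord l) rk.
  rewrite (bigD1 (Ordinal kr)) //= eqxx mulr1 big1 ?addr0 => [|l]; last first.
    by rewrite eqSS -val_eqE eq_sym => /negbTE /= ->; rewrite mulr0.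
  have -> : (n - k - 1 = #|E|.-2 - k)%N by rewrite cardE /=; nlia.
  rewrite degree_reduced_coef ?rankM // /reduced_coef rankM rmorphM rmorphXn rmorphN1.
  (* The sign in [reduced_coef] has the parity of r - k, so it cancels the sign of the statement. *)
  have -> : (r.+1 + k.+1 = (r - k) + (k.+1).*2)%N by rewrite -addnn; nlia.
  by rewrite exprD -[(_.*2)]mul2n exprM sqrrN !expr1n mulr1 mulrA -expr2 sqrr_sign mul1r.
have chE : matroid_charpoly R M = (Q \Po ('X - 1)) * ('X - 1).
  have := congr1 (fun q => q \Po ('X - 1)) shiftE.
  by rewrite comp_polyM -comp_polyA comp_polyX comp_polyD comp_polyX comp_polyC subrK comp_polyXr.
rewrite /reduced_matroid_charpoly chE mulpK ?polyXsubC_eq0 //.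
by rewrite -comp_polyA comp_polyB comp_polyX comp_polyC addrK comp_polyXr.
Qed.
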